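(* For generic camera arrangements of $n$ cameras and generic anchoring lines, the different possible values of the multidegree function $D$ (which is symmetric in its arguments) are as follows. 1. For $\mathcal{M}^{N,h}$ with $(N,h)\in\{(3,3),(3,2),(3,1),(2,2),(2,1),(1,1)\}$: $D$ is constant equal to $1$. 2. For $\mathcal{L}^{L^\gamma,3,3}$ with $\gamma\in\{0,1,2,3\}$: $D$ is constant equal to $2$. 3. For $\mathcal{L}^{3,2}$: $D(2,2,0,\dots,0)=1$, $D(2,1,1,0,\dots,0)=1$, $D(1,1,1,1,0,\dots,0)=2$. 4. For $\mathcal{L}^{L,3,2}$: $D(2,1,0,\dots,0)=1$, $D(1,1,1,0,\dots,0)=2$. 5. For $\mathcal{L}^{L^2,3,2}$: $D(2,0,\dots,0)=1$, $D(1,1,0,\dots,0)=2$. 6. For $\mathcal{L}^{L^3,3,2}$: $D(1,0,\dots,0)=2$. (Each displayed tuple has $n$ entries.)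
   Context: Work over $\mathbb{C}$. A camera is a full-rank $(h+1)\times(N+1)$ matrix; an arrangement is $\mathbf{C}=(C_1,\dots,C_n)$, all of the same size. $\mathcal{M}^{N,h}$ refers to the Zariski closure of the image of $\mathbb{P}^N\dashrightarrow(\mathbb{P}^h)^n$, $X\mapsto(C_1X,\dots,C_nX)$. For $\gamma\in\{0,1,2,3\}$, let $\Lambda\subseteq\mathrm{Gr}(1,\mathbb{P}^3)$ be the set of lines meeting each of $\gamma$ fixed pairwise disjoint lines in $\mathbb{P}^3$ ($\Lambda=\mathrm{Gr}(1,\mathbb{P}^3)$ if $\gamma=0$). $\mathcal{L}^{L^\gamma,3,h}$ refers to the Zariski closure of the image of $\Lambda\dashrightarrow\mathrm{Gr}(1,\mathbb{P}^h)^n$, $E\mapsto(C_1\cdot E,\dots,C_n\cdot E)$, where $C\cdot E$ is the line spanned by the images under $C$ of two points spanning $E$. Write $L=L^1$ and $\mathcal{L}^{3,h}=\mathcal{L}^{L^0,3,h}$. Via the Plücker embedding, $\mathrm{Gr}(1,\mathbb{P}^3)\subseteq\mathbb{P}^5$ and $\mathrm{Gr}(1,\mathbb{P}^2)\cong\mathbb{P}^2$, so these varieties lie in $(\mathbb{P}^5)^n$ for $h=3$ and in $(\mathbb{P}^2)^n$ for $h=2$. The multidegree of $\mathcal{X}\subseteq\mathbb{P}^{m_1}\times\cdots\times\mathbb{P}^{m_n}$ is the function $$D(d_1,\dots,d_n)=\#\big(\mathcal{X}\cap(L_{d_1}^{(1)}\times\cdots\times L_{d_n}^{(n)})\big),$$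 defined for $(d_1,\dots,d_n)\in\mathbb{N}^n$ with $d_1+\cdots+d_n=\dim\mathcal{X}$ and $d_i\le m_i$, where $L_{d_i}^{(i)}\subseteq\mathbb{P}^{m_i}$ is a general linear subspace of codimension $d_i$. *)

(* Defs.v *)
From mathcomp Require Import all_boot all_order all_algebra.
From mathcomp Require Import mpoly.
From mathcomp Require Import classical_sets cardinality reals complex.

Set Implicit Arguments.
Unset Strict Implicit.
Unset Printing Implicit Defensive.

Import GRing.Theory.
Local Open Scope classical_set_scope.
Local Open Scope card_scope.
Local Open Scope ring_scope.

(* The base field is an arbitrary fieldType K in this file;
   the theorem is stated for K = R[i] with R a realType. *)

Section Defs.
Variable K : fieldType.

(* Grassmannian of r-dimensional vector subspaces of K^m. *)
Definition grass (r m : nat) := {U : {vspace 'cV[K]_m} | \dim U == r}.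

(* pspace m is P^(m-1) (the index is the number of homogeneous coordinates)
   and lines m is Gr(1, P^(m-1)). *)
Notation pspace := (grass 1).
Notation lines := (grass 2).

(* (P^(m-1))^n *)
Definition mpspace (n m : nat) := 'I_n -> pspace m.

(** Zariski topology on (P^(m-1))^n *)

(* The variable of index enum_rank (i, j) is the j-th homogeneous coordinate
   of the i-th factor. *)
Definition mform (n m : nat) := {mpoly K[#|{: 'I_n * 'I_m}|]}.

Definition multihomogeneous n m (p : mform n m) : Prop :=
  exists e : 'I_n -> nat, forall mon, mon \in msupp p ->
    forall i, (\sum_(j < m) mon (enum_rank (i, j)))%N = e i.

(* Evaluation at the representatives vpick (val (x i)) of the points x i; for
   multihomogeneous p, vanishing does not depend on the representatives. *)
Definition vanishes_at n m (p : mform n m) (x : mpspace n m) : Prop :=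
  p.@[fun k => let ij := enum_val k in vpick (val (x ij.1)) ij.2 0] = 0.

Definition zclosed n m (Z : set (mpspace n m)) : Prop :=
  exists F : set (mform n m),
    (forall p, F p -> multihomogeneous p) /\
    Z = [set x | forall p, F p -> vanishes_at p x].

Definition zclosure n m (S : set (mpspace n m)) : set (mpspace n m) :=
  [set x | forall Z, zclosed Z -> S `<=` Z -> Z x].

(* Irreducible closed subsets. *)
Definition zirreducible n m (Z : set (mpspace n m)) : Prop :=
  [/\ zclosed Z, Z !=set0 &
    forall A B, zclosed A -> zclosed B -> Z `<=` A `|` B ->
      Z `<=` A \/ Z `<=` B].

(* There is a chain Z_0 < ... < Z_k of irreducible closed subsets of X. *)
Definition has_chain n m (X : set (mpspace n m)) (k : nat) : Prop :=
  exists Z : nat -> set (mpspace n m),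
    (forall i, (i <= k)%N -> zirreducible (Z i) /\ Z i `<=` X) /\
    (forall i, (i < k)%N -> Z i `<` Z i.+1).

Definition dim_is n m (X : set (mpspace n m)) (k : nat) : Prop :=
  has_chain X k /\ forall l, has_chain X l -> (l <= k)%N.

(** Genericity *)

(* P holds on a nonempty Zariski open subset of the affine space K^I; since
   the complements of hypersurfaces form a basis of the topology, one nonzero
   polynomial suffices.  (Meant for infinite K.) *)
Definition generically (I : finType) (P : (I -> K) -> Prop) : Prop :=
  exists2 p : {mpoly K[#|I|]}, p != 0 &
    forall a : I -> K, p.@[fun k => a (enum_val k)] != 0 -> P a.

(** Multidegree *)

(* The linear subspace {x | A x = 0} of P^(m-1). *)
Definition linspace c m (A : 'M[K]_(c, m)) : set (pspace m) :=
  [set x | (val x <= lker (linfun (mulmx A)))%VS].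

(* The domain of the multidegree function D of X; the condition d i < m is
   d_i <= m_i, as m_i = m - 1. *)
Definition multideg_dom n m (X : set (mpspace n m)) (d : 'I_n -> nat) : Prop :=
  dim_is X (\sum_i d i)%N /\ forall i, (d i < m)%N.

(* D(d) = k.  A general subspace of codimension c is the zero space of a
   general full-rank c x m matrix: sending such a matrix to its zero space is
   an open surjection onto the Grassmannian, so that nonempty open sets of
   matrices and of subspaces correspond to each other. *)
Definition multideg n m (X : set (mpspace n m)) (d : 'I_n -> nat) (k : nat)
    : Prop :=
  multideg_dom X d /\
  generically (fun a : {i : 'I_n & ('I_(d i) * 'I_m)%type} -> K =>
    let A := fun i : 'I_n => \matrix_(r < d i, c < m)
      a (Tagged (fun i => ('I_(d i) * 'I_m)%type) (r, c)) in
    (forall i, \rank (A i) = d i) ->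
    X `&` [set x | forall i, linspace (A i) (x i)] #= `I_k).

Definition multideg_constant n m (X : set (mpspace n m)) (k : nat) : Prop :=
  (exists d, multideg_dom X d) /\
  forall d, multideg_dom X d -> multideg X d k.

(* d is a permutation of the n-tuple (t, 0, ..., 0); false if t has more than
   n entries. *)
Definition is_perm_of n (d : 'I_n -> nat) (t : seq nat) : bool :=
  perm_eq (codom d) (t ++ nseq (n - size t) 0%N).

Definition multideg_at n m (X : set (mpspace n m)) (t : seq nat) (k : nat)
    : Prop :=
  forall d, is_perm_of d t -> multideg X d k.

(* Up to permutation, the domain of D contains no tuples but those in ts. *)
Definition multideg_only n m (X : set (mpspace n m)) (ts : seq (seq nat))
    : Prop :=
  forall d, multideg_dom X d -> has (is_perm_of d) ts.

(** Cameras and multiview varieties *)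

Definition is_camera N h (C : 'M[K]_(h.+1, N.+1)) : Prop :=
  \rank C = minn h.+1 N.+1.

Definition arrangement n N h := 'I_n -> 'M[K]_(h.+1, N.+1).

(* The subspace C . E, for a point or a line E. *)
Definition camera_img N h (C : 'M[K]_(h.+1, N.+1)) (E : {vspace 'cV[K]_N.+1})
    : {vspace 'cV[K]_h.+1} :=
  (linfun (mulmx C) @: E)%VS.

(* A point X is outside the domain of definition exactly when some image
   camera_img (C i) X is zero; no y then satisfies the condition. *)
Definition point_variety n N h (C : arrangement n N h)
    : set (mpspace n h.+1) :=
  zclosure [set y | exists X : pspace N.+1,
    forall i, val (y i) = camera_img (C i) (val X)].

Definition pairs m := {ij : 'I_m * 'I_m | (ij.1 < ij.2)%N}.

(* The number of Pluecker coordinates of Gr(1, P^(m-1)). *)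
Definition nplucker m := #|{: pairs m}|.

Lemma npluckerE m : nplucker m = (\sum_(i < m) \sum_(j < m) (i < j))%N.
Proof.
rewrite /nplucker card_sig -sum1_card pair_big /= big_mkcond /=.
by apply: eq_bigr => -[i j] _; rewrite inE /=; case: ltnP.
Qed.

Lemma nplucker3 : nplucker 3 = 3%N.
Proof. by rewrite npluckerE !big_ord_recl !big_ord0. Qed.

Lemma nplucker4 : nplucker 4 = 6%N.
Proof. by rewrite npluckerE !big_ord_recl !big_ord0. Qed.

Definition wedge m (u v : 'cV[K]_m) : 'cV[K]_(nplucker m) :=
  \col_(k < nplucker m) let ij := val (enum_val k) in
    u ij.1 0 * v ij.2 0 - u ij.2 0 * v ij.1 0.

Definition plucker m (E : lines m) : {vspace 'cV[K]_(nplucker m)} :=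
  let b := vbasis (val E) in <[wedge b`_0 b`_1]>%VS.

(* The lines of P^3 meeting all of the given lines. *)
Definition anchored_lines g (L : 'I_g -> lines 4) : set (lines 4) :=
  [set E | forall j, (val E :&: val (L j))%VS != 0%VS].

Definition line_variety n h g (C : arrangement n 3 h) (L : 'I_g -> lines 4)
    : set (mpspace n (nplucker h.+1)) :=
  zclosure [set y | exists2 E : lines 4, anchored_lines L E &
    forall i, exists2 F : lines h.+1,
      val F = camera_img (C i) (val E) & val (y i) = plucker F].

Definition generic_cameras n N h (P : arrangement n N h -> Prop) : Prop :=
  generically (fun a : 'I_n * 'I_h.+1 * 'I_N.+1 -> K =>
    let C := fun i => \matrix_(r, c) a (i, r, c) in
    (forall i, is_camera (C i)) -> P C).

(* Jointly generic cameras and g pairwise disjoint lines of P^3.  A generic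
   line is the column space of a generic 4 x 2 matrix: as for multideg, this
   parametrisation of Gr(1, P^3) is an open surjection. *)
Definition generic_anchored n h g
    (P : arrangement n 3 h -> ('I_g -> lines 4) -> Prop) : Prop :=
  generically
    (fun a : ('I_n * 'I_h.+1 * 'I_4) + ('I_g * 'I_4 * 'I_2) -> K =>
    let C := fun i => \matrix_(r, c) a (inl (i, r, c)) in
    let B := fun j => \matrix_(r < 4, c < 2) a (inr (j, r, c)) in
    forall L : 'I_g -> lines 4,
    (forall i, is_camera (C i)) ->
    (forall j, val (L j) = limg (linfun (mulmx (B j) : 'cV[K]_2 -> 'cV[K]_4))) ->
    (forall j k, j != k -> (val (L j) :&: val (L k) = 0)%VS) ->
    P C L).

End Defs.

(* Main.v *)
(* Lines of P^3 are the points of the Klein quadric in P^5. Through the second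
   exterior power of C_i, a general linear condition on the image line C_i . E
   becomes a linear form on P^5, and each anchoring line contributes one more
   form. In total there are four forms; their common zeros are a line of P^5,
   which meets the quadric in two points. If h = 2 and d_i = 2, the two forms of
   camera i determine the image line, and their common zeros on the quadric are
   the lines in its back-projected plane and the lines through the center of
   C_i. Each family contains one solution; the latter is excluded, as its image
   point does not lie on the given line, so that a single solution remains.
   For points of P^N the corresponding forms have one common zero.

   A linear system with a nonzero isotropic solution keeps one under Zariski
   closure, by elimination with maximal minors; this controls the points of the
   closure outside the image. The dimension is bounded below by a chain of linear
   slices and above by counting homogeneous relations. Genericity only requires
   that finitely many polynomials do not vanish at explicit configurations. *)

Require Import Defs.
From mathcomp Require Import all_boot all_order all_algebra.
From mathcomp Require Import perm mpoly ring zify.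
From mathcomp Require Import boolp classical_sets cardinality.
From mathcomp Require Import reals complex.

Set Implicit Arguments.
Unset Strict Implicit.
Unset Printing Implicit Defensive.

Import Order.TTheory GRing.Theory Num.Theory.

(** What makes the line case work is one determinant, that of the Gram matrix of the four forms for
    the Klein form. If it is nonzero, the Klein form stays nondegenerate on the common kernel of the
    four forms in [K^6], a hyperbolic plane. Its two isotropic lines are then distinct, and the
    orthogonal splitting of [K^6] makes the values of the four forms free parameters on the quadric,
    which yields the dimension as well as the sections. The obstacle is the closure: in the limit a
    solution [x] may be killed by the second exterior power of some camera, where proportionality to
    [y i] says nothing. The condition carried to the limit is therefore incidence: with [X] the skew
    matrix of [x], every column of [C i *m X] lies on the line [y i]. It is linear in [x], and it
    still confines the solution to a back-projected plane. Genericity is nested, since the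
    exceptional set of sections may depend on the cameras. Each condition is hence one function that
    is polynomial in both sets of data, and a single joint witness settles it. *)

Local Notation "''t' k" := (@Ordinal 3 k isT) (at level 8, k at level 2, format "''t' k").
Local Notation "''f' k" := (@Ordinal 4 k isT) (at level 8, k at level 2, format "''f' k").
Local Notation "''s' k" := (@Ordinal 6 k isT) (at level 8, k at level 2, format "''s' k").

(** * Polynomial functions and genericity *)

Section PolynomialFunctions.
Local Open Scope ring_scope.
Variable K : numFieldType.

(** Functions are used instead of polynomials so that determinants and products of matrices of data
    are handled pointwise, by closure properties. *)
Definition polyfun (I : finType) (f : (I -> K) -> K) : Prop :=
  exists p : {mpoly K[#|I|]}, forall a, f a = p.@[fun k => a (enum_val k)].

Section Closure.
Variable I : finType.
Implicit Types f g : (I -> K) -> K.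

Lemma polyfun_ext f g : f =1 g -> polyfun f -> polyfun g.
Proof. by move=> e [p pE]; exists p => a; rewrite -e. Qed.

Lemma polyfun_const c : polyfun (fun _ : I -> K => c).
Proof. by exists c%:MP => a; rewrite mevalC. Qed.

Lemma polyfun_coord i : polyfun (fun a : I -> K => a i).
Proof. by exists 'X_(enum_rank i) => a; rewrite mevalXU enum_rankK. Qed.

Lemma polyfunD f g : polyfun f -> polyfun g -> polyfun (fun a => f a + g a).
Proof. by move=> [p pE] [q qE]; exists (p + q) => a; rewrite mevalD pE qE. Qed.

Lemma polyfunM f g : polyfun f -> polyfun g -> polyfun (fun a => f a * g a).
Proof. by move=> [p pE] [q qE]; exists (p * q) => a; rewrite mevalM pE qE. Qed.

Lemma polyfunN f : polyfun f -> polyfun (fun a => - f a).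
Proof. by move=> [p pE]; exists (- p) => a; rewrite mevalN pE. Qed.

Lemma polyfunB f g : polyfun f -> polyfun g -> polyfun (fun a => f a - g a).
Proof. by move=> pf pg; apply: polyfunD => //; apply: polyfunN. Qed.

Lemma polyfun_sum (T : Type) (r : seq T) (P : pred T) (F : T -> (I -> K) -> K) :
  (forall t, P t -> polyfun (F t)) -> polyfun (fun a => \sum_(t <- r | P t) F t a).
Proof.
move=> pF; elim: r => [|t r IH].
  by apply: (polyfun_ext _ (polyfun_const 0)) => a; rewrite big_nil.
case Pt: (P t).
  by apply: (polyfun_ext _ (polyfunD (pF _ Pt) IH)) => a; rewrite big_cons Pt.
by apply: (polyfun_ext _ IH) => a; rewrite big_cons Pt.
Qed.

Lemma polyfun_prod (T : Type) (r : seq T) (P : pred T) (F : T -> (I -> K) -> K) :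
  (forall t, P t -> polyfun (F t)) -> polyfun (fun a => \prod_(t <- r | P t) F t a).
Proof.
move=> pF; elim: r => [|t r IH].
  by apply: (polyfun_ext _ (polyfun_const 1)) => a; rewrite big_nil.
case Pt: (P t).
  by apply: (polyfun_ext _ (polyfunM (pF _ Pt) IH)) => a; rewrite big_cons Pt.
by apply: (polyfun_ext _ IH) => a; rewrite big_cons Pt.
Qed.

Lemma polyfunX f k : polyfun f -> polyfun (fun a => f a ^+ k).
Proof.
move=> pf; elim: k => [|k IH].
  by apply: (polyfun_ext _ (polyfun_const 1)) => a; rewrite expr0.
by apply: (polyfun_ext _ (polyfunM pf IH)) => a; rewrite exprS.
Qed.

Lemma polyfun_meval r (p : {mpoly K[r]}) (g : 'I_r -> (I -> K) -> K) :
  (forall k, polyfun (g k)) -> polyfun (fun a => p.@[fun k => g k a]).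
Proof.
move=> pg; apply: (@polyfun_ext
  (fun a => \sum_(m <- msupp p) p@_m * \prod_i g i a ^+ m i)).
  by move=> a; rewrite mevalE.
apply: polyfun_sum => m _; apply: polyfunM; first exact: polyfun_const.
by apply: polyfun_prod => i _; apply: polyfunX.
Qed.

Lemma polyfun_mulmx m n p (A : (I -> K) -> 'M[K]_(m, n)) (B : (I -> K) -> 'M[K]_(n, p)) :
  (forall i j, polyfun (fun a => A a i j)) ->
  (forall i j, polyfun (fun a => B a i j)) ->
  forall i j, polyfun (fun a => (A a *m B a) i j).
Proof.
move=> pA pB i j; apply: (@polyfun_ext (fun a => \sum_k A a i k * B a k j)).
  by move=> a; rewrite mxE.
by apply: polyfun_sum => k _; apply: polyfunM.
Qed.

Lemma polyfun_det n (A : (I -> K) -> 'M[K]_n) :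
  (forall i j, polyfun (fun a => A a i j)) -> polyfun (fun a => \det (A a)).
Proof.
move=> pA; apply: polyfun_sum => s _; apply: polyfunM; first exact: polyfun_const.
by apply: polyfun_prod => i _.
Qed.

Lemma polyfun_line f a b : polyfun f ->
  exists P : {poly K}, forall s, f (fun i => a i + s * (b i - a i)) = P.[s].
Proof.
case=> p pE; exists (\sum_(m <- msupp p) p@_m *:
   \prod_k ((a (enum_val k))%:P + 'X * (b (enum_val k) - a (enum_val k))%:P) ^+ m k).
move=> s; rewrite pE mevalE horner_sum; apply: eq_bigr => m _.
rewrite hornerZ horner_prod; congr (_ * _); apply: eq_bigr => k _.
by rewrite horner_exp !hornerE.
Qed.

End Closure.

Lemma poly_nonroot (P : {poly K}) : P != 0 -> exists s, P.[s] != 0.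
Proof.
move=> P0; apply: contrapT => H.
(* In characteristic 0 the naturals below [size P] are distinct, and they are one too many to be all
   roots. *)
have /(_ _ _)/negP := @max_poly_roots K P [seq i%:R | i <- iota 0 (size P)] P0.
rewrite size_map size_iota ltnn; apply => //.
  apply/allP => x _; apply/rootP; apply: contrapT => /eqP Px; by apply: H; exists x.
by rewrite map_inj_uniq ?iota_uniq //; apply: mulrIn; rewrite oner_eq0.
Qed.

(** On the line through [a] and [b] both functions are nonzero univariate polynomials. The common
    nonvanishing point is found on that line, hence in every linear subspace containing [a] and [b];
    this plays the role of the irreducibility of such subspaces. *)
Lemma polyfun_two_nonzero (I : finType) (f g : (I -> K) -> K) a b :
  polyfun f -> polyfun g -> f a != 0 -> g b != 0 ->
  exists s, let c := fun i => a i + s * (b i - a i) in f c != 0 /\ g c != 0.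
Proof.
move=> /(polyfun_line a b)[P PE] /(polyfun_line a b)[Q QE] fa gb.
have P0 : P != 0.
  apply: contraNneq fa => P0; have := PE 0; rewrite P0 horner0 => <-.
  by apply/eqP; congr f; apply/funext => i; rewrite mul0r addr0.
have Q0 : Q != 0.
  apply: contraNneq gb => Q0; have := QE 1; rewrite Q0 horner0 => <-.
  by apply/eqP; congr g; apply/funext => i; rewrite mul1r addrC subrK.
have [s] := poly_nonroot (mulf_neq0 P0 Q0).
by rewrite hornerM mulf_eq0 negb_or => /andP[Ps Qs]; exists s; rewrite /= PE QE.
Qed.

(** Nonvanishing is certified by a point instead of a nonzero polynomial: explicit configurations
    serve directly as certificates, and a generic condition is visibly satisfiable. *)
Definition gen (I : finType) (P : (I -> K) -> Prop) : Prop :=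
  exists f, [/\ polyfun f, exists a, f a != 0 & forall a, f a != 0 -> P a].

Section Gen.
Variable I : finType.
Implicit Types P Q : (I -> K) -> Prop.

Lemma gen_generically P : gen P -> generically P.
Proof.
case=> f [[p pE] [a fa] fP]; exists p.
  by apply: contraNneq fa => p0; rewrite pE p0 meval0.
by move=> c pc; apply: fP; rewrite pE.
Qed.

Lemma gen_ex P : gen P -> exists a, P a.
Proof. by case=> f [_ [a fa] fP]; exists a; apply: fP. Qed.

Lemma gen_mono P Q : (forall a, P a -> Q a) -> gen P -> gen Q.
Proof. by move=> PQ [f [pf ef fP]]; exists f; split=> // a /fP/PQ. Qed.

Lemma genT P : (forall a, P a) -> gen P.
Proof.
move=> PT; exists (fun _ => 1); split=> //; first exact: polyfun_const.
by exists (fun _ => 0); rewrite oner_eq0.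
Qed.

Lemma gen_and P Q : gen P -> gen Q -> gen (fun a => P a /\ Q a).
Proof.
case=> f [pf [a fa] fP] [g [pg [b gb] gQ]].
exists (fun c => f c * g c); split; first exact: polyfunM.
  have [s /= [fs gs]] := polyfun_two_nonzero pf pg fa gb.
  by eexists; rewrite mulf_neq0 //; [exact: fs|exact: gs].
by move=> c; rewrite mulf_eq0 negb_or => /andP[/fP ? /gQ].
Qed.

Lemma gen_forall (T : finType) (P : T -> (I -> K) -> Prop) :
  (forall t, gen (P t)) -> gen (fun a => forall t, P t a).
Proof.
move=> gP; suff: gen (fun a => forall t, t \in enum T -> P t a).
  by apply: gen_mono => a H t; apply: H; rewrite mem_enum.
elim: (enum T) => [|t s IH]; first exact: genT.
apply: gen_mono (gen_and (gP t) IH) => a [Pt Ps] u.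
by rewrite inE => /orP[/eqP->|/Ps].
Qed.

Lemma gen_imp (b : Prop) P : (b -> gen P) -> gen (fun a => b -> P a).
Proof.
move=> gP; have [/gP|nb] := pselect b; last by apply: genT.
exact: gen_mono.
Qed.

Lemma gen_nonzero (f : (I -> K) -> K) : polyfun f -> (exists a, f a != 0) -> gen (fun a => f a != 0).
Proof. by move=> pf ef; exists f. Qed.

End Gen.

(** One joint witness [(a, b)] suffices: every [c] with [f c b != 0] has [b] itself as witness for
    the inner condition. *)
Lemma gen2_nonzero (I J : finType) (f : (I -> K) -> (J -> K) -> K) :
  (forall b, polyfun (f ^~ b)) -> (forall a, polyfun (f a)) ->
  (exists a b, f a b != 0) -> gen (fun a => gen (fun b => f a b != 0)).
Proof.
move=> pf1 pf2 [a [b fab]].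
apply: gen_mono (gen_nonzero (pf1 b) _); last by exists a.
by move=> c fcb; apply: gen_nonzero => //; exists b.
Qed.

End PolynomialFunctions.

(** * Multihomogeneous forms and Zariski closures *)

Section Multihomogeneous.
Local Open Scope classical_set_scope.
Local Open Scope ring_scope.
Variable K : numFieldType.

Section Fixed.
Variables n m : nat.
Implicit Types (p q : mform K n m) (e : 'I_n -> nat) (v : 'I_n -> 'cV[K]_m).
Implicit Types (x y : mpspace K n m) (Z S : set (mpspace K n m)).

(** Evaluation at arbitrary vectors, so that a parametrisation need not hit the chosen
    representatives [rep]. *)
Definition evm p v : K := p.@[fun k => v (enum_val k).1 (enum_val k).2 0].

Definition rep x (i : 'I_n) : 'cV[K]_m := vpick (val (x i)).

Definition mhom e p : Prop := forall mon, mon \in msupp p ->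
  forall i, (\sum_(j < m) mon (enum_rank (i, j)))%N = e i.

Lemma mhom_multihomogeneous e p : mhom e p -> multihomogeneous p.
Proof. by exists e. Qed.

Lemma mhom_eq e e' p : e =1 e' -> mhom e p -> mhom e' p.
Proof. by move=> ee h mon /h H i; rewrite -ee. Qed.

Lemma mhom0 e : mhom e 0.
Proof. by move=> mon; rewrite msupp0. Qed.

Lemma mhom1 : mhom (fun=> 0%N) 1.
Proof.
by move=> mon; rewrite msupp1 inE => /eqP-> i; apply: big1 => j _; rewrite mnm0E.
Qed.

Lemma mhomX ij : mhom (fun i => (i == ij.1) : nat) 'X_(enum_rank ij).
Proof.
move=> mon; rewrite msuppX inE => /eqP-> i; case: ij => i0 j0 /=.
rewrite (bigD1 j0) //= big1 => [|j jj]; rewrite mnmE (inj_eq enum_rank_inj) xpair_eqE.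
  by rewrite eqxx andbT addn0 eq_sym.
by rewrite [j0 == j]eq_sym (negbTE jj) andbF.
Qed.

Lemma mhomD e p q : mhom e p -> mhom e q -> mhom e (p + q).
Proof.
by move=> hp hq mon /msuppD_le; rewrite mem_cat => /orP[/hp|/hq].
Qed.

Lemma mhomZ e c p : mhom e p -> mhom e (c *: p).
Proof. by move=> hp mon /msuppZ_le /hp. Qed.

Lemma mhomM e1 e2 p q : mhom e1 p -> mhom e2 q -> mhom (fun i => (e1 i + e2 i)%N) (p * q).
Proof.
move=> hp hq mon /msuppM_le /allpairsP[[m1 m2] /= [/hp h1 /hq h2 ->]] i.
by rewrite -h1 -h2 -big_split; apply: eq_bigr => j _; rewrite mnmDE.
Qed.

Lemma mhom_sum e (T : Type) (r : seq T) (P : pred T) (F : T -> mform K n m) :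
  (forall t, P t -> mhom e (F t)) -> mhom e (\sum_(t <- r | P t) F t).
Proof.
by move=> h; elim/big_ind: _ => //; [exact: mhom0|move=> *; apply: mhomD].
Qed.

Lemma mhom_prod (T : Type) (r : seq T) (P : pred T) (E : T -> 'I_n -> nat)
    (F : T -> mform K n m) :
  (forall t, P t -> mhom (E t) (F t)) ->
  mhom (fun i => \sum_(t <- r | P t) E t i)%N (\prod_(t <- r | P t) F t).
Proof.
move=> h; elim: r => [|t r IH].
  by rewrite big_nil; apply: mhom_eq mhom1 => i; rewrite big_nil.
rewrite big_cons; case Pt: (P t).
  by apply: mhom_eq (mhomM (h _ Pt) IH) => i; rewrite big_cons Pt.
by apply: mhom_eq IH => i; rewrite big_cons Pt.
Qed.

Lemma mhom_exp e p k : mhom e p -> mhom (fun i => k * e i)%N (p ^+ k).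
Proof.
move=> hp; elim: k => [|k IH]; first by rewrite expr0; apply: mhom_eq mhom1.
by rewrite exprS; apply: mhom_eq (mhomM hp IH) => i; rewrite mulSn.
Qed.

Lemma mhom_det k (E : 'I_k -> 'I_n -> nat) (A : 'M[mform K n m]_k) :
  (forall r c, mhom (E r) (A r c)) ->
  mhom (fun i => \sum_r E r i)%N (\det A).
Proof.
move=> h; apply: mhom_sum => s _.
have: mhom (fun i => \sum_r E r i)%N (\prod_r A r (s r)) by apply: mhom_prod.
by rewrite -signr_odd; case: odd; rewrite ?expr0 ?expr1 ?mul1r ?mulN1r // -scaleN1r => /mhomZ.
Qed.

Lemma evm_sum (T : Type) (r : seq T) (P : pred T) (F : T -> mform K n m) v :
  evm (\sum_(t <- r | P t) F t) v = \sum_(t <- r | P t) evm (F t) v.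
Proof. exact: raddf_sum. Qed.

Lemma evm_prod (T : Type) (r : seq T) (P : pred T) (F : T -> mform K n m) v :
  evm (\prod_(t <- r | P t) F t) v = \prod_(t <- r | P t) evm (F t) v.
Proof. exact: rmorph_prod. Qed.

Lemma evmM p q v : evm (p * q) v = evm p v * evm q v.
Proof. exact: mevalM. Qed.

Lemma evmX p k v : evm (p ^+ k) v = evm p v ^+ k.
Proof. exact: rmorphXn. Qed.

Lemma evmZ c p v : evm (c *: p) v = c * evm p v.
Proof. exact: mevalZ. Qed.

Lemma evm_var ij v : evm 'X_(enum_rank ij) v = v ij.1 ij.2 0.
Proof. by rewrite /evm mevalXU enum_rankK. Qed.

Lemma evm_det k (A : 'M[mform K n m]_k) v :
  evm (\det A) v = \det (map_mx (evm^~ v) A).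
Proof. by rewrite /evm -(det_map_mx (meval _)). Qed.

Lemma evm_scale e p v (c : 'I_n -> K) : mhom e p ->
  evm p (fun i => c i *: v i) = (\prod_i c i ^+ e i) * evm p v.
Proof.
move=> hp; rewrite /evm !mevalE big_distrr /= big_seq [RHS]big_seq; apply: eq_bigr => mon /hp wt.
rewrite mulrCA; congr (_ * _).
under eq_bigr do rewrite mxE exprMn.
rewrite big_split /=; congr (_ * _).
rewrite (reindex (@enum_rank {: 'I_n * 'I_m})) /=; last exact: onW_bij (enum_rank_bij _).
under eq_bigr do rewrite enum_rankK.
transitivity (\prod_i \prod_(j < m) c i ^+ mon (enum_rank (i, j))).
  by rewrite pair_big; apply: eq_bigr => -[].
by apply: eq_bigr => i _; rewrite -(wt i) expr_sum.
Qed.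

Lemma rep_line x i : val (x i) = <[rep x i]>%VS.
Proof.
have /eqP dx := valP (x i); apply/esym/eqP.
rewrite eqEdim -memvE memv_pick dim_vline /= dx /rep.
by rewrite vpick0 -dimv_eq0 dx.
Qed.

Lemma rep_neq0 x i : rep x i != 0.
Proof. by rewrite /rep vpick0 -dimv_eq0 (eqP (valP (x i))). Qed.

Lemma vline_scale (u v : 'cV[K]_m) : <[u]>%VS = <[v]>%VS -> u != 0 ->
  exists2 c, c != 0 & u = c *: v.
Proof.
move=> uv u0; have /vlineP[c uE] : u \in <[v]>%VS by rewrite -uv memv_line.
by exists c => //; apply: contra_neq u0 => c0; rewrite uE c0 scale0r.
Qed.

(** In each factor [rep x] and [v] differ by a nonzero scalar, and multihomogeneity pulls these
    scalars out. *)
Lemma evm_repE e p x v : mhom e p -> (forall i, val (x i) = <[v i]>%VS) ->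
  evm p (rep x) = 0 <-> evm p v = 0.
Proof.
move=> hp xv.
have /fin_all_exists2[c c0 cE] i : exists2 c, c != 0 & rep x i = c *: v i.
  by apply: vline_scale; rewrite ?rep_neq0 // -xv -rep_line.
have -> : rep x = (fun i => c i *: v i) by apply/funext.
rewrite (evm_scale _ _ hp); split=> [/eqP|->]; last by rewrite mulr0.
by rewrite mulf_eq0 => /orP[/prodf_eq0[i _]|/eqP//]; rewrite expf_eq0 (negbTE (c0 i)) andbF.
Qed.

Lemma zclosed_hyp p : multihomogeneous p -> zclosed [set x | evm p (rep x) = 0].
Proof.
move=> hp; exists [set p]; split=> [q ->//|].
by apply/seteqP; split=> x /= => [px q ->|/(_ p)]; [|apply].
Qed.

Lemma zclosureP S x : zclosure S x <->
  forall e p, mhom e p -> (forall y, S y -> evm p (rep y) = 0) -> evm p (rep x) = 0.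
Proof.
split=> [clx e p hp pS|H Z [F [hF ->]] SZ].
  by apply: clx pS; apply: zclosed_hyp; exists e.
by move=> p Fp; have [e he] := hF _ Fp; apply: (H e) => // y /SZ; apply.
Qed.

Lemma subset_zclosure S : S `<=` zclosure S.
Proof. by move=> x Sx Z _; apply. Qed.

Lemma zclosed_zclosure S : zclosed (zclosure S).
Proof.
exists [set p | multihomogeneous p /\ forall y, S y -> evm p (rep y) = 0].
split=> [p []//|]; apply/seteqP; split=> x.
  by move=> /zclosureP H p [[e hp] pS]; apply: (H e).
by move=> H; apply/zclosureP => e p hp pS; apply: H; split=> //; exists e.
Qed.

Lemma zclosure_min S Z : zclosed Z -> S `<=` Z -> zclosure S `<=` Z.
Proof. by move=> cZ SZ x; apply. Qed.

Definition vanishes_on Z p : Prop := forall x, Z x -> evm p (rep x) = 0.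

Lemma zirreducible_mul Z p q : zirreducible Z -> multihomogeneous p -> multihomogeneous q ->
  vanishes_on Z (p * q) -> vanishes_on Z p \/ vanishes_on Z q.
Proof.
case=> _ _ irr hp hq H; apply: irr (zclosed_hyp hp) (zclosed_hyp hq) _ => x /H.
by rewrite evmM => /eqP; rewrite mulf_eq0 => /orP[/eqP|/eqP]; [left|right].
Qed.

Lemma zirreducible_prod Z (T : Type) (r : seq T) (F : T -> mform K n m) :
  zirreducible Z -> (forall t, multihomogeneous (F t)) ->
  vanishes_on Z (\prod_(t <- r) F t) -> exists t, vanishes_on Z (F t).
Proof.
move=> irr hF; elim: r => [|t r IH].
  rewrite big_nil => H; have [_ [x /H]] := irr; rewrite /evm meval1 => /eqP.
  by rewrite oner_eq0.
rewrite big_cons => /(zirreducible_mul irr (hF t)) [|Ht|/IH//]; last by exists t.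
elim: {IH} r => [|u r [e IH]]; first by rewrite big_nil; exists (fun=> 0%N); apply: mhom1.
by rewrite big_cons; have [e' hu] := hF u; eexists; apply: mhomM hu IH.
Qed.

Lemma zirreducible_exp Z p k : zirreducible Z -> multihomogeneous p ->
  vanishes_on Z (p ^+ k) -> vanishes_on Z p.
Proof.
move=> irr hp; rewrite -[k]card_ord -prodr_const => H.
by have [|_] := zirreducible_prod (F := fun _ : 'I_k => p) irr _ H.
Qed.

End Fixed.

End Multihomogeneous.

(** * Dimension *)

Section AlgebraicDependence.
Local Open Scope ring_scope.
Variable K : fieldType.

Lemma wide_kernel p q (A : 'M[K]_(p, q)) : (q < p)%N ->
  exists2 u : 'rV_p, u != 0 & u *m A = 0.
Proof.
move=> qp; have : kermx A != 0.
  by rewrite -mxrank_eq0 mxrank_ker subn_eq0 -ltnNge (leq_ltn_trans (rank_leq_col A)).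
by case/rowV0Pn=> u /sub_kermxP uA u0; exists u.
Qed.

Lemma mdeg_msupp_prod r (T : Type) (s : seq T) (F : T -> {mpoly K[r]}) (d : T -> nat) :
  (forall t mon, mon \in msupp (F t) -> (mdeg mon <= d t)%N) ->
  forall mon, mon \in msupp (\prod_(t <- s) F t) -> (mdeg mon <= \sum_(t <- s) d t)%N.
Proof.
move=> h; elim: s => [|t s IH] mon.
  by rewrite !big_nil msupp1 inE => /eqP->; rewrite mdeg0.
rewrite !big_cons => /msuppM_le /allpairsP[[m1 m2] /= [/h h1 /IH h2 ->]].
by rewrite mdegD leq_add.
Qed.

Lemma mdeg_msupp_exp r (f : {mpoly K[r]}) d k :
  (forall mon, mon \in msupp f -> (mdeg mon <= d)%N) ->
  forall mon, mon \in msupp (f ^+ k) -> (mdeg mon <= k * d)%N.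
Proof.
move=> h mon; rewrite -[k in f ^+ k]card_ord -prodr_const => /(mdeg_msupp_prod (d := fun=> d)).
by rewrite sum_nat_const card_ord; apply.
Qed.

(* Counting: the (e+1)^l products of degree l*e lie in a space of dimension at
   most (l*e*D+1)^r, which is smaller for l > r and e large. *)
Lemma homogeneous_relation r l (f0 : {mpoly K[r]}) (f : 'I_l -> {mpoly K[r]}) : (r < l)%N ->
  exists e, exists2 c : {ffun 'I_l -> 'I_e.+1} -> K, (exists t, c t != 0) &
    \sum_t c t *: (f0 ^+ (l * e - \sum_j t j) * \prod_j f j ^+ t j) = 0.
Proof.
move=> rl; pose D := maxn (msize f0) (\max_j msize (f j)).
have D0 mon : mon \in msupp f0 -> (mdeg mon <= D)%N.
  by move/msize_mdeg_lt/ltnW/leq_trans; apply; apply: leq_maxl.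
have DF j mon : mon \in msupp (f j) -> (mdeg mon <= D)%N.
  move/msize_mdeg_lt/ltnW/leq_trans; apply.
  by apply: leq_trans (leq_maxr _ _); apply: (leq_bigmax (F := fun j => msize (f j))).
(* The choice gives [(l e D + 1)^r <= (C (e + 1))^r = e (e + 1)^r < (e + 1)^(r + 1) <= (e +
   1)^l]. *)
pose C := (l * D).+1; pose e := (C ^ r)%N; exists e.
pose B := (l * e * D)%N.
pose g (t : {ffun 'I_l -> 'I_e.+1}) := f0 ^+ (l * e - \sum_j t j) * \prod_j f j ^+ t j.
have sub (t : {ffun 'I_l -> 'I_e.+1}) : (\sum_j t j <= l * e)%N.
  apply: (@leq_trans (\sum_(j < l) e)%N); last by rewrite sum_nat_const card_ord.
  by apply: leq_sum => j _; rewrite -ltnS.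
have gB t mon : mon \in msupp (g t) -> (mdeg mon <= B)%N.
  move=> /msuppM_le /allpairsP[[m1 m2] /= [h1 h2 ->]]; rewrite mdegD.
  have {}h1 := mdeg_msupp_exp D0 h1.
  have {}h2 : (mdeg m2 <= \sum_j t j * D)%N.
    by apply: mdeg_msupp_prod h2 => j mon' /(mdeg_msupp_exp (DF j)).
  by apply: leq_trans (leq_add h1 h2) _; rewrite -big_distrl -mulnDl subnK.
pose I := {ffun 'I_l -> 'I_e.+1}; pose M := {ffun 'I_r -> 'I_B.+1}.
pose mon (b : M) : 'X_{1..r} := [multinom (b i : nat) | i < r].
pose A : 'M[K]_(#|{: I}|, #|{: M}|) :=
  \matrix_(t, b) (g (enum_val t))@_(mon (enum_val b)).
have cardlt : (#|{: M}| < #|{: I}|)%N.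
  rewrite !card_ffun !card_ord; apply: (@leq_ltn_trans ((C * e.+1) ^ r)).
    case: (r) => // r'; rewrite leq_exp2r // mulSn addSn ltnS mulnS.
    by rewrite mulnAC /B addnA leq_addl.
  rewrite expnMn -/e; apply: (@leq_trans (e.+1 ^ r.+1)).
    by rewrite expnS ltn_pmul2r ?expn_gt0.
  by rewrite leq_pexp2l.
have [u u0 uA] := wide_kernel A cardlt.
exists (fun t => u 0 (enum_rank t)).
  have /rV0Pn[i ui] := u0; exists (enum_val i); rewrite enum_valK; exact: ui.
apply/mpolyP => mn; rewrite mcoeff0 raddf_sum /=.
under eq_bigr do rewrite mcoeffZ -/(g _).
case: (leqP (mdeg mn) B) => [le|gt]; last first.
  rewrite big1 // => t _; rewrite memN_msupp_eq0 ?mulr0 //.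
  by apply: contraL gt => /gB; rewrite -leqNgt.
have le1 i : (mn i < B.+1)%N.
  by rewrite ltnS; apply: leq_trans le; rewrite mdegE (bigD1 i) //= leq_addr.
pose b : M := [ffun i => Ordinal (le1 i)].
have mnE : mn = mon b by apply/mnmP => i; rewrite mnmE ffunE.
have /matrixP/(_ 0 (enum_rank b)) := uA; rewrite !mxE => uA0; rewrite -[RHS]uA0.
rewrite [RHS](reindex (@enum_rank I)) /=; last exact: onW_bij (enum_rank_bij _).
by apply: eq_bigr => t _; rewrite mxE !enum_rankK -mnE.
Qed.

End AlgebraicDependence.

(** * Chains of irreducible closed sets *)

Section Dimension.
Local Open Scope classical_set_scope.
Local Open Scope ring_scope.
Variable K : numFieldType.
Variables n m : nat.
Implicit Types (p q : mform K n m) (e : 'I_n -> nat) (v : 'I_n -> 'cV[K]_m).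
Implicit Types (x y : mpspace K n m) (S X : set (mpspace K n m)).

(* The relation is divided by the largest power of the last form that divides
   it, and restricted to the previous member of the chain, where that form
   vanishes. *)
Lemma chain_independent l (Z : nat -> set (mpspace K n m)) e F0 (F : nat -> mform K n m) :
  (forall i, (i <= l)%N -> zirreducible (Z i)) ->
  (forall i, (i < l)%N -> Z i `<=` Z i.+1) ->
  mhom e F0 -> (forall i, mhom e (F i)) -> ~ vanishes_on (Z 0%N) F0 ->
  (forall i, (i < l)%N -> vanishes_on (Z i) (F i) /\ ~ vanishes_on (Z i.+1) (F i)) ->
  forall (T : finType) (P : pred T) (a : T -> nat -> nat) (c : T -> K) N,
  (forall t, P t -> (\sum_(j < l) a t j <= N)%N) ->
  (forall t u, P t -> P u -> (forall j, (j < l)%N -> a t j = a u j) -> t = u) ->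
  vanishes_on (Z l)
    (\sum_(t | P t) c t *: (F0 ^+ (N - \sum_(j < l) a t j) * \prod_(j < l) F j ^+ a t j)) ->
  forall t, P t -> c t = 0.
Proof.
move=> + + hF0 hF F0n; elim: l => [|l IH] irr sub FZ T P a c N aN inj van t Pt.
  (* With no forms left, injectivity leaves the single index [t], and the relation reads [c t] times
     a power of [F0], which is nonzero somewhere on [Z 0]. *)
  have [x [Zx Fx]] : exists x, Z 0%N x /\ evm F0 (rep x) <> 0.
    apply: contrapT => H; apply: F0n => x Zx; apply: contrapT => Fx.
    by apply: H; exists x.
  have := van _ Zx; rewrite (big_pred1 t) => [|u]; last first.
    by apply/idP/eqP => [Pu|->//]; apply: inj.
  rewrite !big_ord0 subn0 mulr1 evmZ evmX => /eqP.
  by rewrite mulf_eq0 expf_eq0 => /orP[/eqP//|/andP[_ /eqP]].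
apply: contrapT => /eqP ct.
pose P1 u := P u && (c u != 0).
have P1t : P1 t by rewrite /P1 Pt.
case: (arg_minnP (fun u => a u l) P1t) => t0 P1t0 t0min.
set b := a t0 l in t0min.
have bN : (b <= N)%N.
  have /andP[Pt0 _] := P1t0; apply: leq_trans (aN _ Pt0).
  by rewrite big_ord_recr /= leq_addl.
pose s u := (\sum_(j < l) a u j)%N.
have sN u : P u -> (s u + a u l <= N)%N by move/aN; rewrite big_ord_recr.
pose H := \sum_(u | P1 u) c u *: (F0 ^+ (N - s u - a u l) *
   (\prod_(j < l) F j ^+ a u j * F l ^+ (a u l - b))).
have hH : mhom (fun i => (N - b) * e i)%N H.
  apply: mhom_sum => u P1u; apply: mhomZ.
  have hP := mhom_prod (P := xpredT) (r := index_enum 'I_l)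
    (fun (j : 'I_l) _ => mhom_exp (k := a u j) (hF j)).
  have := mhomM (mhom_exp (k := (N - s u - a u l)%N) hF0)
    (mhomM hP (mhom_exp (k := (a u l - b)%N) (hF l))).
  apply: mhom_eq => i; rewrite -big_distrl /= -/(s u) -!mulnDl; congr (_ * _)%N.
  by have /andP[/sN su _] := P1u; have := t0min _ P1u; lia.
have HZ : vanishes_on (Z l.+1) (F l ^+ b * H).
  move=> x /van; apply: etrans; congr evm; rewrite big_distrr /=.
  rewrite [RHS](bigID (fun u => c u != 0)) /= [X in _ = _ + X]big1 ?addr0; last first.
    by move=> u /andP[_]; rewrite negbK => /eqP->; rewrite scale0r.
  apply: eq_bigr => u P1u; rewrite -scalerAr; congr (_ *: _).
  rewrite big_ord_recr [in RHS]big_ord_recr /= -/(s u) subnDA mulrCA; congr (_ * _).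
  by rewrite mulrCA -exprD subnKC // t0min.
(* The factor [F l ^+ b] cancels on [Z l.+1], which is irreducible and on which [F l] does not
   vanish identically. *)
have {}HZ : vanishes_on (Z l) H.
  move=> x Zx; have irl := irr l.+1 (leqnn _).
  case: (zirreducible_mul irl _ _ HZ); first exact: mhom_multihomogeneous (mhom_exp (hF l)).
  - by exists (fun i => (N - b) * e i)%N.
  - move/(zirreducible_exp irl (mhom_multihomogeneous (hF l))) => Fl.
    by have [_] := FZ l (ltnSn _).
  - by move=> H0; apply/H0/sub.
have : c t0 = 0; last by have /andP[_ /eqP] := P1t0.
(* On [Z l] the form [F l] vanishes, so only the terms with exponent exactly [b] survive. They are
   still separated by their other exponents. *)
apply: (IH _ _ _ T (fun u => P1 u && (a u l == b)) a c (N - b)%N).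
- by move=> i il; apply/irr/ltnW.
- by move=> i il; apply/sub/ltnW.
- by move=> i il; apply/FZ/ltnW.
- by move=> u /andP[/andP[/sN su _] /eqP ab]; rewrite -/(s u); lia.
- move=> u w /andP[/andP[Pu _] /eqP au] /andP[/andP[Pw _] /eqP aw] auw.
  apply: inj => // j; rewrite ltnS leq_eqVlt => /orP[/eqP->|/auw//].
  by rewrite au aw.
- move=> x Zx; have := HZ x Zx; apply: etrans.
  rewrite !evm_sum [RHS](bigID (fun u => a u l == b)) /=.
  rewrite [X in _ = _ + X]big1 ?addr0 => [|u /andP[P1u ab]]; last first.
    have [/(_ x Zx) Fl _] := FZ l (ltnSn _).
    rewrite evmZ !evmM !evmX Fl expr0n subn_eq0.
    by rewrite leqNgt ltn_neqAle eq_sym ab t0min //= !mulr0.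
  apply: eq_bigr => u /andP[_ /eqP au].
  by rewrite -/(s u) au subnn expr0 mulr1 subnAC.
- by rewrite P1t0 eqxx.
Qed.

Lemma polyfun_evm (I : finType) p (phi : (I -> K) -> 'I_n -> 'cV[K]_m) :
  (forall i j, polyfun (fun t => phi t i j 0)) -> polyfun (fun t => evm p (phi t)).
Proof. by move=> pphi; apply: polyfun_meval => k; apply: pphi. Qed.

Lemma ex_mpoint v : (forall i, v i != 0) -> exists y, forall i, val (y i) = <[v i]>%VS.
Proof.
move=> v0; have dv i : \dim <[v i]>%VS == 1%N by rewrite dim_vline v0.
by exists (fun i => exist (fun U : {vspace 'cV[K]_m} => is_true (\dim U == 1%N)) _ (dv i)).
Qed.

(** Each step of the chain supplies a form that vanishes on one member and not on the next. Pulled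
    back along a chart with fewer parameters than steps, these forms satisfy a homogeneous relation.
    The product of the relations over all charts vanishes on [S], hence on the irreducible top
    member, and so does one factor, against [chain_independent]. Charts only have to cover [S]; they
    may take values outside it. *)
Theorem chain_length_le S k (J : finType) (phi : J -> ('I_k -> K) -> 'I_n -> 'cV[K]_m) l :
  (forall s i j, polyfun (fun t => phi s t i j 0)) ->
  (forall y, S y -> exists s t, forall i, val (y i) = <[phi s t i]>%VS) ->
  has_chain (zclosure S) l -> (l <= k)%N.
Proof.
move=> pphi Sphi [Z [irrZ ltZ]]; rewrite leqNgt; apply/negP => kl.
have irr i : (i <= l)%N -> zirreducible (Z i) by move/irrZ => [].
have sub i : (i < l)%N -> Z i `<=` Z i.+1 by case/ltZ.
have [_ [x0 Zx0] _] := irr 0%N (leq0n _).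
have Zi i : (i <= l)%N -> Z i x0.
  by elim: i => // i IH il; apply/(sub _ il)/IH/ltnW.
have /fin_all_exists[c cE] (i : 'I_n) : exists j, rep x0 i j 0 != 0.
  have /matrix0Pn[j [o]] := rep_neq0 x0 i; rewrite [o]ord1 => h; by exists j.
have /fin_all_exists2[pj pj1 pj2] (j : 'I_l) : exists2 pe : mform K n m * ('I_n -> nat),
    mhom pe.2 pe.1 /\ vanishes_on (Z j) pe.1 & ~ vanishes_on (Z j.+1) pe.1.
  have [_ /existsNP[y /not_implyP[Zy nZy]]] := ltZ _ (ltn_ord j).
  have [[F [hF ZF]] _ _] := irr j (ltnW (ltn_ord j)).
  have [p Fp py] : exists2 p, F p & ~ vanishes_at p y.
    apply: contrapT => H; apply: nZy; rewrite ZF => p Fp; apply: contrapT => py.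
    by apply: H; exists p.
  have [e hp] := hF p Fp; exists (p, e) => /=; last by move/(_ y Zy).
  by split=> // x; rewrite ZF => /(_ p Fp).
(* Homogeneous relations need forms of equal multidegree. The padding is by coordinates that do not
   vanish at [x0], a point of [Z 0] and so of every member. *)
pose E i := (\sum_j (pj j).2 i)%N.
pose L (d : 'I_n -> nat) : mform K n m := \prod_i 'X_(enum_rank (i, c i)) ^+ d i.
have hL d : mhom d (L d).
  have := mhom_prod (P := xpredT) (r := index_enum 'I_n)
    (fun i _ => mhom_exp (k := d i) (@mhomX K n m (i, c i))).
  apply: mhom_eq => i; rewrite (bigD1 i) //= eqxx muln1 big1 ?addn0 // => j ji.
  by rewrite eq_sym (negbTE ji) muln0.
have nL d : evm (L d) (rep x0) != 0.
  rewrite evm_prod; apply/prodf_neq0 => i _.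
  by rewrite evmX evm_var expf_neq0 // cE.
pose F (j : nat) := if insub j is Some o then (pj o).1 * L (fun i => E i - (pj o).2 i)%N
  else L E.
have hF j : mhom E (F j).
  rewrite /F; case: insubP => [o _ _|_]; last exact: hL.
  apply: mhom_eq (mhomM (pj1 o).1 (hL _)) => i.
  by rewrite subnKC // /E (bigD1 o) //= leq_addr.
have FE (o : 'I_l) : F o = (pj o).1 * L (fun i => E i - (pj o).2 i)%N.
  by rewrite /F valK.
have Fvan (j : nat) : (j < l)%N -> vanishes_on (Z j) (F j) /\ ~ vanishes_on (Z j.+1) (F j).
  move=> jl; rewrite -[j]/(val (Ordinal jl)) FE; set o := Ordinal jl; split.
    by move=> x /(pj1 o).2; rewrite evmM => ->; rewrite mul0r.
  move=> H; have [] := zirreducible_mul (irr _ jl) (mhom_multihomogeneous (pj1 o).1)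
    (mhom_multihomogeneous (hL _)) H; first exact: (pj2 o).
  by move/(_ x0 (Zi _ jl))/eqP; apply/negP.
have rel s : exists N, exists2 d : {ffun 'I_l -> 'I_N.+1} -> K, (exists t, d t != 0) &
    forall t, evm (\sum_a d a *: (L E ^+ (l * N - \sum_j a j) *
      \prod_(j < l) F j ^+ a j)) (phi s t) = 0.
  have [g0 g0E] := polyfun_evm (L E) (pphi s).
  have /fin_all_exists[g gE] (j : 'I_l) := polyfun_evm (F j) (pphi s).
  have [|N [d d0 dE]] := homogeneous_relation g0 g; first by rewrite card_ord.
  exists N, d => // t; have := congr1 (meval (fun k => t (enum_val k))) dE.
  rewrite meval0 raddf_sum evm_sum => E0; rewrite -[RHS]E0; apply: eq_bigr => a _ /=.
  rewrite mevalZ evmZ mevalM evmM rmorphXn evmX /= -g0E; congr (_ * (_ * _)).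
  by rewrite rmorph_prod evm_prod; apply: eq_bigr => j _; rewrite rmorphXn evmX /= -gE.
have /fin_all_exists[N /fin_all_exists2[d d0 dE]] := rel.
pose H s : mform K n m := \sum_a d s a *: (L E ^+ (l * N s - \sum_j a j) *
      \prod_(j < l) F j ^+ a j).
have aN s (a : {ffun 'I_l -> 'I_(N s).+1}) : (\sum_j a j <= l * N s)%N.
  apply: (@leq_trans (\sum_(j < l) N s)%N); last by rewrite sum_nat_const card_ord.
  by apply: leq_sum => j _; rewrite -ltnS.
have hH s : mhom (fun i => l * N s * E i)%N (H s).
  apply: mhom_sum => a _; apply: mhomZ.
  have hP := mhom_prod (P := xpredT) (r := index_enum 'I_l)
    (fun (j : 'I_l) _ => mhom_exp (k := a j) (hF j)).
  apply: mhom_eq (mhomM (mhom_exp (k := (l * N s - \sum_j a j)%N) (hL E)) hP) => i.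
  by rewrite -big_distrl /= -mulnDl subnK ?aN.
(* Which chart covers a given point of [S] is unknown; the product avoids the choice, and
   irreducibility makes it afterwards. *)
have : vanishes_on (Z l) (\prod_s H s).
  move=> x Zx; have [_ /(_ _ Zx)/zclosureP cl] := irrZ _ (leqnn l).
  apply: (cl _ _ (mhom_prod (P := xpredT) (fun s _ => hH s))) => y /Sphi[s [t yt]].
  rewrite evm_prod (bigD1 s) //=; apply/eqP; rewrite mulf_eq0; apply/orP; left.
  by apply/eqP; apply/(evm_repE (hH s) yt)/dE.
case/(zirreducible_prod (irr _ (leqnn l)) (fun s => mhom_multihomogeneous (hH s))) => s Hs.
have [a] := d0 s; apply/negP; rewrite negbK; apply/eqP.
pose ex (a : {ffun 'I_l -> 'I_(N s).+1}) (j : nat) : nat :=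
  if insub j is Some o then a o else 0%N.
have exE b (j : 'I_l) : ex b j = b j by rewrite /ex valK.
apply: (chain_independent (T := {ffun 'I_l -> 'I_(N s).+1}) (P := xpredT) (l := l) (Z := Z)
  (a := ex) (N := (l * N s)%N) irr sub (hL E) hF _ Fvan) => //.
- by move/(_ _ Zx0)/eqP; apply/negP.
- by move=> b _; under eq_bigr do rewrite exE.
- move=> b b' _ _ bb; apply/ffunP => j; apply/val_inj.
  by have := bb j (ltn_ord j); rewrite !exE.
- move=> x Zx; rewrite -(Hs x Zx); congr evm; apply: eq_bigr => b _.
  have -> : (\sum_(j < l) ex b j = \sum_j b j)%N by apply: eq_bigr => j _; rewrite exE.
  by congr (_ *: (_ * _)); apply: eq_bigr => j _; rewrite exE.
Qed.

(** The chain consists of the closures of the images of the coordinate subspaces on which [t i = 0]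
    for [i >= j]. They are irreducible because two polynomial functions that are nonzero on a linear
    space have a common nonvanishing point there. The inclusions are strict because the linear form
    [b j] pulls back to the parameter [t j]. *)
Theorem linear_chain X k (phi : ('I_k -> K) -> 'I_n -> 'cV[K]_m)
    (i_ : 'I_k -> 'I_n) (b : 'I_k -> 'rV[K]_m) :
  zclosed X -> (forall i j, polyfun (fun t => phi t i j 0)) ->
  (forall i, phi (fun=> 0) i != 0) ->
  (forall t y, (forall i, val (y i) = <[phi t i]>%VS) -> X y) ->
  (forall t j, (b j *m phi t (i_ j)) 0 0 = t j) ->
  has_chain X k.
Proof.
move=> cX pphi phi0 phiX bphi.
have /fin_all_exists[c cE] (i : 'I_n) : exists j, phi (fun=> 0) i j 0 != 0.
  by have /matrix0Pn[j [o]] := phi0 i; rewrite [o]ord1 => h; exists j.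
(* Where [D] is nonzero no factor of [phi t] vanishes, so that [phi t] represents a point. *)
pose D t := \prod_i phi t i (c i) 0.
have pD : polyfun D by apply: polyfun_prod => i _; apply: pphi.
have D0 : D (fun=> 0) != 0 by apply/prodf_neq0 => i _; apply: cE.
have Dphi t : D t != 0 -> forall i, phi t i != 0.
  move=> /prodf_neq0 Dt i; apply: contraTneq (Dt i isT) => ->.
  by rewrite mxE eqxx.
pose T (j : nat) (t : 'I_k -> K) := forall i : 'I_k, (j <= i)%N -> t i = 0.
pose S j : set (mpspace K n m) :=
  [set y | exists2 t, T j t & forall i, val (y i) = <[phi t i]>%VS].
have T0 j : T j (fun=> 0) by [].
have Tline j t u s : T j t -> T j u -> T j (fun i => t i + s * (u i - t i)).
  by move=> Tt Tu i ji; rewrite Tt // Tu // subr0 mulr0 addr0.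
have two j f g t u : T j t -> T j u -> polyfun f -> polyfun g -> f t != 0 -> g u != 0 ->
    exists w, [/\ T j w, f w != 0 & g w != 0].
  move=> Tt Tu pf pg ft gu; have [s [/= h1 h2]] := polyfun_two_nonzero pf pg ft gu.
  by eexists; split; [apply: Tline Tt Tu|exact: h1|exact: h2].
have witness j e p t : T j t -> mhom e p -> evm p (phi t) != 0 ->
    exists2 y, S j y & evm p (rep y) <> 0.
  move=> Tt hp pt; have [w [Tw pw Dw]] :=
    two _ _ _ _ _ Tt (T0 j) (polyfun_evm p pphi) pD pt D0.
  have [y yE] := ex_mpoint (Dphi w Dw); exists y; first by exists w.
  by move/(evm_repE hp yE)/eqP; apply/negP.
exists (fun j => zclosure (S j)); split=> j jk; last first.
  split.
    apply: zclosure_min; first exact: zclosed_zclosure.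
    move=> y [t Tt yt]; apply: subset_zclosure; exists t => // i ji.
    by apply: Tt; apply: ltnW.
  pose o := Ordinal jk.
  pose p : mform K n m := \sum_l b o 0 l *: 'X_(enum_rank (i_ o, l)).
  have hp : mhom (fun i => (i == i_ o) : nat) p.
    by apply: mhom_sum => l _; apply: mhomZ; apply: mhomX.
  have pE t : evm p (phi t) = t o.
    rewrite -bphi mxE evm_sum; apply: eq_bigr => l _.
    by rewrite evmZ evm_var.
  have [||y Sy py] := witness j.+1 _ p (fun i => (i == o)%:R) _ hp.
  - by move=> i ji; rewrite -val_eqE /= gtn_eqF.
  - by rewrite pE eqxx oner_neq0.
  move/(_ y (subset_zclosure Sy))/zclosureP/(_ _ _ hp) => H; apply/py/H.
  by move=> z [t Tt zt]; apply/(evm_repE hp zt); rewrite pE Tt.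
split; last first.
  by apply: zclosure_min => // y [t _]; apply: phiX.
split; first exact: zclosed_zclosure.
  by have [y yE] := ex_mpoint phi0; exists y; apply: subset_zclosure; exists (fun=> 0).
move=> A B [FA [hA AE]] [FB [hB BE]] AB; apply: contrapT => /not_orP[nA nB].
have wit C (F : set (mform K n m)) : (forall p, F p -> multihomogeneous p) ->
    C = [set x | forall p, F p -> vanishes_at p x] -> ~ zclosure (S j) `<=` C ->
    exists p e t, [/\ F p, mhom e p, T j t & evm p (phi t) != 0].
  move=> hF CE nC; have cC : zclosed C by exists F.
  have /existsNP[y /not_implyP[[t Tt yt] nCy]] : ~ S j `<=` C.
    by move=> SC; apply: nC; apply: zclosure_min.
  move: nCy; rewrite CE => /existsNP[p /not_implyP[Fp py]].
  have [e hp] := hF p Fp; exists p, e, t; split=> //.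
  by apply/eqP => /(evm_repE hp yt).
have [p [e [t [Fp hp Tt pt]]]] := wit _ _ hA AE nA.
have [q [e' [u [Fq hq Tu qu]]]] := wit _ _ hB BE nB.
have [w [Tw]] := two _ _ _ _ _ Tt (T0 j) (polyfun_evm p pphi) pD pt D0 => pw Dw.
have [z [Tz pz qz]] := two _ _ _ _ _ Tw Tu
  (polyfunM (polyfun_evm p pphi) pD) (polyfun_evm q pphi) (mulf_neq0 pw Dw) qu.
move: pz; rewrite mulf_eq0 negb_or => /andP[pz Dz].
have [y yE] := ex_mpoint (Dphi z Dz).
have /AB[] : zclosure (S j) y by apply: subset_zclosure; exists z.
  by rewrite AE => /(_ p Fp)/(evm_repE hp yE)/eqP; apply/negP.
by rewrite BE => /(_ q Fq)/(evm_repE hq yE)/eqP; apply/negP.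
Qed.

End Dimension.

(** * Elimination *)

Section MinorVector.
Local Open Scope ring_scope.

Definition bordered (R : Type) s (r : 'rV[R]_s.+1) (N : 'M[R]_(s, s.+1)) : 'M[R]_s.+1 :=
  \matrix_(i, j) if unlift ord0 i is Some i' then N i' j else r 0 j.

Lemma bordered0 (R : Type) s (r : 'rV[R]_s.+1) (N : 'M[R]_(s, s.+1)) j :
  bordered r N ord0 j = r 0 j.
Proof. by rewrite mxE unlift_none. Qed.

Lemma borderedS (R : Type) s (r : 'rV[R]_s.+1) (N : 'M[R]_(s, s.+1)) i j :
  bordered r N (lift ord0 i) j = N i j.
Proof. by rewrite mxE liftK. Qed.

(** The generalised cross product of the rows: the signed maximal minors, polynomial in the
    entries. *)
Definition minors (R : comNzRingType) s (N : 'M[R]_(s, s.+1)) : 'cV[R]_s.+1 :=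
  \col_k \det (bordered (delta_mx 0 k) N).

Section Ring.
Variables (R : comNzRingType) (s : nat).
Implicit Types (r : 'rV[R]_s.+1) (N : 'M[R]_(s, s.+1)).

(** Expansion along the first row, whose cofactors do not depend on that row. *)
Lemma det_bordered r N : \det (bordered r N) = (r *m minors N) 0 0.
Proof.
have cofE u k : cofactor (bordered u N) ord0 k = cofactor (bordered r N) ord0 k.
  congr (_ * \det _); apply/matrixP => i j.
  by do 2!rewrite [LHS]mxE [RHS]mxE; rewrite !borderedS.
rewrite (expand_det_row _ ord0) mxE; apply: eq_bigr => k _.
rewrite bordered0 [in RHS]mxE; congr (_ * _); rewrite (expand_det_row _ ord0) (bigD1 k) //=.
rewrite bordered0 mxE !eqxx mul1r cofE big1 ?addr0 // => j jk.
by rewrite bordered0 mxE (negbTE jk) andbF mul0r.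
Qed.

Lemma mul_minors N : N *m minors N = 0.
Proof.
apply/row_matrixP => i; rewrite row_mul row0; apply/matrixP => a b.
rewrite !ord1 -det_bordered mxE.
apply: (@determinant_alternate _ _ _ ord0 (lift ord0 i)) => // j.
by rewrite bordered0 borderedS mxE.
Qed.

End Ring.

Section Field.
Variables (F : fieldType) (s : nat).
Implicit Types (r : 'rV[F]_s.+1) (N : 'M[F]_(s, s.+1)).

Lemma bordered_eq0 r N (x : 'cV[F]_s.+1) :
  \det (bordered r N) != 0 -> N *m x = 0 -> (r *m x) 0 0 = 0 -> x = 0.
Proof.
rewrite -unitfE -unitmxE => U Nx rx; suff B0 : bordered r N *m x = 0.
  by rewrite -[x]mul1mx -(mulVmx U) -mulmxA B0 mulmx0.
apply/matrixP => i j; rewrite ord1 [RHS]mxE mxE.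
case: (unliftP ord0 i) => [i' ->|->].
  have /matrixP/(_ i' 0) := Nx; rewrite [RHS]mxE => Nx0; rewrite -[RHS]Nx0 mxE.
  by apply: eq_bigr => k _; rewrite borderedS.
by rewrite -[RHS]rx mxE; apply: eq_bigr => k _; rewrite bordered0.
Qed.

Lemma kernel_minors N (x : 'cV[F]_s.+1) : minors N != 0 -> N *m x = 0 ->
  exists c, x = c *: minors N.
Proof.
move=> /matrix0Pn[k [o]]; rewrite [o]ord1 {o} => nk Nx.
pose r : 'rV[F]_s.+1 := delta_mx 0 k; pose d := (r *m minors N) 0 0.
have dE : d = minors N k 0.
  rewrite /d mxE (bigD1 k) //= mxE !eqxx mul1r big1 ?addr0 // => j jk.
  by rewrite mxE (negbTE jk) andbF mul0r.
have d0 : d != 0 by rewrite dE.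
exists ((r *m x) 0 0 / d); apply/eqP; rewrite -subr_eq0; apply/eqP.
apply: (@bordered_eq0 r N); first by rewrite det_bordered.
  by rewrite mulmxBr Nx -scalemxAr mul_minors scaler0 subr0.
rewrite mulmxBr -scalemxAr; move: (r *m x) @d d0 dE => y d d0 _.
by rewrite [LHS]mxE [X in _ + X]mxE [X in - X]mxE -/d divfK // subrr.
Qed.

(** The [s] rows do not span the whole space, so some unit row lies outside their span; bordering
    [N] with it gives an invertible matrix. *)
Lemma minors_neq0 N : row_free N -> minors N != 0.
Proof.
move=> rfN; apply/negP => /eqP nu0.
have /row_subPn[i ri] : ~~ (1%:M <= N)%MS.
  apply: contraTN isT => /mxrankS; rewrite mxrank1 => h; have := rank_leq_row N.
  by move/(leq_trans h); rewrite ltnn.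
have /det0P[u u0 uB] : \det (bordered (row i 1%:M) N) == 0.
  by rewrite det_bordered nu0 mulmx0 mxE.
pose w : 'rV[F]_s := \row_j u 0 (lift ord0 j).
have uE : u 0 ord0 *: row i 1%:M + w *m N = 0.
  rewrite -uB; apply/matrixP => a b; rewrite ord1 {a} mxE [RHS]mxE big_ord_recl.
  rewrite bordered0 [X in X + _]mxE; congr (_ + _); rewrite mxE; apply: eq_bigr => j _.
  by rewrite borderedS mxE.
have [u00|u00] := eqVneq (u 0 ord0) 0.
  move: uE; rewrite u00 scale0r add0r => /(congr1 (mulmx^~ (pinvmx N))).
  rewrite mul0mx -mulmxA mulmxVp // mulmx1 => w0.
  case/negP: u0; apply/eqP/matrixP => a b; rewrite ord1 mxE.
  case: (unliftP ord0 b) => [b' ->|->//].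
  by have /matrixP/(_ 0 b') := w0; rewrite !mxE.
case/negP: ri; apply/submxP; exists (- (u 0 ord0)^-1 *: w).
rewrite -scalemxAl; move/eqP: uE; rewrite addr_eq0 => /eqP /(congr1 ( *:%R (u 0 ord0)^-1)).
by rewrite scalerA mulVf // scale1r scalerN scaleNr.
Qed.

Lemma row_free_rowsub p q t (g : 'I_t -> 'I_p) (A : 'M[F]_(p, q)) :
  injective g -> row_free A -> row_free (rowsub g A).
Proof.
move=> gi /row_freeP[B AB]; apply/row_freeP; exists (colsub g B).
apply/matrixP => i j; have /matrixP/(_ (g i) (g j)) := AB.
rewrite !mxE (inj_eq gi) => h; rewrite -[RHS]h.
by apply: eq_bigr => k _; rewrite !mxE.
Qed.

End Field.
End MinorVector.

Section Elimination.
Local Open Scope classical_set_scope.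
Local Open Scope ring_scope.
Variable K : numClosedFieldType.

Definition qf s (J : 'M[K]_s) (x : 'cV[K]_s) : K := (x^T *m J *m x) 0 0.

Lemma trmxZ p q c (A : 'M[K]_(p, q)) : (c *: A)^T = c *: A^T.
Proof. by apply/matrixP => i j; rewrite !mxE. Qed.

Lemma trmxD p q (A B : 'M[K]_(p, q)) : (A + B)^T = A^T + B^T.
Proof. by apply/matrixP => i j; rewrite !mxE. Qed.

Lemma qfZ s (J : 'M[K]_s) c x : qf J (c *: x) = c ^+ 2 * qf J x.
Proof. by rewrite /qf trmxZ -scalemxAr -!scalemxAl scalerA mxE expr2. Qed.

(** The quadratic formula; algebraic closedness of the field is used through this square root. *)
Lemma isotropic_pencil s (J : 'M[K]_s) (w0 w1 : 'cV[K]_s) :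
  (forall a b, a *: w0 + b *: w1 = 0 -> a = 0 /\ b = 0) ->
  exists a b, a *: w0 + b *: w1 != 0 /\ qf J (a *: w0 + b *: w1) = 0.
Proof.
move=> ind; have nz a b : (a, b) != (0, 0) -> a *: w0 + b *: w1 != 0.
  by apply: contra => /eqP/ind[-> ->].
pose B := (w0^T *m J *m w1) 0 0 + (w1^T *m J *m w0) 0 0.
have qE a b : qf J (a *: w0 + b *: w1) = a ^+ 2 * qf J w0 + a * b * B + b ^+ 2 * qf J w1.
  rewrite /qf /B trmxD !trmxZ mulmxDr !mulmxDl -!scalemxAr -!scalemxAl.
  by rewrite !mxE; ring.
have [q0|q0] := eqVneq (qf J w0) 0.
  exists 1, 0; split; first by apply: nz; rewrite xpair_eqE oner_eq0.
  by rewrite qE q0; ring.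
pose d := sqrtC (B ^+ 2 - 4 * qf J w0 * qf J w1).
exists ((d - B) / (2 * qf J w0)), 1; split.
  by apply: nz; rewrite xpair_eqE oner_eq0 andbF.
have dd : d ^+ 2 = B ^+ 2 - 4 * qf J w0 * qf J w1 by rewrite sqrtCK.
rewrite qE; apply: (@mulfI _ (4 * qf J w0)); first by rewrite mulf_neq0 ?pnatr_eq0.
rewrite mulr0; transitivity (d ^+ 2 - (B ^+ 2 - 4 * qf J w0 * qf J w1)); last first.
  by rewrite dd subrr.
by field.
Qed.

Lemma isotropic_kernel p s (M : 'M[K]_(p, s.+1)) (J : 'M[K]_s.+1) : (\rank M < s)%N ->
  exists x : 'cV[K]_s.+1, [/\ x != 0, M *m x = 0 & qf J x = 0].
Proof.
move=> rM; pose B := row_base (kermx M^T).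
have r2 : (1 < \rank (kermx M^T))%N by rewrite mxrank_ker mxrank_tr; lia.
pose w i : 'cV[K]_s.+1 := (row i B)^T.
have MB : M *m B^T = 0.
  apply: trmx_inj; rewrite trmx_mul trmxK trmx0; apply: sub_kermxP.
  by rewrite eq_row_base.
have Mw i : M *m w i = 0 by rewrite /w tr_row colE mulmxA MB mul0mx.
pose i0 := Ordinal (ltnW r2); pose i1 := Ordinal r2.
have ind a b : a *: w i0 + b *: w i1 = 0 -> a = 0 /\ b = 0.
  move=> /(congr1 trmx); rewrite trmx0 trmxD !trmxZ !trmxK !rowE.
  rewrite !scalemxAl -mulmxDl => h.
  have := row_free_inj (row_base_free (kermx M^T)) (etrans h (esym (mul0mx _ _))).
  move=> /matrixP u; split; [have := u 0 i0|have := u 0 i1]; rewrite !mxE /=.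
    by rewrite mulr1 mulr0 addr0.
  by rewrite mulr1 mulr0 add0r.
have [a [b [x0 qx]]] := isotropic_pencil J ind.
exists (a *: w i0 + b *: w i1); split=> //.
by rewrite mulmxDr -!scalemxAr !Mw !scaler0 addr0.
Qed.

(* A linear system with an isotropic solution that depends multihomogeneously
   on y still has one in the limit: either its kernel is at least a pencil, or
   it is spanned by the vector of maximal minors of a subsystem, and being
   isotropic and a solution are closed conditions on these minors. *)
Theorem incidence_zclosure n m s (S : set (mpspace K n m)) (T : finType)
    (rho : T -> 'I_s.+1 -> mform K n m) (E : T -> 'I_n -> nat) (J : 'M[K]_s.+1) :
  (forall t k, mhom (E t) (rho t k)) ->
  let solvable y := exists x : 'cV[K]_s.+1, [/\ x != 0,
    forall t, \sum_k evm (rho t k) (rep y) * x k 0 = 0 & qf J x = 0] in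
  (forall y, S y -> solvable y) -> forall y, zclosure S y -> solvable y.
Proof.
move=> hrho solvable Ssol y /zclosureP cly.
pose M z : 'M[K]_(#|T|, s.+1) := \matrix_(i, k) evm (rho (enum_val i) k) (rep z).
have ME z (x : 'cV[K]_s.+1) : M z *m x = 0 <->
    forall t, \sum_k evm (rho t k) (rep z) * x k 0 = 0.
  split=> [/matrixP Mx t|H]; last first.
    apply/matrixP => i j; rewrite ord1 [RHS]mxE -[RHS](H (enum_val i)) mxE.
    by apply: eq_bigr => k _; rewrite mxE.
  have := Mx (enum_rank t) 0; rewrite [RHS]mxE mxE => Ht; rewrite -[RHS]Ht.
  by apply: eq_bigr => k _; rewrite mxE enum_rankK.
have [rM|rM] := ltnP (\rank (M y)) s.
  by have [x [x0 /ME Mx qx]] := isotropic_kernel J rM; exists x.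
(* The rows are selected at the limit point [y] once and for all. At points of [S] the same rows may
   be dependent. *)
pose g (i : 'I_s) : 'I_#|T| := maxrankfun (M y) (widen_ord rM i).
pose N z := rowsub g (M z).
have rfN : row_free (N y).
  rewrite /N (_ : rowsub g (M y) = rowsub (widen_ord rM) (rowsub (maxrankfun (M y)) (M y))).
    apply: row_free_rowsub; last exact: maxrowsub_free.
    by move=> i j /(congr1 val) /= /val_inj.
  by apply/matrixP => i j; rewrite !mxE.
have NE z (x : 'cV[K]_s.+1) :
    (forall t, \sum_k evm (rho t k) (rep z) * x k 0 = 0) -> N z *m x = 0.
  move=> H; apply/matrixP => i j; rewrite ord1 [RHS]mxE -[RHS](H (enum_val (g i))) mxE.
  by apply: eq_bigr => k _; rewrite !mxE.
pose B (r : 'I_s.+1 -> mform K n m) : mform K n m :=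
  \det (bordered (\row_k r k) (\matrix_(i, k) rho (enum_val (g i)) k)).
have BE r z : evm (B r) (rep z) = \det (bordered (\row_k evm (r k) (rep z)) (N z)).
  rewrite evm_det; congr (\det _); apply/matrixP => i k; rewrite mxE.
  by case: (unliftP ord0 i) => [i' ->|->]; rewrite ?borderedS ?bordered0 !mxE.
have hB e r : (forall k, mhom e (r k)) ->
    exists e', mhom e' (B r) /\ e' =1 (fun i => e i + \sum_j E (enum_val (g j)) i)%N.
  move=> hr; eexists; split.
    apply: (@mhom_det _ _ _ _ (fun i' => if unlift ord0 i' is Some j then E (enum_val (g j)) else e)).
    move=> i k; case: (unliftP ord0 i) => [i' ->|->]; rewrite ?borderedS ?bordered0 !mxE //.
  by move=> i; rewrite big_ord_recl unlift_none; congr (_ + _)%N; apply: eq_bigr => j _; rewrite liftK.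
have [x [x0 Nx]] : exists x : 'cV[K]_s.+1, x != 0 /\ x = minors (N y).
  by exists (minors (N y)); rewrite minors_neq0.
(* The bordering row has constant entries 0 and 1, shaped like those of [delta_mx 0 k], so that
   [nu k] is the [k]-th minor as a multihomogeneous form. *)
pose nu k := B (fun k' => ((0 == 0 :> 'I_1) && (k' == k))%:R).
have nuE z k : evm (nu k) (rep z) = minors (N z) k 0.
  rewrite BE mxE; congr (\det (bordered _ _)); apply/rowP => k'; rewrite !mxE.
  by rewrite /evm rmorph_nat.
have hnu k : mhom (fun i => \sum_j E (enum_val (g j)) i)%N (nu k).
  have [|e [he ee]] := hB (fun=> 0%N) (fun k' => ((0 == 0 :> 'I_1) && (k' == k))%:R).
    by move=> k'; case: (_ && _); [exact: mhom1|exact: mhom0].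
  by apply: mhom_eq he => i; rewrite ee.
exists x; split=> //.
  move=> t; have [e [he _]] := hB (E t) (rho t) (hrho t).
  have /(_ _ _ he) := cly; rewrite BE det_bordered -Nx mxE => H; rewrite -[RHS]H.
    by apply: eq_bigr => k _; rewrite mxE.
  (* At a point of [S] the actual solution is a nonzero kernel vector of the bordered matrix, whose
     determinant therefore vanishes. *)
  move=> z /Ssol[w [w0 Hw _]]; rewrite BE; apply/eqP; apply: contraNT w0 => D.
  apply/eqP; apply: (bordered_eq0 D (NE _ _ Hw)).
  by rewrite -[RHS](Hw t) mxE; apply: eq_bigr => k _; rewrite mxE.
have hq : mhom (fun i => \sum_j E (enum_val (g j)) i + \sum_j E (enum_val (g j)) i)%N
    (\sum_j \sum_k J k j *: (nu k * nu j)).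
  by do 2!(apply: mhom_sum => ? _); apply: mhomZ; apply: mhomM.
have qE z : evm (\sum_j \sum_k J k j *: (nu k * nu j)) (rep z) = qf J (minors (N z)).
  rewrite /qf mxE evm_sum; apply: eq_bigr => j _.
  rewrite evm_sum mxE big_distrl; apply: eq_bigr => k _ /=.
  by rewrite evmZ evmM !nuE [X in _ = X * _ * _]mxE mulrCA mulrA.
(* At a point of [S] either the minors all vanish and there is nothing to show, or they are
   proportional to the isotropic solution. *)
rewrite Nx -qE; apply: cly hq _ => z /Ssol[w [w0 Hw qw]]; rewrite qE.
have [->|nu0] := eqVneq (minors (N z)) 0; first by rewrite /qf mulmx0 mxE.
have [c wE] := kernel_minors nu0 (NE _ _ Hw).
apply/eqP; move: qw; rewrite wE qfZ => /eqP; rewrite mulf_eq0 expf_eq0 /=.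
by case: eqP => // c0; move: w0; rewrite wE c0 scale0r eqxx.
Qed.

End Elimination.

(** * Linear sections and point varieties *)

Section Sections.
Local Open Scope classical_set_scope.
Local Open Scope card_scope.
Local Open Scope ring_scope.
Variable K : numClosedFieldType.

Lemma dim_is_unique n m (X : set (mpspace K n m)) k l : dim_is X k -> dim_is X l -> k = l.
Proof. by move=> [h1 H1] [h2 H2]; apply/anti_leq; rewrite H1 // H2. Qed.

Lemma mpoint_eq n m (x y : mpspace K n m) : (forall i, val (x i) = val (y i)) -> x = y.
Proof. by move=> H; apply/funext => i; apply/val_inj. Qed.

Lemma linspaceE c m (A : 'M[K]_(c, m)) (x : grass K 1 m) :
  linspace A x <-> A *m vpick (val x) = 0.
Proof.
rewrite /linspace /=; have xE : val x = <[vpick (val x)]>%VS.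
  by have := @rep_line K 1 m (fun=> x) 0.
rewrite {1}xE -memvE memv_ker lfunE /=; split=> [/eqP|/eqP] //.
Qed.

Lemma vlineZ m c (v : 'cV[K]_m) : c != 0 -> <[c *: v]>%VS = <[v]>%VS.
Proof.
move=> c0; apply/eqP; rewrite eqEsubv -!memvE; apply/andP; split; apply/vlineP.
  by exists c.
by exists c^-1; rewrite scalerA mulVf // scale1r.
Qed.

Lemma mul_line_eq0 p m (A : 'M[K]_(p, m)) (u v : 'cV[K]_m) :
  <[u]>%VS = <[v]>%VS -> A *m u = 0 -> A *m v = 0.
Proof.
move=> uv Au; have /vlineP[c ->] : v \in <[u]>%VS by rewrite uv memv_line.
by rewrite -scalemxAr Au scaler0.
Qed.

Definition secmx n m (d : 'I_n -> nat) (b : {i : 'I_n & ('I_(d i) * 'I_m)%type} -> K) i :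
  'M[K]_(d i, m) := \matrix_(r, c) b (Tagged (fun i => ('I_(d i) * 'I_m)%type) (r, c)).

Definition secrow n m (d : 'I_n -> nat) (b : {i : 'I_n & ('I_(d i) * 'I_m)%type} -> K)
  (t : {i : 'I_n & 'I_(d i)}) : 'rV[K]_m := row (tagged t) (secmx b (tag t)).

Lemma secmx_mul0 n m d b i (v : 'cV[K]_m) :
  @secmx n m d b i *m v = 0 <-> forall r : 'I_(d i), secrow b (Tagged (fun i => 'I_(d i)) r) *m v = 0.
Proof.
split=> [H r|H]; first by rewrite /secrow -row_mul H row0.
by apply/row_matrixP => r; rewrite row_mul row0; apply: H.
Qed.

Lemma multideg_gen n m (X : set (mpspace K n m)) d k :
  multideg_dom X d ->
  gen (fun b => (forall i, \rank (@secmx n m d b i) = d i) ->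
    X `&` [set x | forall i, @secmx n m d b i *m rep x i = 0] #= `I_k) ->
  multideg X d k.
Proof.
move=> dom /gen_generically[p p0 H]; split=> //; exists p => // a /H{}H /= rk.
have := H rk; congr (_ #= _); congr (_ `&` _); apply/seteqP; split=> x /= Hx i.
  by apply/linspaceE/Hx.
by apply/(linspaceE _ (x i)).1/Hx.
Qed.

Lemma card_tagged_ord n (d : 'I_n -> nat) : #|{: {i : 'I_n & 'I_(d i)}}| = (\sum_i d i)%N.
Proof. by rewrite card_tagged sumnE big_map enumT; apply: eq_bigr => i _; rewrite card_ord. Qed.

(** The inverse without its first column. Its columns span an affine slice on which the forms in [N]
    take arbitrary prescribed values. *)
Lemma bordered_dual s (r : 'rV[K]_s.+1) (N : 'M[K]_(s, s.+1)) :
  \det (bordered r N) != 0 -> exists Z : 'M[K]_(s.+1, s), N *m Z = 1%:M.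
Proof.
rewrite -unitfE -unitmxE => U; exists (colsub (lift ord0) (invmx (bordered r N))).
have /matrixP BV := mulmxV U; apply/matrixP => i j.
rewrite mxE [RHS]mxE; have := BV (lift ord0 i) (lift ord0 j).
rewrite mxE [RHS]mxE (inj_eq lift_inj) => H; rewrite -[RHS]H.
by apply: eq_bigr => k _; rewrite borderedS mxE.
Qed.

Lemma rank_corank1 p h (A : 'M[K]_(p, h.+1)) : \rank A = h ->
  exists2 v : 'cV[K]_h.+1, v != 0 & forall x, A *m x = 0 <-> exists c, x = c *: v.
Proof.
move=> rA; have rk : \rank (kermx A^T) = 1%N by rewrite mxrank_ker mxrank_tr rA subSnn.
pose w := nz_row (kermx A^T); have w0 : w != 0.
  by rewrite nz_row_eq0 -mxrank_eq0 rk.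
have wk : (w <= kermx A^T)%MS by exact: nz_row_sub.
have kw : (kermx A^T <= w)%MS.
  by rewrite -(geq_leqif (mxrank_leqif_sup wk)) rk rank_rV w0.
have kE (x : 'cV[K]_h.+1) : A *m x = 0 <-> (x^T <= kermx A^T)%MS.
  split=> [Ax|/sub_kermxP]; first by apply/sub_kermxP; rewrite -trmx_mul Ax trmx0.
  by rewrite -trmx_mul => /(congr1 trmx); rewrite trmxK trmx0.
exists w^T; first by rewrite -(inj_eq (@trmx_inj _ _ _)) trmxK trmx0.
move=> x; rewrite kE; split=> [/submx_trans/(_ kw)/sub_rVP[c xE]|[c ->]].
  by exists c; apply: trmx_inj; rewrite xE trmxZ trmxK.
by rewrite trmxZ trmxK scalemx_sub.
Qed.

End Sections.

(** * Products of projective spaces *)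

Section FullSpace.
Local Open Scope classical_set_scope.
Local Open Scope card_scope.
Local Open Scope ring_scope.
Variable K : numClosedFieldType.
Variables n h : nat.

(** The charts normalise one coordinate per factor to 1, leaving [n * h] parameters. The chart of
    the first coordinates also carries the linear chain. *)
Lemma dim_mpspace : dim_is [set: mpspace K n h.+1] (n * h).
Proof.
have cE : #|{: 'I_n * 'I_h}| = (n * h)%N by rewrite card_prod !card_ord.
pose ix ir : 'I_(n * h) := cast_ord cE (enum_rank ir).
pose phi (s : {ffun 'I_n -> 'I_h.+1}) (t : 'I_(n * h) -> K) i : 'cV[K]_h.+1 :=
  \col_a if unlift (s i) a is Some r then t (ix (i, r)) else 1.
have pphi s i j : polyfun (fun t => phi s t i j 0).
  have [r E|E] := unliftP (s i) j.
    apply: polyfun_ext (polyfun_coord K (ix (i, r))) => t.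
    by rewrite mxE E liftK.
  by apply: polyfun_ext (@polyfun_const K _ 1) => t; rewrite mxE E unlift_none.
have clT : [set: mpspace K n h.+1] = zclosure setT.
  by apply/seteqP; split=> // x _; apply: subset_zclosure.
split; last first.
  rewrite clT => l; apply: (chain_length_le pphi) => y _.
  have /fin_all_exists[s sE] (i : 'I_n) : exists j, rep y i j 0 != 0.
    by have /matrix0Pn[j [o]] := rep_neq0 y i; rewrite [o]ord1 => H; exists j.
  exists [ffun i => s i], (fun k => let ir := enum_val (cast_ord (esym cE) k) in
    (rep y ir.1 (s ir.1) 0)^-1 * rep y ir.1 (lift (s ir.1) ir.2) 0) => i.
  rewrite rep_line; have -> : rep y i = (rep y i (s i) 0) *: phi [ffun i => s i]
      (fun k => let ir := enum_val (cast_ord (esym cE) k) in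
      (rep y ir.1 (s ir.1) 0)^-1 * rep y ir.1 (lift (s ir.1) ir.2) 0) i.
    apply/matrixP => a b; rewrite ord1 !mxE ffunE; case: unliftP => [r ->|->].
      by rewrite cast_ordK enum_rankK /= mulVKf.
    by rewrite mulr1.
  by rewrite vlineZ.
pose s0 : {ffun 'I_n -> 'I_h.+1} := [ffun=> ord0].
pose ir k := enum_val (cast_ord (esym cE) k) : 'I_n * 'I_h.
apply: (linear_chain (phi := phi s0) (i_ := fun k => (ir k).1)
  (b := fun k => delta_mx 0 (lift ord0 (ir k).2))) => //.
- by rewrite clT; apply: zclosed_zclosure.
- move=> i; apply/matrix0Pn; exists ord0, 0.
  by rewrite mxE ffunE unlift_none oner_eq0.
- move=> t k; rewrite -rowE !mxE ffunE liftK; congr t.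
  by rewrite -surjective_pairing /ix enum_valK cast_ordKV.
Qed.

(** Since [d i <= h] and the sum is [n * h], every [d i] equals [h], and the section is one point in
    each factor. *)
Lemma multideg_mpspace : multideg_constant [set: mpspace K n h.+1] 1.
Proof.
split; first exists (fun=> h).
  split; last by move=> i.
  by rewrite sum_nat_const card_ord; apply: dim_mpspace.
move=> d dom; apply: (multideg_gen dom); apply: genT => b rk.
have [/(dim_is_unique dim_mpspace) dsum dlt] := dom.
have dh i : d i = h.
  apply/anti_leq; rewrite -ltnS dlt /= leqNgt; apply/negP => dih.
  have : (\sum_i d i < \sum_(i < n) h)%N.
    rewrite (bigD1 i) //= [X in (_ < X)%N](bigD1 i) //= -addSn leq_add //.
    by apply: leq_sum => j _; have := dlt j.
  by rewrite sum_nat_const card_ord -dsum ltnn.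
have /fin_all_exists2[v v0 vE] i := rank_corank1 (etrans (rk i) (dh i)).
have [y yE] := ex_mpoint v0.
suff -> : [set: mpspace K n h.+1] `&` [set x | forall i, secmx b i *m rep x i = 0] = [set y].
  exact: card_set1.
apply/seteqP; split=> [x [_ Hx]|_ ->] /=.
  apply: mpoint_eq => i; have /vE[c cE] := Hx i.
  rewrite yE rep_line cE vlineZ //; apply: contraNneq (rep_neq0 x i) => c0.
  by rewrite cE c0 scale0r.
split=> // i; apply: (@mul_line_eq0 _ _ _ _ (v i)).
  by rewrite -rep_line yE.
by apply/vE; exists 1; rewrite scale1r.
Qed.

End FullSpace.

(** * Point varieties and their sections *)

Section Points.
Local Open Scope classical_set_scope.
Local Open Scope card_scope.
Local Open Scope ring_scope.
Variable K : numClosedFieldType.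

Lemma camera_img_line N h (C : 'M[K]_(h.+1, N.+1)) (x : 'cV[K]_N.+1) :
  camera_img C <[x]> = <[C *m x]>%VS.
Proof. by rewrite /camera_img limg_line lfunE. Qed.

Lemma point_source n N h (C : arrangement K n N h) (y : mpspace K n h.+1) :
  (exists X : grass K 1 N.+1, forall i, val (y i) = camera_img (C i) (val X)) <->
  (exists x : 'cV[K]_N.+1, x != 0 /\ forall i, val (y i) = <[C i *m x]>%VS).
Proof.
split=> [[X yX]|[x [x0 yx]]].
  exists (vpick (val X)); split; first exact: (@rep_neq0 K 1 N.+1 (fun=> X) 0).
  move=> i; rewrite yX -camera_img_line; congr camera_img.
  exact: (@rep_line K 1 N.+1 (fun=> X) 0).
have dx : \dim <[x]>%VS == 1%N by rewrite dim_vline x0.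
exists (exist (fun U : {vspace 'cV[K]_N.+1} => is_true (\dim U == 1%N)) _ dx) => i.
by rewrite yx camera_img_line.
Qed.

Section Fixed.
Variables (n N h : nat) (C : arrangement K n N h).
Hypothesis n_gt0 : (0 < n)%N.

(** The conditions are the 2 by 2 minors of the pair [C i *m x], [y i], linear in [x]. With [J = 0]
    the elimination theorem carries no quadric. In the limit [C i *m x] may be zero, which [c = 0]
    allows. *)
Lemma point_variety_incidence (y : mpspace K n h.+1) : point_variety C y ->
  exists2 x : 'cV[K]_N.+1, x != 0 & forall i, exists c, C i *m x = c *: rep y i.
Proof.
pose rho (t : 'I_n * 'I_h.+1 * 'I_h.+1) k : mform K n h.+1 :=
  C t.1.1 t.1.2 k *: 'X_(enum_rank (t.1.1, t.2)) -
  C t.1.1 t.2 k *: 'X_(enum_rank (t.1.1, t.1.2)).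
have hrho t k : mhom (fun i => (i == t.1.1) : nat) (rho t k).
  by apply: mhomD; rewrite -?scaleNr; apply: mhomZ; apply: mhomX.
have rhoE t z (x : 'cV[K]_N.+1) : \sum_k evm (rho t k) (rep z) * x k 0 =
    (C t.1.1 *m x) t.1.2 0 * rep z t.1.1 t.2 0 - (C t.1.1 *m x) t.2 0 * rep z t.1.1 t.1.2 0.
  rewrite !mxE !big_distrl -sumrB; apply: eq_bigr => k _ /=.
  rewrite /rho /evm mevalB -!/(evm _ _) !evmZ !evm_var /=; ring.
move=> /(incidence_zclosure (J := 0) hrho)[].
  move=> z /point_source[x [x0 zx]]; exists x; split=> //.
    move=> t; rewrite rhoE; have /vlineP[c ->] : C t.1.1 *m x \in <[rep z t.1.1]>%VS.
      by rewrite -rep_line zx memv_line.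
    by rewrite !mxE; ring.
  by rewrite /qf mulmx0 mul0mx mxE.
move=> x [x0 Hx _]; exists x => // i.
have /matrix0Pn[j [o]] := rep_neq0 y i; rewrite [o]ord1 {o} => yj.
exists ((C i *m x) j 0 / rep y i j 0); apply/matrixP => a o; rewrite ord1 {o}.
have := Hx (i, a, j); rewrite rhoE /= => /eqP; rewrite subr_eq0 => /eqP E.
by rewrite [RHS]mxE mulrAC -E mulfK.
Qed.

Section Data.
Variables (d : 'I_n -> nat) (b : {i : 'I_n & ('I_(d i) * 'I_h.+1)%type} -> K).
Variable e : 'I_N -> {i : 'I_n & 'I_(d i)}.
Hypothesis e_bij : bijective e.

Definition point_forms : 'M[K]_(N, N.+1) :=
  \matrix_(j, k) (secrow b (e j) *m C (tag (e j))) 0 k.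

Variable a : 'I_n -> 'I_h.+1.
(** By [det_bordered] this determinant is the coordinate [a i] of [C i *m x0], where [x0] is the
    vector of minors: the common zero of the forms has an image in every camera. *)
Hypothesis Da : forall i, \det (bordered (row (a i) (C i)) point_forms) != 0.

Let x0 := minors point_forms.

Lemma point_forms_mul (x : 'cV[K]_N.+1) j :
  (point_forms *m x) j 0 = (secrow b (e j) *m (C (tag (e j)) *m x)) 0 0.
Proof. by rewrite mulmxA mxE [RHS]mxE; apply: eq_bigr => k _; rewrite mxE. Qed.

Lemma point_forms_eq0 (x : 'cV[K]_N.+1) :
  point_forms *m x = 0 <-> forall i, secmx b i *m (C i *m x) = 0.
Proof.
split=> [H i|H].
  apply/secmx_mul0 => r; have [e' ek eK] := e_bij.
  have /matrixP/(_ (e' (Tagged (fun i => 'I_(d i)) r)) 0) := H.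
  rewrite point_forms_mul eK /= => H0; apply/matrixP => u v; rewrite !ord1 H0.
  by rewrite !mxE.
apply/matrixP => j v; rewrite ord1 point_forms_mul; have := H (tag (e j)).
by move=> /secmx_mul0/(_ (tagged (e j))); rewrite taggedK => ->; rewrite !mxE.
Qed.

Let Cx0 i : C i *m x0 != 0.
Proof.
apply/matrix0Pn; exists (a i), 0; have := Da i.
by rewrite det_bordered -row_mul mxE.
Qed.

Let x0_neq0 : x0 != 0.
Proof. by apply: contraNneq (Cx0 (Ordinal n_gt0)) => ->; rewrite mulmx0. Qed.

Lemma dim_point_variety : dim_is (point_variety C) N.
Proof.
split; last first.
  (* Two charts: the affine space [x_0 = 1], and the hyperplane [x_0 = 0] through its [N]
     homogeneous coordinates. *)
  pose ext (c : bool) (t : 'I_N -> K) : 'cV[K]_N.+1 :=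
    \col_k if unlift ord0 k is Some j then t j else c%:R.
  have pext c k : polyfun (fun t => ext c t k 0).
    have [j ->|->] := unliftP ord0 k.
      by apply: polyfun_ext (polyfun_coord K j) => t; rewrite mxE liftK.
    by apply: polyfun_ext (@polyfun_const K _ c%:R) => t; rewrite mxE unlift_none.
  move=> l; apply: (chain_length_le (phi := fun c t i => C i *m ext c t)).
    move=> c i j; apply: (@polyfun_ext _ _ (fun t => \sum_k C i j k * ext c t k 0)).
      by move=> t; rewrite mxE.
    by apply: polyfun_sum => k _; apply: polyfunM; [exact: polyfun_const|].
  move=> y /point_source[x [_ yx]]; have [c0|c0] := eqVneq (x ord0 0) 0.
    exists false, (fun j => x (lift ord0 j) 0) => i; rewrite yx; congr <[_ *m _]>%VS.
    by apply/matrixP => k o; rewrite ord1 mxE; case: unliftP => [j ->|->].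
  exists true, (fun j => (x ord0 0)^-1 * x (lift ord0 j) 0) => i.
  rewrite yx -(@vlineZ _ _ (x ord0 0)^-1) ?invr_eq0 // scalemxAr; congr <[_ *m _]>%VS.
  apply/matrixP => k o; rewrite ord1 mxE [RHS]mxE; case: unliftP => [j ->//|->].
  by rewrite mulVf.
(* On the slice [x0 + Z t] the forms take exactly the values [t], as the linear chain requires. *)
have [Z PZ] := bordered_dual (Da (Ordinal n_gt0)).
pose phi (t : 'I_N -> K) i := C i *m (x0 + Z *m \col_j t j).
apply: (linear_chain (phi := phi) (i_ := fun j => tag (e j)) (b := fun j => secrow b (e j))).
- exact: zclosed_zclosure.
- move=> i j; apply: (@polyfun_ext _ _
    (fun t => \sum_k C i j k * (x0 k 0 + \sum_l Z k l * t l))).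
    move=> t; rewrite [RHS]mxE; apply: eq_bigr => k _; congr (_ * _).
    by rewrite !mxE; congr (_ + _); apply: eq_bigr => l _; rewrite !mxE.
  apply: polyfun_sum => k _; apply: polyfunM; first exact: polyfun_const.
  apply: polyfunD; first exact: polyfun_const.
  apply: polyfun_sum => l _; apply: polyfunM; first exact: polyfun_const.
  exact: polyfun_coord.
- move=> i; rewrite /phi (_ : \col_j 0 = 0) ?mulmx0 ?addr0 //.
  by apply/matrixP => u v; rewrite !mxE.
- move=> t y yt; apply: subset_zclosure; apply/point_source.
  exists (x0 + Z *m \col_j t j); split=> //.
  have := rep_neq0 y (Ordinal n_gt0); rewrite -memv0 => H.
  by apply: contraNneq H => x00; rewrite memv0 /rep yt /phi x00 mulmx0 vpick0.
- move=> t j; rewrite -point_forms_mul mulmxDr mul_minors add0r mulmxA PZ mul1mx mxE //.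
Qed.

(** A point of the closure in the section is incident to some [x] killed by all forms, hence to a
    multiple of [x0]. No image of [x0] is zero, so incidence determines every factor. *)
Lemma point_section :
  point_variety C `&` [set y | forall i, secmx b i *m rep y i = 0] #= `I_1.
Proof.
have [y yE] := ex_mpoint Cx0.
suff -> : point_variety C `&` [set y | forall i, secmx b i *m rep y i = 0] = [set y].
  exact: card_set1.
apply/seteqP; split=> [z [/point_variety_incidence[x x00 xz] Hz]|_ ->] /=; last first.
  split.
    apply: subset_zclosure; apply/point_source; by exists x0.
  move=> i; apply: (@mul_line_eq0 _ _ _ _ (C i *m x0)); first by rewrite -rep_line yE.
  by move: i; apply/point_forms_eq0; apply: mul_minors.
have [|c xE] := @kernel_minors _ _ point_forms x x0_neq0.
  apply/point_forms_eq0 => i; have [c ->] := xz i.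
  by rewrite -scalemxAr Hz scaler0.
have c0 : c != 0 by apply: contraNneq x00 => c0; rewrite xE c0 scale0r.
apply: mpoint_eq => i; rewrite yE; have [c' c'E] := xz i.
have c'0 : c' != 0.
  apply: contraNneq (Cx0 i) => c'0; move: c'E; rewrite xE c'0 scale0r -scalemxAr.
  by move/eqP; rewrite scaler_eq0 (negbTE c0).
rewrite rep_line -(vlineZ _ c'0) -c'E xE -scalemxAr vlineZ //.
Qed.

End Data.
End Fixed.
End Points.

(** This is where the list of pairs enters. Too few cameras for [N] conditions means one camera for
    [(3, 2)] and [(2, 1)], and one or two for [(3, 1)]; in these cases the stacked camera matrix can
    have independent rows. *)
Lemma small_points_size N h n :
  (N, h) \in [:: (3, 3); (3, 2); (3, 1); (2, 2); (2, 1); (1, 1)]%N ->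
  (0 < n)%N -> (n * h < N)%N -> (n * h.+1 <= N.+1)%N.
Proof.
rewrite !inE !xpair_eqE; case: n => // k.
by do ?[case/orP]; move=> /andP[/eqP-> /eqP->] _; lia.
Qed.

(** * Generic cameras for points *)

Section GenericPoints.
Local Open Scope classical_set_scope.
Local Open Scope card_scope.
Local Open Scope ring_scope.
Variable K : numClosedFieldType.
Variable n : nat.
Hypothesis n_gt0 : (0 < n)%N.

Lemma bounded_composition N h : (N <= n * h)%N ->
  exists d : {ffun 'I_n -> 'I_h.+1}, (\sum_i d i = N)%N.
Proof.
move=> Nnh; have dh i : (minn h (N - i * h) < h.+1)%N by rewrite ltnS geq_minl.
(* Greedy filling: each entry takes [h] as long as enough is left. *)
exists [ffun i : 'I_n => Ordinal (dh i)].
transitivity (\sum_(i < n) minn h (N - i * h))%N.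
  by apply: eq_bigr => i _; rewrite ffunE.
transitivity (minn N (n * h)); last exact/minn_idPl.
by elim: (n) => [|k IH]; rewrite ?big_ord0 ?big_ord_recr /= ?IH; lia.
Qed.

Variables N h : nat.

Definition cam_of (a : 'I_n * 'I_h.+1 * 'I_N.+1 -> K) : arrangement K n N h :=
  fun i => \matrix_(r, c) a (i, r, c).

Lemma points_big : (N <= n * h)%N ->
  gen (fun a => multideg_constant (point_variety (cam_of a)) 1).
Proof.
move=> Nnh.
pose good (d : {ffun 'I_n -> 'I_h.+1}) a
    (b : {i : 'I_n & ('I_(d i) * 'I_h.+1)%type} -> K) :=
  exists2 e : 'I_N -> {i : 'I_n & 'I_(d i)}, bijective e &
    forall i, \det (bordered (row (d i) (cam_of a i)) (point_forms (cam_of a) b e)) != 0.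
have key : gen (fun a => forall d : {ffun 'I_n -> 'I_h.+1}, (\sum_i d i)%N = N -> gen (good d a)).
  apply: gen_forall => d; apply: gen_imp => dN.
  have cN : #|{: {i : 'I_n & 'I_(d i)}}| = N by rewrite card_tagged_ord.
  pose e j : {i : 'I_n & 'I_(d i)} := enum_val (cast_ord (esym cN) j).
  pose ei x : 'I_N := cast_ord cN (enum_rank x).
  have eK : cancel e ei by move=> j; rewrite /ei /e enum_valK cast_ordKV.
  have eiK : cancel ei e by move=> x; rewrite /ei /e cast_ordK enum_rankK.
  have e_bij : bijective e by exists ei.
  pose f i a (b : {i : 'I_n & ('I_(d i) * 'I_h.+1)%type} -> K) :=
    \det (bordered (row (d i) (cam_of a i)) (point_forms (cam_of a) b e)).
  suff H i : gen (fun a => gen (fun b => f i a b != 0)).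
    apply: gen_mono (gen_forall H) => a /gen_forall; apply: gen_mono => b Hb.
    by exists e.
  have fE a b j k : point_forms (cam_of a) b e j k = \sum_l
      b (Tagged (fun i => ('I_(d i) * 'I_h.+1)%type) (tagged (e j), l)) * a (tag (e j), l, k).
    by rewrite mxE mxE; apply: eq_bigr => l _; rewrite !mxE.
  apply: gen2_nonzero.
  - move=> b; apply: polyfun_det => j k; have [j' ->|->] := unliftP ord0 j.
      apply: polyfun_ext (fun a => esym (etrans (borderedS _ _ _ _) (fE a b j' k))) _.
      apply: polyfun_sum => l _; apply: polyfunM; first exact: polyfun_const.
      exact: polyfun_coord.
    apply: polyfun_ext (polyfun_coord K (i, d i, k)) => a.
    by rewrite bordered0 !mxE.
  - move=> a; apply: polyfun_det => j k; have [j' ->|->] := unliftP ord0 j.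
      apply: polyfun_ext (fun b => esym (etrans (borderedS _ _ _ _) (fE a b j' k))) _.
      apply: polyfun_sum => l _; apply: polyfunM; last exact: polyfun_const.
      exact: polyfun_coord.
    apply: polyfun_ext (polyfun_const _ (a (i, d i, k))) => b.
    by rewrite bordered0 !mxE.
  pose a0 (t : 'I_n * 'I_h.+1 * 'I_N.+1) : K :=
    (t.2 == (if insub (t.1.2 : nat) is Some r
      then lift ord0 (ei (Tagged (fun i => 'I_(d i)) (r : 'I_(d t.1.1)))) else ord0))%:R.
  pose b0 (t : {i : 'I_n & ('I_(d i) * 'I_h.+1)%type}) : K :=
    ((tagged t).2 == (tagged t).1 :> nat)%:R.
  exists a0, b0; suff -> : f i a0 b0 = 1 by rewrite oner_eq0.
  rewrite /f -[RHS](det1 _ N.+1); congr (\det _); apply/matrixP => j k.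
  have [j' ->|->] := unliftP ord0 j; last first.
    by rewrite bordered0 !mxE /a0 /= insubF ?ltnn // eq_sym.
  rewrite borderedS fE mxE.
  have lt : (tagged (e j') < h.+1)%N.
    by apply: leq_trans (ltn_ord _) _; rewrite -ltnS ltnW // ltnS ltn_ord.
  rewrite (bigD1 (Ordinal lt)) //= big1 ?addr0 => [|l ll]; last first.
    by rewrite /b0 /= -[_ == _ :> nat]/(l == Ordinal lt) (negbTE ll) mul0r.
  by rewrite /b0 /= eqxx mul1r /a0 /= valK taggedK eK eq_sym.
apply: gen_mono key => a H.
have dim : dim_is (point_variety (cam_of a)) N.
  have [d dN] := bounded_composition Nnh; have [b [e e_bij De]] := gen_ex (H d dN).
  exact: (dim_point_variety n_gt0 (a := fun i => d i) De).
split.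
  by have [d dN] := bounded_composition Nnh; exists (fun i => d i); split; rewrite ?dN.
move=> d dom; have [dimd dlt] := dom.
have [d' dd'] : exists d' : {ffun 'I_n -> 'I_h.+1}, d = (fun i => d' i : nat).
  by exists [ffun i => Ordinal (dlt i)]; apply/funext => i; rewrite ffunE.
have dN := dim_is_unique dimd dim.
clear dimd dlt; move: dom dN; rewrite dd' => dom dN.
apply: (multideg_gen dom); apply: gen_mono (H d' dN) => b [e e_bij De] _.
exact: (point_section n_gt0 e_bij (a := fun i => d' i) De).
Qed.

(** The stacked camera matrix is generically onto, so every tuple of image points has a common
    source and the variety is the whole product. *)
Lemma points_small : (n * h.+1 <= N.+1)%N ->
  gen (fun a => multideg_constant (point_variety (cam_of a)) 1).
Proof.
move=> nhN; pose R := ('I_n * 'I_h.+1)%type.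
have cR : #|{: R}| = (n * h.+1)%N by rewrite card_prod !card_ord.
pose P (a : 'I_n * 'I_h.+1 * 'I_N.+1 -> K) : 'M[K]_(#|{: R}|, N.+1) :=
  \matrix_(r, k) a (enum_val r, k).
pose W : 'M[K]_(N.+1, #|{: R}|) := \matrix_(k, r) (k == r :> nat)%:R.
have PE a r s : (P a *m W) r s = \sum_k a (enum_val r, k) * (k == s :> nat)%:R.
  by rewrite mxE; apply: eq_bigr => k _; rewrite !mxE.
have : gen (fun a => \det (P a *m W) != 0).
  apply: gen_nonzero.
    apply: polyfun_det => r s; apply: polyfun_ext (fun a => esym (PE a r s)) _.
    apply: polyfun_sum => k _; apply: polyfunM; last exact: polyfun_const.
    exact: polyfun_coord.
  exists (fun t : R * 'I_N.+1 => (t.2 == enum_rank t.1 :> nat)%:R : K).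
  suff -> : P (fun t : R * 'I_N.+1 => (t.2 == enum_rank t.1 :> nat)%:R : K) *m W = 1%:M.
    by rewrite det1 oner_eq0.
  apply/matrixP => r s; rewrite PE mxE.
  have lt : (s < N.+1)%N by rewrite (leq_trans (ltn_ord s)) // cR.
  rewrite (bigD1 (Ordinal lt)) //= eqxx mulr1 enum_valK eq_sym big1 ?addr0 //.
  by move=> k ks; rewrite -[k == s :> nat]/(k == Ordinal lt) (negbTE ks) mulr0.
apply: gen_mono => a; rewrite -unitfE -unitmxE => U.
have surj (v : 'I_n -> 'cV[K]_h.+1) : exists x, forall i, cam_of a i *m x = v i.
  pose w : 'cV[K]_#|{: R}| := \col_r v (enum_val r).1 (enum_val r).2 0.
  exists (W *m (invmx (P a *m W) *m w)) => i; apply/matrixP => r o; rewrite ord1 {o}.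
  have /matrixP/(_ (enum_rank (i, r)) 0) : P a *m (W *m (invmx (P a *m W) *m w)) = w.
    by rewrite !mulmxA mulmxV // mul1mx.
  rewrite [RHS]mxE enum_rankK /= => H; rewrite -[RHS]H !mxE.
  by apply: eq_bigr => k _; rewrite !mxE enum_rankK.
suff -> : point_variety (cam_of a) = setT by apply: multideg_mpspace.
apply/seteqP; split=> // y _; apply: subset_zclosure; apply/point_source.
have [x xE] := surj (rep y); exists x; split.
  apply: contraNneq (rep_neq0 y (Ordinal n_gt0)) => x0.
  by rewrite -xE x0 mulmx0.
by move=> i; rewrite xE rep_line.
Qed.

Lemma points_generic :
  (N, h) \in [:: (3, 3); (3, 2); (3, 1); (2, 2); (2, 1); (1, 1)]%N ->
  @generic_cameras K n N h (fun C => multideg_constant (point_variety C) 1).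
Proof.
move=> Nh; have [NN|NN] := leqP N (n * h).
  by apply: gen_generically; apply: gen_mono (points_big NN) => a Ha C _.
have {}NN := small_points_size Nh n_gt0 NN.
by apply: gen_generically; apply: gen_mono (points_small NN) => a Ha C _.
Qed.

End GenericPoints.

(** * The Klein quadric *)

Section Klein.
Local Open Scope ring_scope.
Variable K : numClosedFieldType.

Lemma sum_ord3 (F : 'I_3 -> K) : \sum_i F i = F 't0 + F 't1 + F 't2.
Proof.
rewrite !big_ord_recl big_ord0 addr0 !addrA.
by congr (_ + _ + _); congr F; apply/val_inj.
Qed.

Lemma sum_ord4 (F : 'I_4 -> K) : \sum_i F i = F 'f0 + F 'f1 + F 'f2 + F 'f3.
Proof.
rewrite !big_ord_recl big_ord0 addr0 !addrA.
by congr (_ + _ + _ + _); congr F; apply/val_inj.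
Qed.

Lemma sum_ord6 (F : 'I_6 -> K) :
  \sum_i F i = F 's0 + F 's1 + F 's2 + F 's3 + F 's4 + F 's5.
Proof.
rewrite !big_ord_recl big_ord0 addr0 !addrA.
by congr (_ + _ + _ + _ + _ + _); congr F; apply/val_inj.
Qed.

Lemma ord4P (P : 'I_4 -> Prop) : P 'f0 -> P 'f1 -> P 'f2 -> P 'f3 -> forall i, P i.
Proof.
move=> P0 P1 P2 P3 [[|[|[|[|//]]]] Hi];
  [move: P0|move: P1|move: P2|move: P3]; congr P; exact: val_inj.
Qed.

Lemma ord6P (P : 'I_6 -> Prop) :
  P 's0 -> P 's1 -> P 's2 -> P 's3 -> P 's4 -> P 's5 -> forall i, P i.
Proof.
move=> P0 P1 P2 P3 P4 P5 [[|[|[|[|[|[|//]]]]]] Hi];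
  [move: P0|move: P1|move: P2|move: P3|move: P4|move: P5]; congr P; exact: val_inj.
Qed.

Definition pair6 (k : nat) : 'I_4 * 'I_4 :=
  match k with
  | 0 => ('f0, 'f1) | 1 => ('f0, 'f2) | 2 => ('f0, 'f3)
  | 3 => ('f1, 'f2) | 4 => ('f1, 'f3) | _ => ('f2, 'f3)
  end.

Definition skew4 (x : 'cV[K]_6) : 'M[K]_4 := \matrix_(i, j)
  match (i : nat), (j : nat) with
  | 0, 1 => x 's0 0 | 1, 0 => - x 's0 0
  | 0, 2 => x 's1 0 | 2, 0 => - x 's1 0
  | 0, 3 => x 's2 0 | 3, 0 => - x 's2 0
  | 1, 2 => x 's3 0 | 2, 1 => - x 's3 0
  | 1, 3 => x 's4 0 | 3, 1 => - x 's4 0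
  | 2, 3 => x 's5 0 | 3, 2 => - x 's5 0
  | _, _ => 0
  end.

(* The Gram matrix of the wedge product on the second exterior power. *)
Definition klein : 'M[K]_6 := \matrix_(i, j)
  match (i : nat), (j : nat) with
  | 0, 5 | 5, 0 | 2, 3 | 3, 2 => 1
  | 1, 4 | 4, 1 => -1
  | _, _ => 0
  end.

Definition wedge4 (u v : 'cV[K]_4) : 'cV[K]_6 :=
  \col_k (u (pair6 k).1 0 * v (pair6 k).2 0 - u (pair6 k).2 0 * v (pair6 k).1 0).

Definition bf (x y : 'cV[K]_6) : K := (x^T *m klein *m y) 0 0.

Lemma kleinE (x : 'cV[K]_6) : klein *m x = \col_k
  match (k : nat) with
  | 0 => x 's5 0 | 1 => - x 's4 0 | 2 => x 's3 0
  | 3 => x 's2 0 | 4 => - x 's1 0 | _ => x 's0 0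
  end.
Proof.
by apply/matrixP => k o; rewrite ord1 !mxE sum_ord6 !mxE; move: k; apply: ord6P => /=; ring.
Qed.

Lemma kleinK : klein *m klein = 1%:M.
Proof.
apply/matrixP => i j; rewrite !mxE sum_ord6 !mxE.
by move: i j; do 2!apply: ord6P; rewrite /= ; ring.
Qed.

Lemma klein_tr : klein^T = klein.
Proof. by apply/matrixP => i j; rewrite !mxE; move: i j; do 2!apply: ord6P. Qed.

Lemma bfE x y : bf x y = x 's0 0 * y 's5 0 - x 's1 0 * y 's4 0 + x 's2 0 * y 's3 0 +
  x 's3 0 * y 's2 0 - x 's4 0 * y 's1 0 + x 's5 0 * y 's0 0.
Proof. by rewrite /bf -mulmxA kleinE !mxE sum_ord6 !mxE /=; ring. Qed.

Lemma bfC x y : bf x y = bf y x.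
Proof. by rewrite !bfE; ring. Qed.

Lemma bfDl x y z : bf (x + y) z = bf x z + bf y z.
Proof. by rewrite /bf trmxD !mulmxDl mxE. Qed.

Lemma bfZl c x y : bf (c *: x) y = c * bf x y.
Proof. by rewrite /bf trmxZ -!scalemxAl mxE. Qed.

Lemma bfDr x y z : bf z (x + y) = bf z x + bf z y.
Proof. by rewrite /bf mulmxDr mxE. Qed.

Lemma bfZr c x y : bf y (c *: x) = c * bf y x.
Proof. by rewrite /bf -scalemxAr mxE. Qed.

Lemma skew4D x y : skew4 (x + y) = skew4 x + skew4 y.
Proof. by apply/matrixP => i j; rewrite !mxE; move: i j; do 2!apply: ord4P; rewrite /=; ring. Qed.

Lemma skew4Z c x : skew4 (c *: x) = c *: skew4 x.
Proof. by apply/matrixP => i j; rewrite !mxE; move: i j; do 2!apply: ord4P; rewrite /=; ring. Qed.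

Lemma skew40 : skew4 0 = 0.
Proof. by rewrite -[0 in LHS](scale0r 0) skew4Z scale0r. Qed.

Lemma skew4_tr x : (skew4 x)^T = - skew4 x.
Proof. by apply/matrixP => i j; rewrite !mxE; move: i j; do 2!apply: ord4P; rewrite /=; ring. Qed.

Lemma skew4_eq0 x : skew4 x = 0 -> x = 0.
Proof.
move=> /matrixP H; apply/matrixP => k o; rewrite ord1 [RHS]mxE.
by have := H (pair6 k).1 (pair6 k).2; rewrite !mxE; move: k {H}; apply: ord6P.
Qed.

Lemma skew4_wedge u v : skew4 (wedge4 u v) = u *m v^T - v *m u^T.
Proof.
apply/matrixP => i j; rewrite !mxE !big_ord1 !mxE.
by move: i j; do 2!apply: ord4P; rewrite /=; ring.
Qed.

(** Polarised form of [X^* X = - Pf(X) I], where [X^*] is the dual skew matrix. As [bf x x] is twice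
    the Pfaffian, lines, incidence and the quadric are all handled by this matrix identity. *)
Lemma skew4_star_mul a b :
  skew4 (klein *m a) *m skew4 (klein *m b) + skew4 b *m skew4 a = - (\sum_k a k 0 * b k 0) *: 1%:M.
Proof.
rewrite !kleinE; apply/matrixP => i j; rewrite sum_ord6 !mxE !sum_ord4 !mxE.
by move: i j; do 2!apply: ord4P; rewrite /=; ring.
Qed.

Lemma skew4_star_polar x y :
  skew4 (klein *m x) *m skew4 y + skew4 (klein *m y) *m skew4 x = - bf x y *: 1%:M.
Proof.
have := skew4_star_mul x (klein *m y); rewrite mulmxA kleinK mul1mx => ->.
by congr (- _ *: _); rewrite bfE kleinE sum_ord6 !mxE /=; ring.
Qed.

Lemma skew4_star_self x : skew4 (klein *m x) *m skew4 x = - (bf x x / 2) *: 1%:M.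
Proof.
have := skew4_star_polar x x; rewrite -mulr2n -scaler_nat => /(congr1 ( *:%R 2^-1)).
by rewrite !scalerA mulVf ?pnatr_eq0 // scale1r => ->; congr (_ *: _); ring.
Qed.

Lemma star_wedgel u v : skew4 (klein *m wedge4 u v) *m u = 0.
Proof.
rewrite kleinE; apply/matrixP => i j; rewrite ord1 !mxE sum_ord4 !mxE.
by move: i; apply: ord4P; rewrite /=; ring.
Qed.

Lemma star_wedger u v : skew4 (klein *m wedge4 u v) *m v = 0.
Proof.
rewrite kleinE; apply/matrixP => i j; rewrite ord1 !mxE sum_ord4 !mxE.
by move: i; apply: ord4P; rewrite /=; ring.
Qed.

Lemma wedge4_lin a b c d u v :
  wedge4 (a *: u + b *: v) (c *: u + d *: v) = (a * d - b * c) *: wedge4 u v.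
Proof. by apply/matrixP => k o; rewrite !mxE; ring. Qed.

Lemma wedge_isotropic u v : bf (wedge4 u v) (wedge4 u v) = 0.
Proof. by rewrite bfE !mxE /=; ring. Qed.

(** With the value -1 the polar identity becomes a decomposition of the identity matrix. *)
Lemma bf_nondegenerate x : x != 0 -> exists y, bf x y = -1.
Proof.
move=> /matrix0Pn[k [o]]; rewrite [o]ord1 {o} => xk.
exists (- (x k 0)^-1 *: (klein *m delta_mx k 0)).
rewrite bfZr /bf -mulmxA [klein *m (_ *m _)]mulmxA kleinK mul1mx -colE !mxE.
by rewrite mulNr mulVf.
Qed.

(** For [bf x y = -1] the transposed polar identity reads [Y X^* + X Y^* = I]. If [X^*] kills [z],
    then [z = X (Y^* z)], and the columns of [X] lie in the span of [u] and [v]. *)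
Lemma wedge_spanP u v z : wedge4 u v != 0 ->
  skew4 (klein *m wedge4 u v) *m z = 0 -> exists a b, z = a *: u + b *: v.
Proof.
move=> x0 Xz; have [y xy] := bf_nondegenerate x0.
have := skew4_star_polar (wedge4 u v) y; rewrite xy opprK scale1r.
move/(congr1 trmx); rewrite trmx1 trmxD !trmx_mul !skew4_tr !mulNmx !mulmxN !opprK.
move/(congr1 (mulmx^~ z)); rewrite mulmxDl -mulmxA Xz mulmx0 add0r mul1mx => {1}<-.
rewrite skew4_wedge -!mulmxA mulmxBl -!mulmxA; set w := _ *m z.
rewrite [v^T *m w]mx11_scalar [u^T *m w]mx11_scalar !mul_mx_scalar -scaleNr.
by eexists; eexists.
Qed.

Lemma wedge_decomp x : bf x x = 0 -> exists u v, x = wedge4 u v.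
Proof.
rewrite bfE => bx.
have {}bx : x 's0 0 * x 's5 0 - x 's1 0 * x 's4 0 + x 's2 0 * x 's3 0 = 0.
  apply: (@mulfI _ 2); first by rewrite pnatr_eq0.
  by rewrite mulr0 -bx; ring.
have [->|] := eqVneq x 0.
  by exists 0, 0; apply/matrixP => k o; rewrite !mxE; ring.
case/matrix0Pn=> k [o]; rewrite [o]ord1 {o} => xk.
(* Two rows of the skew matrix that cross in a nonzero entry span the line; that entry is the
   scaling factor. *)
exists ((x k 0)^-1 *: \col_i skew4 x (pair6 k).1 i), (\col_i skew4 x (pair6 k).2 i).
apply/matrixP => l o; rewrite ord1 {o}; apply: (mulfI xk).
rewrite !mxE mulrBr !mulrA mulfV // !mul1r; move: bx; clear xk.
move: k l; do 2!apply: ord6P; rewrite /=.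
all: move: (x 's0 0) (x 's1 0) (x 's2 0) (x 's3 0) (x 's4 0) (x 's5 0) => a b c d e f E.
all: first [ring | rewrite -[LHS]addr0 -E; ring | rewrite -[LHS]subr0 -E; ring].
Qed.

Lemma wedge4_free a b u v : wedge4 u v != 0 -> a *: u + b *: v = 0 -> a = 0 /\ b = 0.
Proof.
have w0 p : wedge4 0 p = 0 /\ wedge4 p 0 = 0.
  by split; apply/matrixP => k o; rewrite !mxE; ring.
move=> x0 E; split; apply/eqP.
  have := wedge4_lin a b 0 1 u v; rewrite E (w0 _).1 mulr1 mulr0 subr0 => /esym/eqP.
  by rewrite scaler_eq0 (negbTE x0) orbF.
have := wedge4_lin 1 0 a b u v; rewrite E (w0 _).2 mul1r mul0r subr0 => /esym/eqP.
by rewrite scaler_eq0 (negbTE x0) orbF.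
Qed.

(** For [bf = 0] the polar identity is [X^* Y + Y^* X = 0]. Any of its rows equates a combination of
    [l, l'] with one of [u, v]; it is nonzero for a suitable row unless [X^* l = 0], and then [l]
    itself is the common point. *)
Lemma wedge_meet u v l l' : wedge4 u v != 0 -> wedge4 l l' != 0 ->
  bf (wedge4 u v) (wedge4 l l') = 0 ->
  exists z, [/\ z != 0, exists a b, z = a *: u + b *: v & exists a b, z = a *: l + b *: l'].
Proof.
set x := wedge4 u v; set y := wedge4 l l' => x0 y0 xy.
pose s := skew4 (klein *m x) *m l; pose s' := skew4 (klein *m x) *m l'.
have [s0|s0] := eqVneq s 0.
  exists l; split; last by exists 1, 0; rewrite scale1r scale0r addr0.
    by apply: contraNneq y0 => l0; apply/eqP/matrixP => k o; rewrite !mxE l0 !mxE; ring.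
  exact: wedge_spanP.
have /matrix0Pn[k [o]] := s0; rewrite [o]ord1 {o} => sk.
pose t := skew4 (klein *m y) *m u; pose t' := skew4 (klein *m y) *m v.
have := skew4_star_polar x y; rewrite xy oppr0 scale0r.
rewrite !skew4_wedge !mulmxBr !mulmxA -/s -/s' -/t -/t' => /matrixP/(_ k) E.
exists (s k 0 *: l' + (- s' k 0) *: l); split.
- by apply: contraNneq sk; rewrite addrC => /(wedge4_free y0)[_ ->].
- exists (t' k 0), (- t k 0); apply/matrixP => i o; rewrite ord1 {o}.
  have := E i; rewrite !mxE !big_ord1 !mxE => /eqP; rewrite addr_eq0 => /eqP E'.
  by rewrite !mulNr E'; ring.
- by exists (- s' k 0), (s k 0); rewrite addrC.
Qed.

(** The common point [z] is killed by both dual matrices, so the polar identity applied to [z]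
    leaves [bf] times [z]. *)
Lemma wedge_meet_bf u v l l' a b c d : a *: u + b *: v = c *: l + d *: l' ->
  a *: u + b *: v != 0 -> bf (wedge4 u v) (wedge4 l l') = 0.
Proof.
set z := a *: u + b *: v => zE z0.
have := skew4_star_polar (wedge4 u v) (wedge4 l l').
move/(congr1 (mulmx z^T)); rewrite mulmxDr !mulmxA.
have H x : skew4 (klein *m x) *m z = 0 -> z^T *m skew4 (klein *m x) = 0.
  move=> Hx; apply: trmx_inj; rewrite trmx_mul trmxK skew4_tr mulNmx Hx oppr0 trmx0 //.
rewrite !H; last 2 first.
- by rewrite zE mulmxDr -!scalemxAr star_wedgel star_wedger !scaler0 addr0.
- by rewrite /z mulmxDr -!scalemxAr star_wedgel star_wedger !scaler0 addr0.
rewrite !mul0mx addr0 -scalemxAr mulmx1 => /esym/eqP; rewrite scaler_eq0 oppr_eq0.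
by case/orP => [/eqP//|/eqP/(congr1 trmx)]; rewrite trmxK trmx0 => /eqP; rewrite (negbTE z0).
Qed.

(** If [bf x x] were nonzero, [skew4 x] would be invertible, and the vanishing product would force
    twice the rank of [C] to be at most 4. *)
Lemma skew4_image_isotropic m (C : 'M[K]_(m, 4)) x : (3 <= \rank C)%N ->
  C *m skew4 x *m C^T = 0 -> bf x x = 0.
Proof.
move=> rC CX; apply/eqP; apply: contraTT rC => bx; rewrite -ltnNge.
have U : skew4 x \in unitmx.
  have /mulmx1_unit[] // : (- (bf x x / 2))^-1 *: skew4 (klein *m x) *m skew4 x = 1%:M.
  rewrite -scalemxAl skew4_star_self scalerA mulVf ?scale1r //.
  by rewrite oppr_eq0 mulf_neq0 // invr_eq0 pnatr_eq0.
have rk : \rank (skew4 x *m C^T) = \rank C.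
  by rewrite -mxrank_tr trmx_mul trmxK mxrankMfree // row_free_unit unitmx_tr.
have : (\rank C + \rank (skew4 x *m C^T) <= 4)%N.
  by apply: mulmx0_rank_max; rewrite mulmxA.
by rewrite rk; lia.
Qed.

End Klein.

(** * Four forms and the hyperbolic plane they cut out *)

Section HyperbolicPlane.
Local Open Scope ring_scope.
Variable K : numClosedFieldType.
Variables (p : nat) (O : 'M[K]_(p, 6)).
Local Notation J := (klein K).

Definition gram : 'M[K]_p := O *m J *m O^T.

Hypotheses (p4 : p = 4%N) (G_unit : gram \in unitmx).

(** A vector orthogonal to the whole kernel has the form [J O^T z]; applying [O] gives [gram] times
    [z], so [z = 0]. *)
Lemma kernel_pairing (x : 'cV[K]_6) : x != 0 -> O *m x = 0 ->
  exists2 w, O *m w = 0 & bf x w != 0.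
Proof.
move=> x0 Ox; apply: contrapT => H.
have Hw (w : 'cV[K]_6) : O *m w = 0 -> x^T *m J *m w = 0.
  move=> Ow; apply/matrixP => i j; rewrite !ord1 [RHS]mxE.
  by apply/eqP; apply: contrapT => /negP bw; apply: H; exists w.
have /submxP[z zE] : (x^T *m J <= O)%MS.
  have OC := mulmx_coker O; rewrite submxE; apply/eqP/matrixP => i j.
  have := Hw (col j (cokermx O)); rewrite {1}colE mulmxA OC mul0mx => /(_ erefl).
  by move/matrixP/(_ i 0); rewrite colE mulmxA -colE mxE [RHS]mxE => ->; rewrite mxE.
have xE : x = J *m O^T *m z^T.
  rewrite -mulmxA -trmx_mul -zE trmx_mul trmxK klein_tr mulmxA kleinK mul1mx //.
move: Ox; rewrite xE !mulmxA -/gram => /(congr1 (mulmx (invmx gram))).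
rewrite mulmxA mulVmx // mul1mx mulmx0 => z0.
by move: x0; rewrite xE z0 mulmx0 eqxx.
Qed.

Lemma hyperbolic_partner (x : 'cV[K]_6) : x != 0 -> O *m x = 0 -> bf x x = 0 ->
  exists y, [/\ O *m y = 0, bf y y = 0 & bf x y = 1].
Proof.
move=> x0 Ox xx; have [w Ow xw] := kernel_pairing x0 Ox.
(* Normalise the pairing with [x], then subtract the multiple of [x] that makes the vector
   isotropic. *)
exists ((bf x w)^-1 *: w + (- (bf w w) / (2 * bf x w ^+ 2)) *: x); split.
- by rewrite mulmxDr -!scalemxAr Ow Ox !scaler0 addr0.
- rewrite !bfDl !bfDr !bfZl !bfZr xx (bfC w x); field.
  by rewrite xw.
- by rewrite bfDr !bfZr xx mulr0 addr0 mulVf.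
Qed.

Lemma isotropic_solution : exists x, [/\ x != 0, O *m x = 0 & bf x x = 0].
Proof.
have [|x [x0 Ox qx]] := @isotropic_kernel K p 5 O J.
  by apply: leq_ltn_trans (rank_leq_row _) _; rewrite p4.
by exists x.
Qed.

Variables x1 x2 : 'cV[K]_6.
Hypotheses (Ox1 : O *m x1 = 0) (Ox2 : O *m x2 = 0).
Hypotheses (q1 : bf x1 x1 = 0) (q2 : bf x2 x2 = 0) (b12 : bf x1 x2 = 1).

Lemma hyperbolic_span x : O *m x = 0 -> x = bf x x2 *: x1 + bf x x1 *: x2.
Proof.
move=> Ox; pose D := col_mx x1^T x2^T.
have DJ : D *m J *m D^T = block_mx 0 1%:M 1%:M 0.
  rewrite tr_col_mx !trmxK mul_col_mx mul_col_row.
  have E a b : a^T *m J *m b = (bf a b)%:M by rewrite [LHS]mx11_scalar.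
  by rewrite !E q1 q2 (bfC x2) b12 !raddf0.
have rD : \rank D = 2%N.
  apply/anti_leq; rewrite rank_leq_row /=.
  have := mxrankM_maxl D (J *m D^T); rewrite mulmxA DJ; apply: leq_trans.
  have : \rank (block_mx 0 1%:M 1%:M 0 : 'M[K]_(1 + 1)) = 2%N; last by move->.
  apply/eqP; rewrite -/(row_free _) row_free_unit.
  have /mulmx1_unit[] // : (block_mx 0 1%:M 1%:M 0 : 'M[K]_(1 + 1)) *m block_mx 0 1%:M 1%:M 0 = 1%:M.
  by rewrite mulmx_block !mul0mx !mulmx0 !mulmx1 !addr0 !add0r -scalar_mx_block.
have rO : \rank (kermx O^T) = 2%N.
  rewrite mxrank_ker mxrank_tr (_ : \rank O = 4%N) //; apply/anti_leq.
  rewrite -[X in (_ <= X)%N]p4 rank_leq_row -{1}p4 /=.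
  have := mxrankM_maxl O (J *m O^T); rewrite mulmxA -/gram.
  by apply: leq_trans; rewrite mxrank_unit.
have DO : (D <= kermx O^T)%MS.
  by apply/sub_kermxP; rewrite mul_col_mx -!trmx_mul Ox1 Ox2 trmx0 col_mx0.
have OD : (kermx O^T <= D)%MS by rewrite -(geq_leqif (mxrank_leqif_sup DO)) rO rD.
have /submx_trans/(_ OD)/submxP[c cE] : (x^T <= kermx O^T)%MS.
  by apply/sub_kermxP; rewrite -trmx_mul Ox trmx0.
have xE : x = (lsubmx c) 0 0 *: x1 + (rsubmx c) 0 0 *: x2.
  apply: trmx_inj; rewrite trmxD !trmxZ cE -{1}[c]hsubmxK mul_row_col.
  by rewrite [lsubmx c]mx11_scalar [rsubmx c]mx11_scalar !mul_scalar_mx !mxE.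
rewrite {1}xE; congr (_ *: _ + _ *: _).
  by rewrite xE bfDl !bfZl b12 q2 mulr1 mulr0 addr0.
by rewrite xE bfDl !bfZl (bfC x2) b12 q1 mulr1 mulr0 add0r.
Qed.

(** In the basis [x1], [x2] the quadratic form is twice the product of the coordinates. *)
Lemma two_isotropic x : O *m x = 0 -> bf x x = 0 -> x != 0 ->
  exists2 c, c != 0 & x = c *: x1 \/ x = c *: x2.
Proof.
move=> Ox xx x0; have xE := hyperbolic_span Ox.
have : bf x x2 * bf x x1 = 0.
  apply: (@mulfI _ 2); first by rewrite pnatr_eq0.
  rewrite mulr0 -[RHS]xx {4}xE bfDr !bfZr; ring.
move/eqP; rewrite mulf_eq0 => /orP[] /eqP c0.
  exists (bf x x1); last by right; rewrite {1}xE c0 scale0r add0r.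
  by apply: contraNneq x0 => c1; rewrite xE c0 c1 !scale0r addr0.
exists (bf x x2); last by left; rewrite {1}xE c0 scale0r addr0.
by apply: contraNneq x0 => c1; rewrite xE c0 c1 !scale0r addr0.
Qed.

(** The right inverse of [O] whose image is orthogonal to the kernel, so that [K^6] is the
    orthogonal sum of the two. *)
Definition dual_forms : 'M[K]_(6, p) := J *m O^T *m invmx gram.

Lemma mul_dual_forms : O *m dual_forms = 1%:M.
Proof. by rewrite /dual_forms !mulmxA -/gram mulmxV. Qed.

Lemma bf_dual_forms z w : O *m w = 0 -> bf (dual_forms *m z) w = 0.
Proof.
move=> Ow; rewrite bfC /bf /dual_forms -!mulmxA [J *m (J *m _)]mulmxA kleinK mul1mx.
by rewrite mulmxA -trmx_mul Ow trmx0 mul0mx mxE.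
Qed.

Lemma hyperbolic_decomposition x :
  x = bf x x2 *: x1 + bf x x1 *: x2 + dual_forms *m (O *m x).
Proof.
set z := dual_forms *m _; have /hyperbolic_span : O *m (x - z) = 0.
  by rewrite mulmxBr /z [O *m (dual_forms *m _)]mulmxA mul_dual_forms mul1mx subrr.
rewrite -scaleN1r !bfDl !bfZl !bf_dual_forms // !mulr0 !addr0 => <-.
by rewrite scaleN1r subrK.
Qed.

(** Stereographic parametrisation of the quadric by the values [t] of the four forms; the multiple
    of [b] restores isotropy. *)
Definition affine_slice a b (t : 'cV[K]_p) : 'cV[K]_6 :=
  a + dual_forms *m t - (bf (dual_forms *m t) (dual_forms *m t) / 2) *: b.

Lemma affine_slice_forms a b t : O *m a = 0 -> O *m b = 0 -> O *m affine_slice a b t = t.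
Proof.
move=> Oa Ob; rewrite /affine_slice mulmxBr mulmxDr [O *m (dual_forms *m _)]mulmxA mul_dual_forms mul1mx Oa.
by rewrite -scalemxAr Ob scaler0 subr0 add0r.
Qed.

Lemma affine_slice_isotropic a b t : O *m a = 0 -> O *m b = 0 ->
  bf a a = 0 -> bf b b = 0 -> bf a b = 1 -> bf (affine_slice a b t) (affine_slice a b t) = 0.
Proof.
move=> Oa Ob aa bb ab; rewrite /affine_slice -scaleNr; set z := dual_forms *m t.
have za : bf z a = 0 by apply: bf_dual_forms.
have zb : bf z b = 0 by apply: bf_dual_forms.
rewrite !bfDl !bfDr !bfZl !bfZr aa bb ab (bfC b a) ab (bfC a z) (bfC b z) za zb.
by field.
Qed.

(** After scaling, a vector with nonzero coordinate on [x1] or on [x2] lies on the corresponding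
    slice. If both vanish, it is determined by the values of the forms. *)
Lemma isotropic_slices x : bf x x = 0 ->
  [\/ exists2 c, c != 0 & x = c *: affine_slice x1 x2 (c^-1 *: (O *m x)),
      exists2 c, c != 0 & x = c *: affine_slice x2 x1 (c^-1 *: (O *m x))
    | x = dual_forms *m (O *m x)].
Proof.
move=> xx; have xE := hyperbolic_decomposition x; move: xE.
set a := bf x x2; set b := bf x x1; set z := dual_forms *m _ => xE.
have zz : bf z z = - 2 * a * b.
  move: xx; rewrite {1 2}xE !bfDl !bfDr !bfZl !bfZr q1 q2 b12 (bfC x2) b12.
  have z1 : bf z x1 = 0 by apply: bf_dual_forms.
  have z2 : bf z x2 = 0 by apply: bf_dual_forms.
  rewrite (bfC x1 z) (bfC x2 z) z1 z2 => H.
  by apply/eqP; rewrite -subr_eq0 -[X in _ == X]H; apply/eqP; ring.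
have [a0|a0] := eqVneq a 0; last first.
  constructor 1; exists a => //.
  rewrite /affine_slice -!scalemxAr -/z bfZl bfZr zz scalerBr scalerDr !scalerA mulfV // scale1r.
  by rewrite {1}xE addrAC -scaleNr; congr (_ + _ *: _); field.
have [b0|b0] := eqVneq b 0; last first.
  constructor 2; exists b => //.
  rewrite /affine_slice -!scalemxAr -/z bfZl bfZr zz scalerBr scalerDr !scalerA mulfV // scale1r.
  by rewrite {1}xE [X in X + _]addrC addrAC -scaleNr; congr (_ + _ *: _); field.
by constructor 3; rewrite {1}xE a0 b0 !scale0r !add0r.
Qed.

End HyperbolicPlane.

(** * Line varieties *)

Section Plucker.
Local Open Scope ring_scope.
Variable K : numClosedFieldType.
Variable m : nat.
Implicit Types (u v w : 'cV[K]_m) (M : 'M[K]_m) (y : 'cV[K]_(nplucker m)).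

Definition wm u v : 'M[K]_m := u *m v^T - v *m u^T.

Lemma wmE u v i j : wm u v i j = u i 0 * v j 0 - v i 0 * u j 0.
Proof. by rewrite !mxE !big_ord1 !mxE. Qed.

(* Pluecker coordinates of a skew-symmetric matrix, and conversely. *)
Definition pv M : 'cV[K]_(nplucker m) :=
  \col_k M (val (enum_val k)).1 (val (enum_val k)).2.

Definition upper y (b c : 'I_m) : K :=
  if insub (b, c) is Some p then y (enum_rank (p : pairs m)) 0 else 0.

Definition unpv y : 'M[K]_m := \matrix_(b, c) (upper y b c - upper y c b).

Lemma wedge_pv u v : wedge u v = pv (wm u v).
Proof. by apply/matrixP => k o; rewrite !mxE !big_ord1 !mxE [X in _ - X]mulrC. Qed.

Lemma wm_tr u v : (wm u v)^T = - wm u v.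
Proof. by apply/matrixP => i j; rewrite mxE [RHS]mxE !wmE; ring. Qed.

Lemma wm_lin a b c d u v : wm (a *: u + b *: v) (c *: u + d *: v) = (a * d - b * c) *: wm u v.
Proof. by apply/matrixP => i j; rewrite [RHS]mxE !wmE !mxE; ring. Qed.

Lemma pvZ c M : pv (c *: M) = c *: pv M.
Proof. by apply/matrixP => k o; rewrite !mxE. Qed.

Lemma unpvZ c y : unpv (c *: y) = c *: unpv y.
Proof.
have uE a b : upper (c *: y) a b = c * upper y a b.
  by rewrite /upper; case: insubP => *; rewrite ?mxE ?mulr0.
by apply/matrixP => a b; rewrite !mxE !uE mulrBr.
Qed.

Lemma pvK M : M^T = - M -> unpv (pv M) = M.
Proof.
move=> sM; have skewE a b : M b a = - M a b.
  by have /matrixP/(_ a b) := sM; rewrite !mxE.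
have uE a b : upper (pv M) a b = if (a < b)%N then M a b else 0.
  rewrite /upper; case: insubP => [p ab pE|/negbTE /= ->//].
  by rewrite mxE enum_rankK pE /= ab.
apply/matrixP => a b; rewrite mxE !uE; case: ltngtP => [ab|ba|/val_inj ->].
- by rewrite subr0.
- by rewrite skewE opprK add0r.
- have : M b b *+ 2 = 0 by rewrite mulr2n {1}skewE addNr.
  by move/eqP; rewrite mulrn_eq0 /= => /eqP->; rewrite subrr.
Qed.

Lemma unpvK y : pv (unpv y) = y.
Proof.
apply/matrixP => k o; rewrite ord1 {o} !mxE.
have ab := valP (enum_val k); set p := enum_val k in ab *.
rewrite /upper -surjective_pairing valK insubF ?subr0; first by rewrite enum_valK.
by apply/negbTE; rewrite /= -leqNgt ltnW.
Qed.

Lemma unpv_tr y : (unpv y)^T = - unpv y.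
Proof. by apply/matrixP => a b; rewrite !mxE opprB. Qed.

Lemma pv_eq0 M : M^T = - M -> (pv M == 0) = (M == 0).
Proof.
move=> sM; apply/eqP/eqP => [M0|->]; last by apply/matrixP => k o; rewrite !mxE.
rewrite -(pvK sM) M0; have -> : 0 = 0 *: 0 :> 'cV[K]_(nplucker m) by rewrite scale0r.
by rewrite unpvZ scale0r.
Qed.

Lemma mem_span2 u v w : reflect (exists a b, w = a *: u + b *: v) (w \in <<[:: u; v]>>%VS).
Proof.
rewrite span_cons span_seq1; apply: (iffP memv_addP).
  by case=> x /vlineP[a ->] [y /vlineP[b ->] ->]; exists a, b.
case=> a [b ->]; exists (a *: u); first by apply/vlineP; exists a.
by exists (b *: v) => //; apply/vlineP; exists b.
Qed.

Lemma wm_free a b u v : wm u v != 0 -> a *: u + b *: v = 0 -> a = 0 /\ b = 0.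
Proof.
have w0 p : wm 0 p = 0 /\ wm p 0 = 0.
  by split; apply/matrixP => i j; rewrite wmE !mxE; ring.
move=> x0 E; split; apply/eqP.
  have := wm_lin a b 0 1 u v; rewrite E (w0 _).1 mulr1 mulr0 subr0 => /esym/eqP.
  by rewrite scaler_eq0 (negbTE x0) orbF.
have := wm_lin 1 0 a b u v; rewrite E (w0 _).2 mul1r mul0r subr0 => /esym/eqP.
by rewrite scaler_eq0 (negbTE x0) orbF.
Qed.

Lemma wm_neq0 u v : free [:: u; v] -> wm u v != 0.
Proof.
rewrite free_cons => /andP[]; rewrite span_seq1 seq1_free => uv v0.
apply: contra uv => /eqP/matrixP uv0.
case/matrix0Pn: v0 => j [o]; rewrite [o]ord1 {o} => vj.
apply/vlineP; exists (u j 0 / v j 0); apply/matrixP => i o; rewrite ord1 {o} mxE.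
by have := uv0 i j; rewrite wmE [RHS]mxE => /eqP; rewrite subr_eq0 mulrAC
  [u j 0 * _]mulrC => /eqP <-; rewrite mulfK.
Qed.

Lemma line_basis (E : grass K 2 m) : exists u v,
  [/\ val E = <<[:: u; v]>>%VS, wm u v != 0 & plucker E = <[pv (wm u v)]>%VS].
Proof.
have dE := eqP (valP E); set b := vbasis (val E).
have bE : b = [:: b`_0; b`_1] :> seq _.
  have : size b = 2%N by rewrite size_tuple dE.
  by move: (val b) => /=; case=> [|? [|? []]].
exists b`_0, b`_1; have bb := vbasisP (val E); split.
- by rewrite -bE; apply/esym/span_basis.
- by apply: wm_neq0; rewrite -bE; apply: basis_free bb.
- by rewrite /plucker wedge_pv.
Qed.

Lemma line_span u v : wm u v != 0 -> exists E : grass K 2 m, val E = <<[:: u; v]>>%VS.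
Proof.
move=> uv; have fr : free [:: u; v].
  rewrite free_cons span_seq1 seq1_free; apply/andP; split.
    apply/vlineP => -[c uE]; have [/eqP] : 1 = 0 :> K /\ - c = 0; last by rewrite oner_eq0.
    by apply: (wm_free uv); rewrite scale1r uE scaleNr subrr.
  apply: contraNneq uv => ->; apply/eqP/matrixP => i j; rewrite wmE !mxE; ring.
have dU : \dim <<[:: u; v]>>%VS == 2%N by have := fr; rewrite /free.
by exists (exist (fun U : {vspace 'cV[K]_m} => is_true (\dim U == 2%N)) _ dU).
Qed.

Lemma plucker_span (E : grass K 2 m) u v : val E = <<[:: u; v]>>%VS ->
  plucker E = <[pv (wm u v)]>%VS /\ wm u v != 0.
Proof.
move=> EE; have [p [q [Epq pq ->]]] := line_basis E.
have /mem_span2[a [b pE]] : p \in <<[:: u; v]>>%VS by rewrite -EE Epq; apply: memv_span; rewrite inE eqxx.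
have /mem_span2[c [d qE]] : q \in <<[:: u; v]>>%VS.
  by rewrite -EE Epq; apply: memv_span; rewrite !inE eqxx orbT.
move: pq; rewrite pE qE wm_lin pvZ => pq.
have c0 : a * d - b * c != 0 by apply: contraNneq pq => ->; rewrite scale0r.
by rewrite vlineZ //; split=> //; apply: contraNneq pq => ->; rewrite scaler0.
Qed.

Lemma wm_meet u v l l' : wm u v != 0 -> wm l l' != 0 ->
  reflect (exists z, [/\ z != 0, exists a b, z = a *: u + b *: v & exists a b, z = a *: l + b *: l'])
    ((<<[:: u; v]>> :&: <<[:: l; l']>>)%VS != 0%VS).
Proof.
move=> uv ll; apply: (iffP idP) => [nz|[z [z0 /mem_span2 zu /mem_span2 zl]]].
  exists (vpick (<<[:: u; v]>> :&: <<[:: l; l']>>)%VS); rewrite vpick0; split=> //.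
  - by apply/mem_span2; have := memv_pick (<<[:: u; v]>> :&: <<[:: l; l']>>)%VS; rewrite memv_cap => /andP[].
  - by apply/mem_span2; have := memv_pick (<<[:: u; v]>> :&: <<[:: l; l']>>)%VS; rewrite memv_cap => /andP[].
apply: contraNneq z0 => E0; rewrite -memv0 -E0 memv_cap zu zl //.
Qed.

(* z lies on the line with Pluecker matrix Y. *)
Definition incident (Y : 'M[K]_m) (z : 'cV[K]_m) := forall a b c,
  z a 0 * Y b c - z b 0 * Y a c + z c 0 * Y a b = 0.

Lemma incident_wm u v a b : incident (wm u v) (a *: u + b *: v).
Proof. by move=> i j k; rewrite !wmE !mxE; ring. Qed.

Lemma incidentZ c (Y : 'M[K]_m) (z : 'cV[K]_m) : incident Y z -> incident (c *: Y) z.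
Proof.
move=> H i j k; rewrite !mxE.
by transitivity (c * (z i 0 * Y j k - z j 0 * Y i k + z k 0 * Y i j)); [ring|rewrite H mulr0].
Qed.

(** Each difference [Y_cd (u ^ v)_ab - Y_ab (u ^ v)_cd] is a combination of four incidence
    relations, so all coordinates stand in the same ratio. *)
Lemma incident_proportional (Y : 'M[K]_m) u v : Y != 0 -> incident Y u -> incident Y v ->
  exists c, wm u v = c *: Y.
Proof.
move=> Y0 Yu Yv.
have E a b c d : Y c d * wm u v a b = Y a b * wm u v c d.
  rewrite !wmE; have h1 := Yu a c d; have h2 := Yu b c d.
  have h3 := Yv a b d; have h4 := Yv a b c; apply/eqP; rewrite -subr_eq0.
  rewrite (_ : _ - _ = (u a 0 * Y c d - u c 0 * Y a d + u d 0 * Y a c) * v b 0 -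
     (u b 0 * Y c d - u c 0 * Y b d + u d 0 * Y b c) * v a 0 -
     u c 0 * (v a 0 * Y b d - v b 0 * Y a d + v d 0 * Y a b) +
     u d 0 * (v a 0 * Y b c - v b 0 * Y a c + v c 0 * Y a b)); last by ring.
  by rewrite h1 h2 h3 h4 !mul0r !mulr0 !subr0 addr0.
case/matrix0Pn: Y0 => i [j Yij]; exists (wm u v i j / Y i j).
by apply/matrixP => a b; rewrite [RHS]mxE mulrAC [wm u v i j * _]mulrC E mulrC mulKf.
Qed.

End Plucker.

(** * Line varieties as images of sections of the Klein quadric *)

Section LineVarieties.
Local Open Scope classical_set_scope.
Local Open Scope card_scope.
Local Open Scope ring_scope.
Variable K : numClosedFieldType.
Local Notation J := (klein K).

Lemma card_set2 (T : Type) (x y : T) : x <> y -> [set x; y] #= `I_2.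
Proof.
move=> xy; pose f (k : nat) := if k == 0%N then x else y.
have -> : [set x; y] = [set f k | k in `I_2].
  apply/seteqP; split=> [z [->|->]|z [[|[|//]] _ <-]]; rewrite /f /=.
  - by exists 0%N.
  - by exists 1%N.
  - by left.
  - by right.
apply: inj_card_eq => i j; rewrite !in_setE /= /f.
by case: i j => [|[|//]] [|[|//]] // _ _ /= E; case: xy.
Qed.

Lemma cV_delta s (x : 'cV[K]_s) : x = \sum_l x l 0 *: delta_mx l 0.
Proof. by rewrite {1}[x]matrix_sum_delta; apply: eq_bigr => l _; rewrite big_ord1. Qed.

Lemma skew4_sum (x : 'cV[K]_6) : skew4 x = \sum_l x l 0 *: skew4 (delta_mx l 0).
Proof.
rewrite {1}[x]cV_delta.
elim/big_rec2: _ => [|l a b _ <-]; first exact: skew40.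
by rewrite skew4D skew4Z.
Qed.

Section Camera.
Variables (m : nat) (C : 'M[K]_(m, 4)).

Definition lam_row i j : 'rV[K]_6 := \row_l
  (C i (pair6 l).1 * C j (pair6 l).2 - C i (pair6 l).2 * C j (pair6 l).1).

(* The second exterior power of C. *)
Definition lam : 'M[K]_(nplucker m, 6) :=
  \matrix_(k, l) lam_row (val (enum_val k)).1 (val (enum_val k)).2 0 l.

Lemma lam_rowE i j x : (lam_row i j *m x) 0 0 = (C *m skew4 x *m C^T) i j.
Proof.
rewrite !mxE sum_ord4 !mxE !sum_ord4 sum_ord6 !mxE /=.
by ring.
Qed.

Lemma lamE x : lam *m x = pv (C *m skew4 x *m C^T).
Proof.
apply/matrixP => k o; rewrite ord1 {o} [RHS]mxE -lam_rowE !mxE.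
by apply: eq_bigr => l _; rewrite !mxE.
Qed.

Lemma camera_skew_tr x : (C *m skew4 x *m C^T)^T = - (C *m skew4 x *m C^T).
Proof. by rewrite !trmx_mul trmxK skew4_tr mulNmx mulmxN mulmxA. Qed.

Lemma lam_eq0 x : (lam *m x == 0) = (C *m skew4 x *m C^T == 0).
Proof. by rewrite lamE pv_eq0 // camera_skew_tr. Qed.

Lemma camera_wedge u v : C *m skew4 (wedge4 u v) *m C^T = wm (C *m u) (C *m v).
Proof. by rewrite skew4_wedge mulmxBr mulmxBl /wm !trmx_mul !mulmxA. Qed.

End Camera.

Lemma wedge4_eq0 u v : (wedge4 u v == 0 :> 'cV[K]_6) = (wm u v == 0).
Proof.
rewrite /wm -skew4_wedge; apply/eqP/eqP => [->|]; first exact: skew40.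
exact: skew4_eq0.
Qed.

Lemma camera_img_span N h (C : 'M[K]_(h.+1, N.+1)) u v :
  camera_img C <<[:: u; v]>> = <<[:: C *m u; C *m v]>>%VS.
Proof. by rewrite /camera_img limg_span /= !lfunE. Qed.

Variables (n h g : nat) (C : arrangement K n 3 h) (L : 'I_g -> grass K 2 4).
Variables l l' : 'I_g -> 'cV[K]_4.
Hypothesis n_gt0 : (0 < n)%N.
Hypothesis LE : forall j, val (L j) = <<[:: l j; l' j]>>%VS.

Definition anchor_forms : 'M[K]_(g, 6) := \matrix_(j, k) (J *m wedge4 (l j) (l' j)) k 0.

Lemma anchor_formsE x j : (anchor_forms *m x) j 0 = bf x (wedge4 (l j) (l' j)).
Proof.
rewrite bfC /bf (_ : _^T *m J = (J *m wedge4 (l j) (l' j))^T); last by rewrite trmx_mul klein_tr.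
rewrite [LHS]mxE [RHS]mxE.
by apply: eq_bigr => k _; rewrite mxE [in RHS]mxE.
Qed.

Lemma anchored_forms (E : grass K 2 4) u v : val E = <<[:: u; v]>>%VS ->
  anchored_lines L E <-> anchor_forms *m wedge4 u v = 0.
Proof.
move=> EE; have [_ uv] := plucker_span EE.
have uv4 : wedge4 u v != 0 by rewrite wedge4_eq0.
have ll j : wm (l j) (l' j) != 0 by have [] := plucker_span (LE j).
have H j : (val E :&: val (L j))%VS != 0%VS <-> (anchor_forms *m wedge4 u v) j 0 = 0.
  rewrite anchor_formsE EE LE; split=> [/wm_meet -/(_ uv (ll j))[z [z0 [a [b zE]] [c [d zE']]]]|b0].
    by apply: (@wedge_meet_bf _ _ _ _ _ a b c d); rewrite -zE.
  by apply/wm_meet => //; apply: wedge_meet; rewrite ?wedge4_eq0.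
split=> [An|O0 j]; last by apply/H; rewrite O0 mxE.
by apply/matrixP => j o; rewrite ord1 [RHS]mxE; apply/H/An.
Qed.

(** The image in linear terms: isotropic vectors killed by the anchor forms, mapped by the second
    exterior powers. That no image degenerates is implicit in [y i] being a point. *)
Lemma line_source (y : mpspace K n (nplucker h.+1)) :
  (exists2 E : grass K 2 4, anchored_lines L E &
    forall i, exists2 F : grass K 2 h.+1,
      val F = camera_img (C i) (val E) & val (y i) = plucker F) <->
  exists x, [/\ bf x x = 0, anchor_forms *m x = 0 &
    forall i, val (y i) = <[lam (C i) *m x]>%VS].
Proof.
split=> [[E An H]|[x [xx Ox yx]]].
  have [u [v [EE uv _]]] := line_basis E; exists (wedge4 u v); split.
  - exact: wedge_isotropic.
  - exact/(anchored_forms EE).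
  - move=> i; have [F FE ->] := H i; rewrite EE camera_img_span in FE.
    by rewrite lamE camera_wedge; have [] := plucker_span FE.
have [u [v xE]] := wedge_decomp xx.
have lam0 i : lam (C i) *m x != 0.
  by apply: contraNneq (rep_neq0 y i) => x0; rewrite /rep yx x0 vpick0.
have uv : wm u v != 0.
  rewrite -wedge4_eq0 -xE; apply: contraNneq (lam0 (Ordinal n_gt0)) => ->.
  by rewrite mulmx0.
have [E EE] := line_span uv; exists E.
  by apply/(anchored_forms EE); rewrite -xE.
move=> i; have Cuv : wm (C i *m u) (C i *m v) != 0.
  by have := lam0 i; rewrite lam_eq0 xE camera_wedge.
have [F FE] := line_span Cuv; exists F; first by rewrite EE camera_img_span.
by rewrite yx (plucker_span FE).1 lamE xE camera_wedge.
Qed.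

Lemma line_variety_source x y : bf x x = 0 -> anchor_forms *m x = 0 ->
  (forall i, val (y i) = <[lam (C i) *m x]>%VS) -> line_variety C L y.
Proof.
by move=> xx Ox yx; apply: subset_zclosure; apply/line_source; exists x.
Qed.

(** Incidence of the columns of [C i *m skew4 x] with [y i] is linear in [x] and multihomogeneous in
    [y], so it passes to the closure. It retains information even when [lam (C i) *m x = 0]: the
    image points still lie on [y i]. *)
Lemma line_variety_incidence (y : mpspace K n (nplucker h.+1)) : line_variety C L y ->
  exists u v, [/\ wedge4 u v != 0, anchor_forms *m wedge4 u v = 0 &
    forall i, incident (unpv (rep y i)) (C i *m u) /\ incident (unpv (rep y i)) (C i *m v)].
Proof.
pose m := h.+1; pose M := mform K n (nplucker m).
pose up i (b c : 'I_m) : M :=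
  if insub (b, c) is Some p then 'X_(enum_rank (i, enum_rank (p : pairs m))) else 0.
pose Y i b c : M := up i b c - up i c b.
pose D i a k s := (C i *m skew4 (delta_mx s 0 : 'cV[K]_6)) a k.
pose T : finType := ('I_g + 'I_n * 'I_4 * ('I_m * 'I_m * 'I_m))%type.
(* Left summand: the anchor conditions, of degree zero in [y]. Right summand: incidence of column
   [k] of [C i *m skew4 x] with [y i]. *)
pose rho (t : T) (s : 'I_6) : M := match t with
  | inl j => (anchor_forms j s)%:MP
  | inr (i, k, (a, b, c)) =>
      D i a k s *: Y i b c + (- D i b k s) *: Y i a c + D i c k s *: Y i a b
  end.
pose E (t : T) (i : 'I_n) : nat := match t with
  | inl _ => 0 | inr (i', _, _) => (i == i') end.
have hup i b c : mhom (fun i' => (i' == i) : nat) (up i b c).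
  by rewrite /up; case: insubP => [p _ _|_]; [exact: mhomX|exact: mhom0].
have hY i b c : mhom (fun i' => (i' == i) : nat) (Y i b c).
  by apply: mhomD => //; rewrite -scaleN1r; apply: mhomZ.
have hrho t s : mhom (E t) (rho t s).
  case: t => [j|[[i k] [[a b] c]]] /=.
    by rewrite -[_%:MP]mulr1 mul_mpolyC; apply: mhomZ; apply: mhom1.
  by do 2?apply: mhomD; apply: mhomZ; apply: hY.
have evY v i b c : evm (Y i b c) v = unpv (v i) b c.
  rewrite /evm mevalB -!/(evm _ _) mxE; congr (_ - _); rewrite /up /upper;
    by case: insubP => [p _ _|_]; rewrite ?evm_var // /evm meval0.
have DE i a k (x : 'cV[K]_6) : \sum_s D i a k s * x s 0 = (C i *m skew4 x) a k.
  rewrite [in RHS]skew4_sum mulmx_sumr summxE; apply: eq_bigr => s _.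
  by rewrite -scalemxAr [RHS]mxE mulrC.
have rhoL z (x : 'cV[K]_6) j : \sum_s evm (rho (inl j) s) z * x s 0 = (anchor_forms *m x) j 0.
  by rewrite mxE; apply: eq_bigr => s _; rewrite /evm /= mevalC.
have rhoR z (x : 'cV[K]_6) i k a b c :
    \sum_s evm (rho (inr (i, k, (a, b, c))) s) z * x s 0 =
    (C i *m skew4 x) a k * unpv (z i) b c - (C i *m skew4 x) b k * unpv (z i) a c +
    (C i *m skew4 x) c k * unpv (z i) a b.
  rewrite -!DE !big_distrl -sumrB -big_split /=; apply: eq_bigr => s _.
  by rewrite /evm !mevalD !mevalZ -!/(evm _ _) !evY; ring.
have col_incident z i (x : 'cV[K]_6) :
    (forall k a b c, (C i *m skew4 x) a k * unpv (z i) b c -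
      (C i *m skew4 x) b k * unpv (z i) a c + (C i *m skew4 x) c k * unpv (z i) a b = 0) <->
    (forall w, incident (unpv (z i)) (C i *m (skew4 x *m w))).
  split=> H; last first.
    move=> k a b c; have cE a' :
      (C i *m (skew4 x *m (delta_mx k 0 : 'cV[K]_4))) a' 0 = (C i *m skew4 x) a' k.
      by rewrite mulmxA -colE mxE.
    by have := H (delta_mx k 0) a b c; rewrite !cE.
  move=> w a b c; rewrite mulmxA ![(_ *m w) _ _]mxE !big_distrl -sumrB -big_split big1 //= => k _.
  transitivity (w k 0 * ((C i *m skew4 x) a k * unpv (z i) b c -
      (C i *m skew4 x) b k * unpv (z i) a c + (C i *m skew4 x) c k * unpv (z i) a b)); first by ring.
  by rewrite H mulr0.
move=> /(incidence_zclosure (J := J) hrho)[].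
  move=> z /line_source[x [xx Ox zx]]; have [u [v xE]] := wedge_decomp xx.
  exists x; split=> //.
    apply: contraNneq (rep_neq0 z (Ordinal n_gt0)) => x0.
    by rewrite /rep zx x0 mulmx0 vpick0.
  move=> [j|[[i k] [[a b] c]]]; first by rewrite rhoL Ox mxE.
  rewrite rhoR; move: k a b c; apply/col_incident => w.
  have [s s0 ->] := vline_scale (etrans (esym (rep_line z i)) (zx i)) (rep_neq0 z i).
  rewrite unpvZ; apply: incidentZ.
  rewrite lamE pvK ?camera_skew_tr // xE camera_wedge skew4_wedge mulmxBl mulmxBr -!mulmxA.
  rewrite [v^T *m w]mx11_scalar [u^T *m w]mx11_scalar !mul_mx_scalar -!scalemxAr -scaleNr.
  exact: incident_wm.
move=> x [x0 Hx xx]; have [u [v xE]] := wedge_decomp xx.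
exists u, v; split; first by rewrite -xE.
  by apply/matrixP => j o; rewrite ord1 -xE -(rhoL (rep y)) Hx !mxE.
move=> i; have Hcol w : incident (unpv (rep y i)) (C i *m (skew4 x *m w)).
  by move: w; apply/(col_incident (rep y)) => k a b c; rewrite -rhoR; apply: Hx.
(* The decomposition of the identity recovers [u] and [v] as combinations of the columns of
   [skew4 x], whose images are known to be incident. *)
have [y' xy] := bf_nondegenerate x0.
have := skew4_star_polar x y'; rewrite xy opprK scale1r.
move/(congr1 trmx); rewrite trmx1 trmxD !trmx_mul !skew4_tr !mulNmx !mulmxN !opprK => I1.
have fixed (w : 'cV[K]_4) : skew4 (J *m x) *m w = 0 -> skew4 x *m (skew4 (J *m y') *m w) = w.
  move=> xw; have := congr1 (mulmx^~ w) I1.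
  by rewrite mulmxDl -!mulmxA xw mulmx0 add0r mul1mx.
split.
  by rewrite -(fixed u) // xE star_wedgel.
by rewrite -(fixed v) // xE star_wedger.
Qed.

Lemma incident_lam (y : mpspace K n (nplucker h.+1)) i u v :
  incident (unpv (rep y i)) (C i *m u) -> incident (unpv (rep y i)) (C i *m v) ->
  exists c, lam (C i) *m wedge4 u v = c *: rep y i.
Proof.
move=> Iu Iv; have Y0 : unpv (rep y i) != 0.
  by rewrite -pv_eq0 ?unpv_tr // unpvK rep_neq0.
have [c cE] := incident_proportional Y0 Iu Iv; exists c.
by rewrite lamE camera_wedge cE pvZ unpvK.
Qed.

Section Data.
Variables (k : nat) (d : 'I_n -> nat).
Variables (b : {i : 'I_n & ('I_(d i) * 'I_(nplucker h.+1))%type} -> K).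
Variable e : 'I_k -> {i : 'I_n & 'I_(d i)}.
Hypothesis kg : (k + g = 4)%N.

Definition camera_forms : 'M[K]_(k, 6) :=
  \matrix_(j, s) (secrow b (e j) *m lam (C (tag (e j)))) 0 s.

Definition line_forms : 'M[K]_(k + g, 6) := col_mx camera_forms anchor_forms.

Hypothesis G_unit : gram line_forms \in unitmx.

Lemma camera_formsE (x : 'cV[K]_6) j :
  (camera_forms *m x) j 0 = (secrow b (e j) *m (lam (C (tag (e j))) *m x)) 0 0.
Proof. by rewrite mulmxA mxE [RHS]mxE; apply: eq_bigr => s _; rewrite mxE. Qed.

Lemma line_forms_mul (x : 'cV[K]_6) : line_forms *m x = col_mx (camera_forms *m x) (anchor_forms *m x).
Proof. exact: mul_col_mx. Qed.

Lemma line_forms_eq0 (x : 'cV[K]_6) : line_forms *m x = 0 -> camera_forms *m x = 0 /\ anchor_forms *m x = 0.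
Proof. by rewrite line_forms_mul -col_mx0 => /eq_col_mx. Qed.

(** The parameters are the values of the [k] camera forms, with the anchor values fixed at zero. The
    slices of the quadric give the charts for the upper bound; the slice through [x1], whose images
    are all nonzero, carries the linear chain. *)
Theorem dim_line_variety x1 : line_forms *m x1 = 0 -> bf x1 x1 = 0 ->
  (forall i, lam (C i) *m x1 != 0) -> dim_is (line_variety C L) k.
Proof.
move=> Ox1 q1 lx1.
have x10 : x1 != 0 by apply: contraNneq (lx1 (Ordinal n_gt0)) => ->; rewrite mulmx0.
have [x2 [Ox2 q2 b12]] := hyperbolic_partner G_unit x10 Ox1 q1.
pose T (t : 'I_k -> K) : 'cV[K]_(k + g) := col_mx (\col_j t j) 0.
have pT i j : polyfun (fun t => T t i j).
  rewrite [j]ord1; have [i' ->|i' ->] := split_ordP i.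
    apply: polyfun_ext (polyfun_coord K i') => t.
    by rewrite /T col_mxEu mxE.
  by apply: polyfun_ext (@polyfun_const K _ 0) => t; rewrite /T col_mxEd mxE.
have pconst r s (M : 'M[K]_(r, s)) i j : polyfun (fun _ : 'I_k -> K => M i j).
  exact: polyfun_const.
pose Z t := dual_forms line_forms *m T t.
have pZ i j : polyfun (fun t => Z t i j) by exact: (polyfun_mulmx (pconst _ _ _) pT i j).
have pq : polyfun (fun t => bf (Z t) (Z t)).
  have pZT i j : polyfun (fun t => (Z t)^T i j).
    by apply: polyfun_ext (pZ j i) => t; rewrite [RHS]mxE.
  exact: (polyfun_mulmx (polyfun_mulmx pZT (pconst _ _ J)) pZ).
(* The last chart is in general not isotropic; it only serves to cover the vectors without component
   in the hyperbolic plane. *)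
pose xi (s : 'I_3) t : 'cV[K]_6 := match (s : nat) with
  | 0 => affine_slice line_forms x1 x2 (T t)
  | 1 => affine_slice line_forms x2 x1 (T t)
  | _ => Z t end.
have pslice a c i j : polyfun (fun t => affine_slice line_forms a c (T t) i j).
  apply: (@polyfun_ext _ _ (fun t => a i j + Z t i j - bf (Z t) (Z t) / 2 * c i j)).
    by move=> t; rewrite !mxE.
  apply: polyfunB; first by apply: polyfunD => //; exact: polyfun_const.
  apply: polyfunM; last exact: polyfun_const.
  by apply: polyfunM; [exact: pq|exact: polyfun_const].
have pxi s i j : polyfun (fun t => xi s t i j).
  by case: s => [[|[|[|//]]] ?]; rewrite /xi /=.
have pphi s i j : polyfun (fun t => (lam (C i) *m xi s t) j 0).
  exact: (polyfun_mulmx (pconst _ _ (lam (C i))) (pxi s)).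
split; last first.
  move=> r; apply: (chain_length_le (phi := fun s t i => lam (C i) *m xi s t)) => //.
  move=> y /line_source[x [xx Ox yx]].
  have OxE : line_forms *m x = T (fun j => (camera_forms *m x) j 0).
    rewrite line_forms_mul Ox; congr col_mx.
    by apply/matrixP => i j; rewrite ord1 [RHS]mxE.
  have TZ c t : c *: T t = T (fun j => c * t j).
    rewrite /T scale_col_mx scaler0; congr col_mx.
    by apply/matrixP => i j; rewrite !mxE.
  have [[c c0 xE]|[c c0 xE]|xE] := isotropic_slices kg G_unit Ox1 Ox2 q1 q2 b12 xx;
    rewrite OxE ?TZ in xE.
  - exists (@Ordinal 3 0 isT), (fun j => c^-1 * (camera_forms *m x) j 0) => i.
    by rewrite yx {1}xE -scalemxAr vlineZ.
  - exists (@Ordinal 3 1 isT), (fun j => c^-1 * (camera_forms *m x) j 0) => i.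
    by rewrite yx {1}xE -scalemxAr vlineZ.
  - exists (@Ordinal 3 2 isT), (fun j => (camera_forms *m x) j 0) => i.
    by rewrite yx {1}xE.
have slice_forms t : line_forms *m xi (@Ordinal 3 0 isT) t = T t.
  exact: affine_slice_forms.
have slice_iso t : bf (xi (@Ordinal 3 0 isT) t) (xi (@Ordinal 3 0 isT) t) = 0.
  exact: affine_slice_isotropic.
apply: (linear_chain (phi := fun t i => lam (C i) *m xi (@Ordinal 3 0 isT) t)
  (i_ := fun j => tag (e j)) (b := fun j => secrow b (e j))) => //.
- exact: zclosed_zclosure.
- move=> i; suff -> : xi (@Ordinal 3 0 isT) (fun=> 0) = x1 by [].
  have T0 : T (fun=> 0) = 0.
    rewrite /T (_ : \col_j 0 = 0) ?col_mx0 //; apply/matrixP => u v; rewrite !mxE //.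
  by rewrite /xi /affine_slice /= T0 mulmx0 addr0 /bf mulmx0 mxE mul0r scale0r subr0.
- move=> t y yt; apply: (@line_variety_source (xi (@Ordinal 3 0 isT) t)) => //.
  have := slice_forms t; rewrite line_forms_mul => /eq_col_mx[] //.
- move=> t j; rewrite -camera_formsE.
  have := slice_forms t; rewrite line_forms_mul => /eq_col_mx[-> _].
  by rewrite mxE.
Qed.

Hypothesis e_bij : bijective e.

Lemma camera_forms_eq0 (x : 'cV[K]_6) :
  camera_forms *m x = 0 <-> forall i, secmx b i *m (lam (C i) *m x) = 0.
Proof.
split=> [H i|H].
  apply/secmx_mul0 => r; have [e' ek eK] := e_bij.
  have /matrixP/(_ (e' (Tagged (fun i => 'I_(d i)) r)) 0) := H.
  rewrite camera_formsE eK /= => H0; apply/matrixP => u v; rewrite !ord1 H0.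
  by rewrite !mxE.
apply/matrixP => j v; rewrite ord1 camera_formsE; have := H (tag (e j)).
by move=> /secmx_mul0/(_ (tagged (e j))); rewrite taggedK => ->; rewrite !mxE.
Qed.

Lemma section_point (x : 'cV[K]_6) (y : mpspace K n (nplucker h.+1)) :
  line_forms *m x = 0 -> bf x x = 0 ->
  (forall i, val (y i) = <[lam (C i) *m x]>%VS) ->
  line_variety C L y /\ forall i, secmx b i *m rep y i = 0.
Proof.
move=> /line_forms_eq0[Cx Ax] xx yx; split; first exact: line_variety_source yx.
move=> i; apply: (@mul_line_eq0 _ _ _ _ (lam (C i) *m x)); first by rewrite -rep_line yx.
by move: i; apply/camera_forms_eq0.
Qed.

Lemma section_incidence (y : mpspace K n (nplucker h.+1)) : line_variety C L y ->
  (forall i, secmx b i *m rep y i = 0) ->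
  exists u v, [/\ wedge4 u v != 0, line_forms *m wedge4 u v = 0,
    forall i, exists c, lam (C i) *m wedge4 u v = c *: rep y i &
    forall i, incident (unpv (rep y i)) (C i *m u) /\ incident (unpv (rep y i)) (C i *m v)].
Proof.
move=> /line_variety_incidence[u [v [x0 Ax inc]]] sec; exists u, v.
have prop i : exists c, lam (C i) *m wedge4 u v = c *: rep y i.
  by have [] := inc i; apply: incident_lam.
split=> //; rewrite line_forms_mul Ax.
suff -> : camera_forms *m wedge4 u v = 0 by rewrite col_mx0.
apply/camera_forms_eq0 => i; have [c ->] := prop i.
by rewrite -scalemxAr sec scaler0.
Qed.

Lemma section_pointE (x : 'cV[K]_6) (y : mpspace K n (nplucker h.+1)) :
  (forall i, lam (C i) *m x != 0) ->
  (forall i, exists c, lam (C i) *m x = c *: rep y i) ->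
  forall i, val (y i) = <[lam (C i) *m x]>%VS.
Proof.
move=> lx prop i; have [c cE] := prop i; rewrite cE vlineZ ?rep_line //.
by apply: contraNneq (lx i) => c0; rewrite cE c0 scale0r.
Qed.

(** The two isotropic solutions have different images already in one camera: otherwise some
    [x1 - c x2] with [c] nonzero would be killed by [lam], hence isotropic, while its square is
    [-2c]. *)
Theorem two_point_section : (forall i, 3 <= \rank (C i))%N ->
  (forall x, x != 0 -> line_forms *m x = 0 -> bf x x = 0 -> forall i, lam (C i) *m x != 0) ->
  line_variety C L `&` [set y | forall i, secmx b i *m rep y i = 0] #= `I_2.
Proof.
move=> rC nz; have [x1 [x10 Ox1 q1]] := isotropic_solution line_forms kg.
have [x2 [Ox2 q2 b12]] := hyperbolic_partner G_unit x10 Ox1 q1.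
have x20 : x2 != 0.
  apply/eqP => x20; move: b12; rewrite x20 /bf mulmx0 mxE => /esym/eqP.
  by rewrite oner_eq0.
have [y1 y1E] := ex_mpoint (nz _ x10 Ox1 q1).
have [y2 y2E] := ex_mpoint (nz _ x20 Ox2 q2).
have y12 : y1 <> y2.
  move=> y12; pose i := Ordinal n_gt0.
  have [|c c0 cE] := @vline_scale K _ (lam (C i) *m x1) (lam (C i) *m x2) _ (nz _ x10 Ox1 q1 i).
    by rewrite -y1E -y2E y12.
  have : lam (C i) *m (x1 + (- c) *: x2) == 0.
    by rewrite mulmxDr -scalemxAr cE scaleNr subrr.
  rewrite lam_eq0 => /eqP /(skew4_image_isotropic (rC i)).
  rewrite bfDl !bfDr !bfZl !bfZr q1 q2 (bfC x2) b12 !mulr1 !mulr0 addr0 add0r -mulr2n.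
  by move/eqP; rewrite mulrn_eq0 oppr_eq0 (negbTE c0).
suff -> : line_variety C L `&` [set y | forall i, secmx b i *m rep y i = 0] = [set y1; y2].
  exact: card_set2.
apply/seteqP; split=> [y [Xy sy]|y [->|->]] /=; last 2 first.
- exact: (section_point Ox1 q1 y1E).
- exact: (section_point Ox2 q2 y2E).
have [u [v [x0 Ox prop _]]] := section_incidence Xy sy.
have xx := wedge_isotropic u v.
have yE := section_pointE (nz _ x0 Ox xx) prop.
have [c c0 [xE|xE]] := two_isotropic kg G_unit Ox1 Ox2 q1 q2 b12 Ox xx x0; [left|right];
  by apply: mpoint_eq => i; rewrite yE xE -scalemxAr vlineZ // ?y1E ?y2E.
Qed.

End Data.
End LineVarieties.

(** * Lines in a back-projected plane *)

Section PlaneLines.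
Local Open Scope ring_scope.
Variable K : numClosedFieldType.
Local Notation J := (klein K).

Lemma ord3P (P : 'I_3 -> Prop) : P 't0 -> P 't1 -> P 't2 -> forall i, P i.
Proof.
move=> P0 P1 P2 [[|[|[|//]]] Hi]; [move: P0|move: P1|move: P2]; congr P; exact: val_inj.
Qed.

Lemma sum_plucker m (F : 'I_m -> 'I_m -> K) :
  \sum_(k < nplucker m) F (val (enum_val k)).1 (val (enum_val k)).2 =
  \sum_(i < m) \sum_(j < m) (if (i < j)%N then F i j else 0).
Proof.
rewrite (reindex (@enum_rank (pairs m))) /=; last exact: onW_bij (enum_rank_bij _).
under eq_bigr do rewrite enum_rankK.
rewrite pair_big /= -big_mkcond /= (reindex_omap (val : pairs m -> _) insub) /=; last first.
  by move=> [i j] ij; rewrite insubT.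
by apply: eq_bigl => p; rewrite valK eqxx (valP p).
Qed.

Definition pcoord (b : 'rV[K]_(nplucker 3)) i j : K := unpv b^T i j.

Lemma mul_coord b (y : 'cV[K]_(nplucker 3)) : (b *m y) 0 0 =
  pcoord b 't0 't1 * unpv y 't0 't1 + pcoord b 't0 't2 * unpv y 't0 't2 +
  pcoord b 't1 't2 * unpv y 't1 't2.
Proof.
transitivity (\sum_(k < nplucker 3) pcoord b (val (enum_val k)).1 (val (enum_val k)).2 *
   unpv y (val (enum_val k)).1 (val (enum_val k)).2).
  rewrite mxE; apply: eq_bigr => k _.
  have /matrixP/(_ k 0) := unpvK y; rewrite mxE => ->.
  by have /matrixP/(_ k 0) := unpvK b^T; rewrite mxE /pcoord [RHS]mxE => ->.
rewrite (sum_plucker (fun i j => pcoord b i j * unpv y i j)).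
by rewrite !sum_ord3 /= ; ring.
Qed.

Lemma coord_pv b (M : 'M[K]_3) : M^T = - M -> (b *m pv M) 0 0 =
  pcoord b 't0 't1 * M 't0 't1 + pcoord b 't0 't2 * M 't0 't2 + pcoord b 't1 't2 * M 't1 't2.
Proof. by move=> sM; rewrite mul_coord pvK. Qed.

(* The coefficients of the line of the plane through the two points that b and
   b' represent as linear forms on the dual plane. *)
Definition join_coef b b' : 'rV[K]_3 := \row_c match (c : nat) with
  | 0 => pcoord b 't0 't1 * pcoord b' 't0 't2 - pcoord b 't0 't2 * pcoord b' 't0 't1
  | 1 => pcoord b 't0 't1 * pcoord b' 't1 't2 - pcoord b 't1 't2 * pcoord b' 't0 't1
  | _ => pcoord b 't0 't2 * pcoord b' 't1 't2 - pcoord b 't1 't2 * pcoord b' 't0 't2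
  end.

Lemma join_coef_incident b b' (y : 'cV[K]_(nplucker 3)) z : y != 0 ->
  b *m y = 0 -> b' *m y = 0 -> incident (unpv y) z -> (join_coef b b' *m z) 0 0 = 0.
Proof.
move=> y0 /matrixP/(_ 0 0) by0 /matrixP/(_ 0 0) b'y inc.
rewrite mul_coord [RHS]mxE in by0; rewrite mul_coord [RHS]mxE in b'y.
have h := inc 't0 't1 't2.
rewrite !mxE sum_ord3 !mxE /=.
have [p pE] : exists p, unpv y 't0 't1 = p by eexists.
have [q qE] : exists q, unpv y 't0 't2 = q by eexists.
have [r rE] : exists r, unpv y 't1 't2 = r by eexists.
rewrite pE qE rE in by0 b'y h.
have pqr : [|| p != 0, q != 0 | r != 0].
  apply: contraNT y0; rewrite !negb_or !negbK => /and3P[/eqP p0 /eqP q0 /eqP r0].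
  rewrite -[y]unpvK pv_eq0 ?unpv_tr //; apply/eqP/matrixP.
  have sk i j : unpv y j i = - unpv y i j.
    by have /matrixP/(_ i j) := unpv_tr y; rewrite mxE [RHS]mxE.
  have dg i : unpv y i i = 0 by rewrite mxE subrr.
  rewrite p0 in pE; rewrite q0 in qE; rewrite r0 in rE.
  move=> i j; rewrite [RHS]mxE; move: i j; do 2!apply: ord3P;
    by rewrite ?dg ?pE ?qE ?rE // sk ?pE ?qE ?rE oppr0.
move: h by0 b'y; move: (z 't0 0) (z 't1 0) (z 't2 0) => x0 x1 x2 h.
move: (pcoord b 't0 't1) (pcoord b 't0 't2) (pcoord b 't1 't2) => A B C S.
move: (pcoord b' 't0 't1) (pcoord b' 't0 't2) (pcoord b' 't1 't2) => A' B' C' S'.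
(* Each identity multiplies the claim by a nonzero coordinate of [y] and writes the product as a
   combination of the incidence relation and the two section equations. *)
case/or3P: pqr => [p0|q0|r0].
- apply: (mulfI p0); rewrite mulr0.
  transitivity ((B * C' - C * B') * (x0 * r - x1 * q + x2 * p) +
    x0 * (B' * (A * p + B * q + C * r) - B * (A' * p + B' * q + C' * r)) -
    x1 * (C * (A' * p + B' * q + C' * r) - C' * (A * p + B * q + C * r))); first by ring.
  by rewrite h S S'; ring.
- apply: (mulfI q0); rewrite mulr0.
  transitivity ((C * A' - A * C') * (x0 * r - x1 * q + x2 * p) -
    x0 * (A' * (A * p + B * q + C * r) - A * (A' * p + B' * q + C' * r)) +
    x2 * (C' * (A * p + B * q + C * r) - C * (A' * p + B' * q + C' * r))); first by ring.
  by rewrite h S S'; ring.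
- apply: (mulfI r0); rewrite mulr0.
  transitivity ((A * B' - B * A') * (x0 * r - x1 * q + x2 * p) -
    x1 * (A' * (A * p + B * q + C * r) - A * (A' * p + B' * q + C' * r)) -
    x2 * (B' * (A * p + B * q + C * r) - B * (A' * p + B' * q + C' * r))); first by ring.
  by rewrite h S S'; ring.
Qed.

(* Cramer's rule: three vectors annihilated by a nonzero covector have zero
   determinant; the third one is the point that b represents. *)
Lemma join_coef_pv b b' z z' : join_coef b b' != 0 ->
  (join_coef b b' *m z) 0 0 = 0 -> (join_coef b b' *m z') 0 0 = 0 ->
  b *m pv (wm z z') = 0 /\ b' *m pv (wm z z') = 0.
Proof.
move=> /rV0Pn[c]; rewrite !mxE !sum_ord3 !mxE /=; move=> c0 h h'.
have E1 (u : 'rV[K]_(nplucker 3)) : u *m pv (wm z z') = 0 <-> (u *m pv (wm z z')) 0 0 = 0.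
  split=> [->|H]; first by rewrite mxE.
  by apply/matrixP => o o'; rewrite !ord1 H mxE.
rewrite !E1 !coord_pv ?wm_tr // !wmE.
move: c0 h h'; move: (z 't0 0) (z 't1 0) (z 't2 0) => x0 x1 x2.
move: (z' 't0 0) (z' 't1 0) (z' 't2 0) => y0 y1 y2.
move: (pcoord b 't0 't1) (pcoord b 't0 't2) (pcoord b 't1 't2) => A B C.
move: (pcoord b' 't0 't1) (pcoord b' 't0 't2) (pcoord b' 't1 't2) => A' B' C' c0.
pose n0 := A * B' - B * A'; pose n1 := A * C' - C * A'; pose n2 := B * C' - C * B'.
rewrite -/n0 -/n1 -/n2 => h h'.
have key P Q R : n0 * R - n1 * Q + n2 * P = 0 ->
    P * (x0 * y1 - y0 * x1) + Q * (x0 * y2 - y0 * x2) + R * (x1 * y2 - y1 * x2) = 0.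
  move=> PQR; case: c c0 => [[|[|[|//]]] ? /=] c0; apply: (mulfI c0); rewrite mulr0 -/n0 -/n1 -/n2.
  - transitivity ((n0 * R - n1 * Q + n2 * P) * (x1 * y2 - x2 * y1) +
      (n0 * x0 + n1 * x1 + n2 * x2) * (y1 * P + y2 * Q) -
      (n0 * y0 + n1 * y1 + n2 * y2) * (x2 * Q + x1 * P)); first by ring.
    by rewrite PQR h h'; ring.
  - transitivity ((n0 * R - n1 * Q + n2 * P) * (x2 * y0 - x0 * y2) +
      (n0 * x0 + n1 * x1 + n2 * x2) * (y2 * R - y0 * P) +
      (n0 * y0 + n1 * y1 + n2 * y2) * (P * x0 - R * x2)); first by ring.
    by rewrite PQR h h'; ring.
  - transitivity ((n0 * R - n1 * Q + n2 * P) * (x0 * y1 - x1 * y0) -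
      (n0 * x0 + n1 * x1 + n2 * x2) * (y0 * Q + y1 * R) +
      (n0 * y0 + n1 * y1 + n2 * y2) * (R * x1 + Q * x0)); first by ring.
    by rewrite PQR h h'; ring.
by split; apply: key; rewrite /n0 /n1 /n2; ring.
Qed.

(* The common point of the lines of the plane pi on which the form f vanishes. *)
Definition plane_point (f : 'rV[K]_6) (pi : 'rV[K]_4) : 'cV[K]_4 :=
  skew4 (J *m f^T) *m pi^T.

Lemma row_wedge (f : 'rV[K]_6) u v :
  (f *m wedge4 u v) 0 0 = (u^T *m (skew4 f^T *m v)) 0 0.
Proof.
rewrite !mxE sum_ord6 sum_ord4 !mxE !sum_ord4 !mxE /=; ring.
Qed.

Lemma plane_point_plane f pi : pi *m plane_point f pi = 0.
Proof.
apply/matrixP => o o'; rewrite !ord1 /plane_point [RHS]mxE.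
set S := skew4 _; have : (pi *m (S *m pi^T))^T = - (pi *m (S *m pi^T)).
  by rewrite !trmx_mul trmxK skew4_tr mulmxN mulNmx mulmxA.
move/matrixP/(_ 0 0); rewrite mxE [RHS]mxE => /eqP.
by rewrite -addr_eq0 -mulr2n mulrn_eq0 => /eqP.
Qed.

Lemma skew_plane_point f pi : exists c, skew4 f^T *m plane_point f pi = c *: pi^T.
Proof.
have := skew4_star_self (J *m f^T); rewrite mulmxA kleinK mul1mx => E.
eexists; rewrite /plane_point mulmxA E -scalemxAl mul1mx; reflexivity.
Qed.

(** When [f] vanishes on the line, the mixed identity is [X^* F^* + F X = 0]. As [X] kills the plane
    [pi], the dual [X^*] kills [F^* pi^T], which is the plane point. *)
Lemma plane_point_on_line f pi u v : wedge4 u v != 0 -> pi *m u = 0 -> pi *m v = 0 ->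
  f *m wedge4 u v = 0 -> exists a b, plane_point f pi = a *: u + b *: v.
Proof.
move=> uv piu piv fuv; apply: wedge_spanP => //.
have := skew4_star_mul (wedge4 u v) f^T.
have -> : \sum_k wedge4 u v k 0 * f^T k 0 = (f *m wedge4 u v) 0 0.
  by rewrite [RHS]mxE; apply: eq_bigr => k _; rewrite [f^T k 0]mxE mulrC.
rewrite fuv mxE oppr0 scale0r /plane_point mulmxA => /eqP.
rewrite addr_eq0 => /eqP->; rewrite mulNmx -mulmxA skew4_wedge mulmxBl -!mulmxA.
by rewrite -!trmx_mul piu piv trmx0 !mulmx0 subrr mulmx0 oppr0.
Qed.

(** The matrix of [f] sends its own plane point to a multiple of [pi], which annihilates the other
    plane point. The join of the two points thus solves both forms. *)
Lemma plane_points_isotropic f f' pi :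
  f *m wedge4 (plane_point f pi) (plane_point f' pi) = 0 /\
  f' *m wedge4 (plane_point f pi) (plane_point f' pi) = 0.
Proof.
have [c cE] := skew_plane_point f pi; have [c' c'E] := skew_plane_point f' pi.
split; apply/matrixP => o o'; rewrite !ord1 [RHS]mxE row_wedge.
  rewrite mulmxA -[_^T *m skew4 _]trmxK trmx_mul trmxK skew4_tr mulNmx cE.
  rewrite -scaleN1r scalerA trmxZ trmxK -scalemxAl plane_point_plane.
  by rewrite scaler0 mxE.
by rewrite c'E -scalemxAr -trmx_mul plane_point_plane trmx0 scaler0 mxE.
Qed.

End PlaneLines.

(** * Sections in which one camera has two forms *)

Section OnePointSection.
Local Open Scope classical_set_scope.
Local Open Scope card_scope.
Local Open Scope ring_scope.
Variable K : numClosedFieldType.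
Variables (n g : nat) (C : arrangement K n 3 2) (L : 'I_g -> grass K 2 4).
Variables l l' : 'I_g -> 'cV[K]_4.
Hypothesis n_gt0 : (0 < n)%N.
Hypothesis LE : forall j, val (L j) = <<[:: l j; l' j]>>%VS.
Variables (k : nat) (d : 'I_n -> nat).
Variables (b : {i : 'I_n & ('I_(d i) * 'I_(nplucker 3))%type} -> K).
Variable e : 'I_k -> {i : 'I_n & 'I_(d i)}.
Hypothesis e_bij : bijective e.

Variables (i0 : 'I_n) (r0 r1 : 'I_(d i0)) (a1 a2 : 'I_(k + g)).
Let b0 := secrow b (Tagged (fun i => 'I_(d i)) r0).
Let b1 := secrow b (Tagged (fun i => 'I_(d i)) r1).
Let forms := line_forms C l l' b e.
(** Expresses that the four forms are the two of camera [i0] together with rows [a1] and [a2]. *)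
Hypothesis forms_cover : forall x : 'cV[K]_6,
  b0 *m (lam (C i0) *m x) = 0 -> b1 *m (lam (C i0) *m x) = 0 ->
  row a1 forms *m x = 0 -> row a2 forms *m x = 0 -> forms *m x = 0.

Definition back_plane := join_coef b0 b1 *m C i0.
Let p1 := plane_point (row a1 forms) back_plane.
Let p2 := plane_point (row a2 forms) back_plane.

Hypothesis lam_neq0 : forall i, lam (C i) *m wedge4 p1 p2 != 0.

Let p12 : wedge4 p1 p2 != 0.
Proof. by apply: contraNneq (lam_neq0 (Ordinal n_gt0)) => ->; rewrite mulmx0. Qed.

Lemma plane_line_forms : forms *m wedge4 p1 p2 = 0.
Proof.
have [h1 h2] := plane_points_isotropic (row a1 forms) (row a2 forms) back_plane.
have n0 : join_coef b0 b1 != 0.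
  apply: contraNneq p12 => n0; rewrite /p1 /back_plane n0 mul0mx /plane_point trmx0 mulmx0.
  have W w : wedge4 0 w = 0 :> 'cV[K]_6 by apply/matrixP => i j; rewrite !mxE; ring.
  by rewrite W.
have q a : (join_coef b0 b1 *m (C i0 *m plane_point (row a forms) back_plane)) 0 0 = 0.
  by rewrite mulmxA plane_point_plane mxE.
have [B0 B1] := join_coef_pv n0 (q a1) (q a2).
by apply: forms_cover; rewrite ?lamE ?camera_wedge.
Qed.

(** Incidence with [y i0], which satisfies both section equations, puts every solution, limits
    included, into the back-projected plane. There it passes through the plane points of the other
    two forms, which are distinct. *)
Theorem one_point_section :
  line_variety C L `&` [set y | forall i, secmx b i *m rep y i = 0] #= `I_1.
Proof.
have [y0 y0E] := ex_mpoint lam_neq0.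
suff -> : line_variety C L `&` [set y | forall i, secmx b i *m rep y i = 0] = [set y0].
  exact: card_set1.
apply/seteqP; split=> [y [Xy sy]|y ->] /=; last first.
  exact: (section_point n_gt0 LE e_bij plane_line_forms (wedge_isotropic _ _) y0E).
have [u [v [uv Ouv prop inc]]] := section_incidence n_gt0 LE e_bij Xy sy.
have sec (r : 'I_(d i0)) : secrow b (Tagged (fun i => 'I_(d i)) r) *m rep y i0 = 0.
  by move: r; apply/secmx_mul0.
have [iu iv] := inc i0; have y0' := rep_neq0 y i0.
have plane w : incident (unpv (rep y i0)) (C i0 *m w) -> back_plane *m w = 0.
  move=> iw; apply/matrixP => o o'; rewrite !ord1 [RHS]mxE /back_plane -mulmxA.
  exact: join_coef_incident y0' (sec r0) (sec r1) iw.
have on a : exists s t, plane_point (row a forms) back_plane = s *: u + t *: v.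
  by apply: plane_point_on_line => //; rewrite ?plane // -row_mul Ouv row0.
have [s [t p1E]] := on a1; have [s' [t' p2E]] := on a2.
have pE : wedge4 p1 p2 = (s * t' - t * s') *: wedge4 u v.
  by rewrite /p1 /p2 p1E p2E wedge4_lin.
have c0 : s * t' - t * s' != 0.
  by apply: contraNneq p12; rewrite pE => ->; rewrite scale0r.
have lx i : lam (C i) *m wedge4 u v != 0.
  by have := lam_neq0 i; rewrite pE -scalemxAr scaler_eq0 (negbTE c0).
by apply: mpoint_eq => i; rewrite (section_pointE lx prop) y0E pE -scalemxAr vlineZ.
Qed.

End OnePointSection.

(** * Explicit configurations and genericity *)

Section PolynomialData.
Local Open Scope ring_scope.
Variable K : numClosedFieldType.
Local Notation J := (klein K).
Variable I : finType.

Definition polymx m n (A : (I -> K) -> 'M[K]_(m, n)) : Prop :=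
  forall i j, polyfun (fun x => A x i j).

Lemma polymx_const m n (A : 'M[K]_(m, n)) : polymx (fun=> A).
Proof. by move=> i j; apply: polyfun_const. Qed.

Lemma polymx_mul m n p (A : (I -> K) -> 'M[K]_(m, n)) (B : (I -> K) -> 'M[K]_(n, p)) :
  polymx A -> polymx B -> polymx (fun x => A x *m B x).
Proof. by move=> pA pB i j; apply: polyfun_mulmx. Qed.

Lemma polymx_tr m n (A : (I -> K) -> 'M[K]_(m, n)) : polymx A -> polymx (fun x => (A x)^T).
Proof. by move=> pA i j; apply: polyfun_ext (pA j i) => x; rewrite mxE. Qed.

Lemma polymx_row m n (A : (I -> K) -> 'M[K]_(m, n)) i : polymx A -> polymx (fun x => row i (A x)).
Proof. by move=> pA i' j; apply: polyfun_ext (pA i j) => x; rewrite mxE. Qed.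

Lemma polymx_wedge4 (u v : (I -> K) -> 'cV[K]_4) : polymx u -> polymx v ->
  polymx (fun x => wedge4 (u x) (v x)).
Proof.
move=> pu pv k o; pose i := (pair6 k).1; pose j := (pair6 k).2.
apply: (@polyfun_ext _ _ (fun x => u x i 0 * v x j 0 - u x j 0 * v x i 0)).
  by move=> x; rewrite mxE.
by apply: polyfunB; apply: polyfunM.
Qed.

Lemma polymx_skew4 (u : (I -> K) -> 'cV[K]_6) : polymx u -> polymx (fun x => skew4 (u x)).
Proof.
move=> pu i j; apply: (@polyfun_ext _ _
  (fun x => \sum_s u x s 0 * skew4 (delta_mx s 0) i j)).
  by move=> x; rewrite (skew4_sum (u x)) summxE; apply: eq_bigr => s _; rewrite [RHS]mxE.
by apply: polyfun_sum => s _; apply: polyfunM => //; apply: polyfun_const.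
Qed.

Variables (n h g k : nat) (d : 'I_n -> nat) (e : 'I_k -> {i : 'I_n & 'I_(d i)}).
Variable C : (I -> K) -> arrangement K n 3 h.
Variables l l' : (I -> K) -> 'I_g -> 'cV[K]_4.
Variable b : (I -> K) -> {i : 'I_n & ('I_(d i) * 'I_(nplucker h.+1))%type} -> K.
Hypotheses (pC : forall i, polymx (fun x => C x i)).
Hypotheses (pl : forall j, polymx (fun x => l x j)) (pl' : forall j, polymx (fun x => l' x j)).
Hypothesis pb : forall t, polyfun (fun x => b x t).

Lemma polymx_lam_row i p q : polymx (fun x => lam_row (C x i) p q).
Proof.
move=> o s; pose u := (pair6 s).1; pose v := (pair6 s).2.
apply: (@polyfun_ext _ _ (fun x => C x i p u * C x i q v - C x i p v * C x i q u)).
  by move=> x; rewrite mxE.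
by apply: polyfunB; apply: polyfunM; apply: pC.
Qed.

Lemma polymx_secrow t : polymx (fun x => secrow (b x) t).
Proof.
move=> o s; apply: polyfun_ext (pb (Tagged (fun i => ('I_(d i) * _)%type) (tagged t, s))) => x.
by rewrite !mxE.
Qed.

Definition line_data x := line_forms (C x) (l x) (l' x) (b x) e.

Lemma polymx_line_data : polymx line_data.
Proof.
move=> i s; have [j ->|j ->] := split_ordP i.
  have pM : polymx (fun x => secrow (b x) (e j) *m lam (C x (tag (e j)))).
    apply: polymx_mul; first exact: polymx_secrow.
    move=> r s'; apply: polyfun_ext (polymx_lam_row _ _ _ 0 s') => x.
    by rewrite [RHS]mxE.
  by apply: polyfun_ext (pM 0 s) => x; rewrite [RHS]col_mxEu [RHS]mxE.
have pM := polymx_mul (polymx_const J) (polymx_wedge4 (pl j) (pl' j)).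
by apply: polyfun_ext (pM s 0) => x; rewrite [RHS]col_mxEd [RHS]mxE.
Qed.

Lemma polyfun_gram : polyfun (fun x => \det (gram (line_data x))).
Proof.
apply: polyfun_det; apply: polymx_mul; last exact/polymx_tr/polymx_line_data.
by apply: polymx_mul; [exact: polymx_line_data|exact: polymx_const].
Qed.

End PolynomialData.

Section CenterForms.
Local Open Scope ring_scope.
Variable K : numClosedFieldType.

(* Three forms together with the forms of the lines through the center of C. *)
Definition center_forms (C : 'M[K]_(3, 4)) p (O : 'M[K]_(p, 6)) (s : 'I_3 -> 'I_p) : 'M[K]_6 :=
  \matrix_(i, j) match (i : nat) with
    | 0 => lam_row C 't0 't1 0 j | 1 => lam_row C 't0 't2 0 j | 2 => O (s 't0) j
    | 3 => lam_row C 't1 't2 0 j | 4 => O (s 't1) j | _ => O (s 't2) j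
  end.

(** A line through the center satisfying all of [O] would be killed by an invertible 6 by 6
    matrix. *)
Lemma center_formsP C p (O : 'M[K]_(p, 6)) s (x : 'cV[K]_6) :
  \det (center_forms C O s) != 0 -> x != 0 -> O *m x = 0 -> lam C *m x != 0.
Proof.
rewrite -unitfE -unitmxE => U x0 Ox; apply: contraNneq x0 => /eqP.
rewrite lam_eq0 => /eqP CX.
have lr i j : \sum_t lam_row C i j 0 t * x t 0 = 0.
  by have := lam_rowE C i j x; rewrite CX mxE [RHS]mxE.
have Or i : \sum_t O i t * x t 0 = 0.
  by have /matrixP/(_ i 0) := Ox; rewrite mxE [RHS]mxE.
suff Dx : center_forms C O s *m x = 0 by rewrite -[x](mulKmx U) Dx mulmx0.
apply/matrixP => i o; rewrite ord1 [RHS]mxE mxE; under eq_bigr do rewrite mxE.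
by case: i => [[|[|[|[|[|[|//]]]]]] ?] /=; rewrite ?lr ?Or.
Qed.

Lemma polyfun_center (I : finType) p (C : (I -> K) -> 'M[K]_(3, 4)) (O : (I -> K) -> 'M[K]_(p, 6)) s :
  (forall i j, polymx (fun x => lam_row (C x) i j)) -> polymx O ->
  polyfun (fun x => \det (center_forms (C x) (O x) s)).
Proof.
move=> pL pO; apply: polyfun_det => i j.
pose F x := match (i : nat) with
    | 0 => lam_row (C x) 't0 't1 0 j | 1 => lam_row (C x) 't0 't2 0 j | 2 => O x (s 't0) j
    | 3 => lam_row (C x) 't1 't2 0 j | 4 => O x (s 't1) j | _ => O x (s 't2) j
  end.
apply: (@polyfun_ext _ _ F) => [x|]; first by rewrite mxE.
rewrite /F; case: i {F} => [[|[|[|[|[|[|//]]]]]] ?] /=; first [exact: pL | exact: pO].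
Qed.

Lemma polymx_plane_point (I : finType) (f : (I -> K) -> 'rV[K]_6) (pi : (I -> K) -> 'rV[K]_4) :
  polymx f -> polymx pi -> polymx (fun x => plane_point (f x) (pi x)).
Proof.
move=> pf ppi; apply: polymx_mul; last exact: polymx_tr.
apply: polymx_skew4; apply: polymx_mul; [exact: polymx_const|exact: polymx_tr].
Qed.

Lemma polymx_join_coef (I : finType) (b b' : (I -> K) -> 'rV[K]_(nplucker 3)) :
  polymx b -> polymx b' -> polymx (fun x => join_coef (b x) (b' x)).
Proof.
have pc (u : (I -> K) -> 'rV[K]_(nplucker 3)) i j : polymx u -> polyfun (fun x => pcoord (u x) i j).
  have pu v w : polymx u -> polyfun (fun x => upper (u x)^T v w).
    rewrite /upper; case: insub => [p|] pu; last exact: polyfun_const.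
    exact: (polymx_tr pu).
  move=> Hu; apply: (@polyfun_ext _ _ (fun x => upper (u x)^T i j - upper (u x)^T j i)).
    by move=> x; rewrite /pcoord mxE.
  by apply: polyfunB; apply: pu.
move=> pb pb' o c.
pose F i j i' j' x := pcoord (b x) i j * pcoord (b' x) i' j' - pcoord (b x) i' j' * pcoord (b' x) i j.
have pF i j i' j' : polyfun (F i j i' j').
  by apply: polyfunB; apply: polyfunM; apply: pc.
apply: (@polyfun_ext _ _ (match (c : nat) with
  | 0 => F 't0 't1 't0 't2 | 1 => F 't0 't1 't1 't2 | _ => F 't0 't2 't1 't2 end)).
  by move=> x; rewrite mxE; case: c => [[|[|[|//]]] ?].
by case: (c : nat) => [|[|?]]; apply: pF.
Qed.

End CenterForms.

(** * Coordinate configurations *)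

Section Witnesses.
Local Open Scope ring_scope.
Variable K : numClosedFieldType.
Local Notation J := (klein K).

(** Incidence with a coordinate line is a Pluecker coordinate up to sign, and the sign is absorbed
    into the first spanning vector. *)
Lemma anchor_witness (c : 'I_6) : exists l l', J *m wedge4 l l' = delta_mx c 0 :> 'cV[K]_6.
Proof.
pose e (i : 'I_4) : 'cV[K]_4 := delta_mx i 0.
have red s p q : J *m wedge4 (s *: e p) (e q) = s *: (J *m wedge4 (e p) (e q)).
  by rewrite scalemxAr; congr (_ *m _); apply/matrixP => i j; rewrite !mxE; ring.
move: c; apply: ord6P.
- exists (1 *: e 'f2), (e 'f3); rewrite red kleinE; apply/matrixP => i o; rewrite ord1 !mxE.
  by move: i; apply: ord6P; rewrite -!val_eqE /=; ring.
- exists (-1 *: e 'f1), (e 'f3); rewrite red kleinE; apply/matrixP => i o; rewrite ord1 !mxE.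
  by move: i; apply: ord6P; rewrite -!val_eqE /=; ring.
- exists (1 *: e 'f1), (e 'f2); rewrite red kleinE; apply/matrixP => i o; rewrite ord1 !mxE.
  by move: i; apply: ord6P; rewrite -!val_eqE /=; ring.
- exists (1 *: e 'f0), (e 'f3); rewrite red kleinE; apply/matrixP => i o; rewrite ord1 !mxE.
  by move: i; apply: ord6P; rewrite -!val_eqE /=; ring.
- exists (-1 *: e 'f0), (e 'f2); rewrite red kleinE; apply/matrixP => i o; rewrite ord1 !mxE.
  by move: i; apply: ord6P; rewrite -!val_eqE /=; ring.
- exists (1 *: e 'f0), (e 'f1); rewrite red kleinE; apply/matrixP => i o; rewrite ord1 !mxE.
  by move: i; apply: ord6P; rewrite -!val_eqE /=; ring.
Qed.

Definition sel m (p q : 'I_m) : 'rV[K]_(nplucker m) :=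
  \row_k (val (enum_val k) == (p, q))%:R.

Lemma mul_sel m (p q : 'I_m) (y : 'cV[K]_(nplucker m)) : (p < q)%N ->
  (sel p q *m y) 0 0 = unpv y p q.
Proof.
move=> pq; pose t : pairs m := exist (fun ij : 'I_m * 'I_m => is_true (ij.1 < ij.2)%N) (p, q) pq.
have -> : sel p q *m y = row (enum_rank t) y.
  rewrite rowE; congr (_ *m _); apply/rowP => k; rewrite !mxE eqxx /=.
  by rewrite -[X in _ = (X == _)%:R](enum_valK k) (inj_eq enum_rank_inj) -val_eqE.
rewrite mxE mxE /upper insubT; rewrite insubF ?subr0.
  by congr (y _ 0); congr enum_rank; apply: val_inj.
by rewrite /= ltnNge ltnW.
Qed.

Lemma sel_lam m (C : 'M[K]_(m, 4)) (p q : 'I_m) : (p < q)%N -> sel p q *m lam C = lam_row C p q.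
Proof.
move=> pq; apply/rowP => s; have mulc r (A : 'M[K]_(r, 6)) i : A i s = (A *m (delta_mx s 0 : 'cV[K]_6)) i 0.
  by rewrite -colE mxE.
rewrite mulc [RHS]mulc -mulmxA mul_sel // lamE lam_rowE pvK //.
exact: camera_skew_tr.
Qed.

Lemma pcoord_sel (p q i j : 'I_3) : (p < q)%N -> (i < j)%N ->
  pcoord (sel p q) i j = ((i == p) && (j == q))%:R.
Proof.
move=> pq ij; rewrite /pcoord mxE /upper insubT insubF ?subr0.
  by rewrite !mxE enum_rankK /= xpair_eqE.
by rewrite /= ltnNge ltnW.
Qed.

Definition cam_rows m (t : 'I_m -> 'I_4) : 'M[K]_(m, 4) := \matrix_(i, j) (j == t i)%:R.

Lemma lam_cam_rows m (t : 'I_m -> 'I_4) (p q : 'I_m) (c : 'I_6) :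
  t p = (pair6 c).1 -> t q = (pair6 c).2 -> lam_row (cam_rows t) p q = delta_mx 0 c.
Proof.
move=> tp tq; apply/rowP => s; rewrite !mxE tp tq.
by move: c s {tp tq}; do 2!apply: ord6P; rewrite -!val_eqE /=; ring.
Qed.

(* The four coordinates are closed under the pairing s <-> 5 - s of the Klein
   form, so that the Gram matrix is a signed permutation matrix. *)
Lemma gram_witness p (c : 'I_p -> 'I_6) : p = 4%N -> injective c ->
  (forall i, c i \in [:: 's0; 's1; 's4; 's5]) ->
  \det (gram (\matrix_(i, j) (j == c i)%:R : 'M[K]_(p, 6))) != 0.
Proof.
move=> p4 ic cS; set O : 'M[K]_(p, 6) := \matrix_(i, j) _.
pose S := [:: 's0; 's1; 's4; 's5].
have SE s : (s \in codom c) = (s \in S).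
  apply: (uniq_min_size _ _ _).2 => //.
  - by rewrite map_inj_uniq ?enum_uniq.
  - by move=> x /codomP[i ->].
  - by rewrite size_codom card_ord p4.
pose P : 'M[K]_6 := \matrix_(s, t) ((s == t) && (s \in S))%:R.
have OO : O^T *m O = P.
  apply/matrixP => s t; rewrite !mxE; under eq_bigr do rewrite !mxE -natrM mulnb.
  have [/codomP[i sE]|sc] := boolP (s \in codom c).
    rewrite (bigD1 i) //= -sE eqxx /= big1 ?addr0 => [|j ji].
      by rewrite -SE sE codom_f andbT eq_sym.
    by rewrite sE (inj_eq ic) eq_sym (negbTE ji).
  rewrite big1 => [|i _]; first by rewrite -SE (negbTE sc) andbF.
  by case: eqP => // sE; rewrite sE codom_f in sc.
have OOt : O *m O^T = 1%:M.
  apply/matrixP => i j; rewrite !mxE (bigD1 (c i)) //= big1 ?addr0 => [|s si].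
    by rewrite !mxE eqxx mul1r (inj_eq ic).
  by rewrite mxE (negbTE si) mul0r.
have JP : J *m P = P *m J.
  apply/matrixP => s t; transitivity (J s t * P t t).
    rewrite mxE (bigD1 t) //= big1 ?addr0 // => u ut.
    by rewrite [P _ _]mxE (negbTE ut) mulr0.
  transitivity (P s s * J s t); last first.
    rewrite [RHS]mxE (bigD1 s) //= big1 ?addr0 // => u us.
    by rewrite [P _ _]mxE eq_sym (negbTE us) mul0r.
  rewrite ![P _ _]mxE !eqxx [J _ _]mxE.
  by move: s t; do 2!apply: ord6P; rewrite !inE -!val_eqE /= ?mulr1 ?mul1r ?mulr0 ?mul0r.
have JPJ : J *m P *m J = P by rewrite JP -mulmxA kleinK mulmx1.
(* As [O^T O] is the projection [P] onto the selected coordinates,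
   [gram^2 = O J P J O^T = O P O^T = 1]. *)
have : gram O *m gram O = 1%:M.
  rewrite /gram -!mulmxA [O^T *m (O *m _)]mulmxA OO !mulmxA.
  rewrite -[O *m J *m P *m J]mulmxA -[O *m J *m _]mulmxA [J *m (P *m J)]mulmxA JPJ.
  by rewrite -OO !mulmxA OOt mul1mx OOt.
by move/mulmx1_unit => [+ _]; rewrite unitmxE unitfE.
Qed.

End Witnesses.

(** * Parameter spaces of cameras, anchors and sections *)

Section GenericLines.
Local Open Scope classical_set_scope.
Local Open Scope card_scope.
Local Open Scope ring_scope.
Variable K : numClosedFieldType.
Local Notation J := (klein K).

Variables (n h g : nat).
Local Notation I := (('I_n * 'I_h.+1 * 'I_4) + ('I_g * 'I_4 * 'I_2))%type.

Definition cam_data (a : I -> K) : arrangement K n 3 h := fun i => \matrix_(r, c) a (inl (i, r, c)).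

Definition anchor_data (a : I -> K) (s : 'I_2) (j : 'I_g) : 'cV[K]_4 := \col_r a (inr (j, r, s)).

Section Degree.
Variable d : 'I_n -> nat.
Local Notation B := {i : 'I_n & ('I_(d i) * 'I_(nplucker h.+1))%type}.

Lemma ex_data (C : arrangement K n 3 h) (l l' : 'I_g -> 'cV[K]_4)
    (w : {i : 'I_n & 'I_(d i)} -> 'rV[K]_(nplucker h.+1)) :
  exists (a : I -> K) (b : B -> K), [/\ cam_data a = C, anchor_data a ord0 = l,
    anchor_data a ord_max = l' & forall t, secrow b t = w t].
Proof.
exists (fun t => match t with
    | inl (i, r, c) => C i r c
    | inr (j, r, s) => if s == ord0 then l j r 0 else l' j r 0 end),
  (fun t => w (Tagged (fun i => 'I_(d i)) (tagged t).1) 0 (tagged t).2); split.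
- by apply/funext => i; apply/matrixP => r c; rewrite mxE.
- by apply/funext => j; apply/matrixP => r o; rewrite ord1 !mxE.
- by apply/funext => j; apply/matrixP => r o; rewrite ord1 !mxE.
- by case=> i r; apply/rowP => c; rewrite !mxE.
Qed.

(** Polynomiality is asked over an arbitrary parameter type, so that one proof covers variation of
    the configuration with fixed section and the reverse. *)
Lemma gen2_data (f : arrangement K n 3 h -> ('I_g -> 'cV[K]_4) -> ('I_g -> 'cV[K]_4) ->
    (B -> K) -> K) :
  (forall (T : finType) C l l' (b : (T -> K) -> B -> K),
    (forall i, polymx (fun x => C x i)) -> (forall j, polymx (fun x => l x j)) ->
    (forall j, polymx (fun x => l' x j)) -> (forall t, polyfun (fun x => b x t)) ->
    polyfun (fun x => f (C x) (l x) (l' x) (b x))) ->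
  (exists C l l' w, forall b, (forall t, secrow b t = w t) -> f C l l' b != 0) ->
  gen (fun a => gen (fun b =>
    f (cam_data a) (anchor_data a ord0) (anchor_data a ord_max) b != 0)).
Proof.
move=> pf [C [l [l' [w fw]]]]; apply: gen2_nonzero.
- move=> b; apply: pf => [i r c|j r c|j r c|t]; last exact: polyfun_const.
  + by apply: polyfun_ext (polyfun_coord K (inl (i, r, c))) => a; rewrite mxE.
  + by apply: polyfun_ext (polyfun_coord K (inr (j, r, ord0))) => a; rewrite mxE.
  + by apply: polyfun_ext (polyfun_coord K (inr (j, r, ord_max))) => a; rewrite mxE.
- by move=> a; apply: pf => [i|j|j|t]; try exact: polymx_const; exact: polyfun_coord.
have [a [b [aC al al' bw]]] := ex_data C l l' w.
by exists a, b; rewrite aC al al'; apply: fw.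
Qed.

Variable k : nat.
Hypothesis kg : (k + g = 4)%N.
Variable e : 'I_k -> {i : 'I_n & 'I_(d i)}.

(** Once the cameras realise the first [k] coordinate forms, the anchors can be chosen to realise
    the other [g]. *)
Lemma witness_rows (C : arrangement K n 3 h) (w : {i : 'I_n & 'I_(d i)} -> 'rV[K]_(nplucker h.+1))
    (c : 'I_(k + g) -> 'I_6) :
  (forall j, w (e j) *m lam (C (tag (e j))) = delta_mx 0 (c (lshift g j))) ->
  exists l l', forall b : B -> K, (forall t, secrow b t = w t) ->
    line_forms C l l' b e = \matrix_(i, s) (s == c i)%:R.
Proof.
move=> wc.
have /fin_all_exists[l /fin_all_exists[l' ll]] (j : 'I_g) := anchor_witness K (c (rshift k j)).
exists l, l' => b bw; apply/matrixP => i s; rewrite [RHS]mxE.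
have [j ->|j ->] := split_ordP i.
  by rewrite col_mxEu mxE bw wc mxE.
by rewrite col_mxEd mxE ll mxE eqxx andbT.
Qed.

Lemma gram_target : exists c : 'I_(k + g) -> 'I_6,
  injective c /\ forall i, c i \in [:: 's0; 's1; 's4; 's5].
Proof.
pose S := [:: 's0; 's1; 's4; 's5].
have lt (i : 'I_(k + g)) : (i < size S)%N by rewrite /= -kg.
exists (fun i => nth 's0 S i); split; last by move=> i; apply: mem_nth.
by move=> i j /eqP; rewrite nth_uniq // => /eqP/val_inj.
Qed.

Lemma gen_gram :
  (exists (C : arrangement K n 3 h) (w : {i : 'I_n & 'I_(d i)} -> 'rV[K]_(nplucker h.+1))
      (c : 'I_(k + g) -> 'I_6),
    [/\ injective c, forall i, c i \in [:: 's0; 's1; 's4; 's5] &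
      forall j, w (e j) *m lam (C (tag (e j))) = delta_mx 0 (c (lshift g j))]) ->
  gen (fun a => gen (fun b => gram (line_forms (cam_data a) (anchor_data a ord0)
    (anchor_data a ord_max) b e) \in unitmx)).
Proof.
move=> [C [w [c [ic cS wc]]]].
apply: gen_mono (gen2_data (f := fun C l l' b => \det (gram (line_forms C l l' b e))) _ _).
- by move=> a; apply: gen_mono => b; rewrite unitmxE unitfE.
- by move=> T C' l l' b pC pl pl' pb; apply: polyfun_gram.
have [l [l' lw]] := witness_rows wc.
by exists C, l, l', w => b /lw ->; apply: gram_witness.
Qed.

End Degree.

Lemma limg_columns m (A : 'M[K]_(m, 2)) (l l' : 'cV[K]_m) :
  (forall r, A r ord0 = l r 0) -> (forall r, A r ord_max = l' r 0) ->
  limg (linfun (mulmx A : 'cV[K]_2 -> 'cV[K]_m)) = <<[:: l; l']>>%VS.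
Proof.
move=> Al Al'.
have AE (z : 'cV[K]_2) : A *m z = z ord0 0 *: l + z ord_max 0 *: l'.
  apply/matrixP => i o; rewrite ord1 !mxE big_ord_recl big_ord1 Al.
  by rewrite (_ : lift ord0 ord0 = ord_max) ?Al' 1?mulrC 1?[X in _ + X]mulrC //; apply: val_inj.
apply/vspaceP => w; apply/memv_imgP/mem_span2 => [[z _ ->]|[s [t ->]]].
  by rewrite lfunE /= AE; eexists; eexists.
exists (\col_i if i == ord0 then s else t); first exact: memvf.
by rewrite lfunE /= AE !mxE.
Qed.

End GenericLines.

(** * Sections with two points *)

Section LineSections.
Local Open Scope classical_set_scope.
Local Open Scope card_scope.
Local Open Scope ring_scope.
Variable K : numClosedFieldType.
Local Notation J := (klein K).

Variables (n g k : nat).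
Hypotheses (n_gt0 : (0 < n)%N) (kg : (k + g = 4)%N).

Definition line_section_claim h (d : 'I_n -> nat) c
    (a : 'I_n * 'I_h.+1 * 'I_4 + 'I_g * 'I_4 * 'I_2 -> K)
    (b : {i : 'I_n & ('I_(d i) * 'I_(nplucker h.+1))%type} -> K) : Prop :=
  forall L : 'I_g -> grass K 2 4, (forall i, is_camera (cam_data a i)) ->
  (forall j, val (L j) = <<[:: anchor_data a ord0 j; anchor_data a ord_max j]>>%VS) ->
  dim_is (line_variety (cam_data a) L) k /\
  line_variety (cam_data a) L `&` [set y | forall i, secmx b i *m rep y i = 0] #= `I_c.

Lemma tagged_enum (d : 'I_n -> nat) : (\sum_i d i = k)%N ->
  exists (e : 'I_k -> {i : 'I_n & 'I_(d i)}) ei, cancel e ei /\ cancel ei e.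
Proof.
move=> dk; have cN : #|{: {i : 'I_n & 'I_(d i)}}| = k by rewrite card_tagged_ord.
exists (fun j => enum_val (cast_ord (esym cN) j)), (fun x => cast_ord cN (enum_rank x)).
by split=> j; rewrite ?enum_valK ?cast_ordKV // cast_ordK enum_rankK.
Qed.

Lemma pair6_lt (c : 'I_6) : ((pair6 c).1 < (pair6 c).2)%N.
Proof. by move: c; apply: ord6P. Qed.

(** Full-rank 4 by 4 cameras act injectively on Pluecker vectors, so no image degenerates and the
    Gram determinant is the only condition. The witness takes all cameras equal to the identity. *)
Lemma line_sections3 (d : 'I_n -> nat) : (\sum_i d i = k)%N ->
  gen (fun a => gen (fun b => @line_section_claim 3 d 2 a b)).
Proof.
move=> /tagged_enum[e [ei [eK eiK]]].
have e_bij : bijective e by exists ei.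
have gG : gen (fun a : 'I_n * 'I_3.+1 * 'I_4 + 'I_g * 'I_4 * 'I_2 -> K => gen (fun b =>
    gram (line_forms (cam_data a) (anchor_data a ord0)
    (anchor_data a ord_max) b e) \in @unitmx K _)).
  apply: (gen_gram (h := 3) kg); have [c [ic cS]] := gram_target kg.
  exists (fun=> cam_rows K id).
  exists (fun t => sel K (pair6 (c (lshift g (ei t)))).1 (pair6 (c (lshift g (ei t)))).2).
  exists c; split=> // j; rewrite eK sel_lam ?pair6_lt //; exact: lam_cam_rows.
apply: gen_mono gG => a; apply: gen_mono => b G_unit L cam LE.
have rC i : \rank (cam_data a i) = 4%N by rewrite cam.
have nz (x : 'cV[K]_6) : x != 0 -> forall i, lam (cam_data a i) *m x != 0.
  move=> x0 i; rewrite lam_eq0; apply: contraNneq x0 => CX.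
  have U : cam_data a i \in unitmx by rewrite -row_full_unit /row_full rC.
  apply/eqP/skew4_eq0; rewrite -[skew4 x](mulKmx U)
    -[X in _ *m X](mulmxK (_ : (cam_data a i)^T \in unitmx)) ?unitmx_tr //.
  by rewrite CX mul0mx mulmx0.
split.
  have [x1 [x10 Ox1 q1]] := isotropic_solution
    (line_forms (cam_data a) (anchor_data a ord0) (anchor_data a ord_max) b e) kg.
  exact: (dim_line_variety n_gt0 LE kg G_unit Ox1 q1 (nz _ x10)).
apply: (two_point_section n_gt0 LE kg G_unit e_bij) => [i|x x0 _ _ i].
  by rewrite rC.
exact: nz.
Qed.

Definition rows3 (a b c : 'I_4) (r : 'I_3) : 'I_4 :=
  match (r : nat) with 0 => a | 1 => b | _ => c end.

(** Besides the Gram determinant, solutions through a camera center must be excluded. For each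
    camera one 6 by 6 determinant does so: its three exterior rows and three of the four forms. *)
Lemma line_sections2_distinct (d : 'I_n -> nat) : (\sum_i d i = k)%N -> (forall i, d i <= 1)%N ->
  gen (fun a => gen (fun b => @line_section_claim 2 d 2 a b)).
Proof.
move=> /tagged_enum[e [ei [eK eiK]]] d1.
have e_bij : bijective e by exists ei.
have tag_inj j j' : tag (e j) = tag (e j') -> j = j'.
  move=> E; rewrite -[j]eK -[j']eK; congr ei.
  move: (e j) (e j') E => [i r] [i' r'] /= E; subst i'; congr (Tagged _ _); apply/val_inj.
  have := leq_trans (ltn_ord r) (d1 i); have := leq_trans (ltn_ord r') (d1 i).
  by rewrite !ltnS !leqn0 => /eqP r'0 /eqP r00; apply: etrans r00 (esym r'0).
(* The first two rows select coordinate [c]. The third may repeat one of them: a witness for a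
   nonzero polynomial need not be a camera. *)
pose mk (c : 'I_6) : 'M[K]_(3, 4) := cam_rows K (rows3 (pair6 c).1 (pair6 c).2 'f0).
pose cams (c : 'I_(k + g) -> 'I_6) i :=
  if [pick j | tag (e j) == i] is Some j then mk (c (lshift g j)) else mk 's0.
have camsE c j : cams c (tag (e j)) = mk (c (lshift g j)).
  rewrite /cams; case: pickP => [j' /eqP/tag_inj->//|/(_ j)].
  by rewrite eqxx.
have mkE c : sel K 't0 't1 *m lam (mk c) = delta_mx 0 c.
  by rewrite sel_lam //; apply: lam_cam_rows.
have gG : gen (fun a : 'I_n * 'I_2.+1 * 'I_4 + 'I_g * 'I_4 * 'I_2 -> K => gen (fun b =>
    gram (line_forms (cam_data a) (anchor_data a ord0)
    (anchor_data a ord_max) b e) \in @unitmx K _)).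
  apply: (gen_gram (h := 2) kg); have [c [ic cS]] := gram_target kg.
  by exists (cams c), (fun=> sel K 't0 't1), c; split=> // j; rewrite camsE mkE.
(* A form of camera [i] itself depends on the rows of [lam (C i)], so it is left out of the system,
   and [s i] lists the other three. A camera without a form leaves out the first one. *)
pose x0 i := if [pick j | tag (e j) == i] is Some j then lshift g j
  else cast_ord (esym kg) ord0.
pose s i u : 'I_(k + g) := cast_ord (esym kg) (lift (cast_ord kg (x0 i)) u).
have gC i : gen (fun a : 'I_n * 'I_2.+1 * 'I_4 + 'I_g * 'I_4 * 'I_2 -> K => gen (fun b =>
    \det (@center_forms K (cam_data a i) _
    (line_forms (cam_data a) (anchor_data a ord0) (anchor_data a ord_max) b e) (s i)) != 0)).
  apply: (gen2_data (h := 2) (f := fun C l l' b =>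
    \det (@center_forms K (C i) _ (line_forms C l l' b e) (s i)))).
    move=> T C l l' b pC pl pl' pb; apply: polyfun_center; last exact: polymx_line_data.
    by move=> p q; apply: polymx_lam_row.
  (* Camera [i] with rows [e_0, e_1, e_2] has exterior rows 0, 1, 3, and the remaining forms are
     given the coordinates 2, 4, 5, so that the 6 by 6 matrix is the identity. *)
  pose c (y : 'I_(k + g)) : 'I_6 := if unlift (cast_ord kg (x0 i)) (cast_ord kg y) is Some u
    then nth 's0 [:: 's2; 's4; 's5] u else 's0.
  have cs u : c (s i u) = nth 's0 [:: 's2; 's4; 's5] u by rewrite /c /s cast_ordKV liftK.
  pose Cw i' := if i' == i then cam_rows K (rows3 'f0 'f1 'f2) else cams c i'.
  have wc j : sel K 't0 't1 *m lam (Cw (tag (e j))) = delta_mx 0 (c (lshift g j)).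
    rewrite /Cw; case: eqP => [ji|_]; last by rewrite camsE mkE.
    have -> : c (lshift g j) = 's0.
      rewrite /c /x0; case: pickP => [j' /eqP j'i|/(_ j)]; last by rewrite ji eqxx.
      by rewrite (tag_inj j' j) ?unlift_none // ji.
    by rewrite sel_lam //; apply: lam_cam_rows.
  have [l [l' lw]] := witness_rows (h := 2) (w := fun=> sel K 't0 't1) wc.
  exists Cw, l, l', (fun=> sel K 't0 't1) => b /lw ->.
  rewrite (_ : center_forms _ _ _ = 1%:M) ?det1 ?oner_eq0 //.
  have lr (p q : 'I_3) (c' : 'I_6) :
      rows3 'f0 'f1 'f2 p = (pair6 c').1 -> rows3 'f0 'f1 'f2 q = (pair6 c').2 ->
      lam_row (Cw i) p q = delta_mx 0 c'.
    by rewrite /Cw eqxx; apply: lam_cam_rows.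
  apply/matrixP => r t; rewrite mxE; move: r; apply: ord6P => /=.
  - by rewrite (lr _ _ 's0) // !mxE eqxx eq_sym.
  - by rewrite (lr _ _ 's1) // !mxE eqxx eq_sym.
  - by rewrite !mxE cs eq_sym.
  - by rewrite (lr _ _ 's3) // !mxE eqxx eq_sym.
  - by rewrite !mxE cs eq_sym.
  - by rewrite !mxE cs eq_sym.
have := gen_and gG (gen_forall gC); apply: gen_mono => a [Ga /gen_forall Ca].
apply: gen_mono (gen_and Ga Ca) => b [G_unit Cb] L cam LE.
have nz (x : 'cV[K]_6) : x != 0 ->
    line_forms (cam_data a) (anchor_data a ord0) (anchor_data a ord_max) b e *m x = 0 ->
    forall i, lam (cam_data a i) *m x != 0.
  by move=> x00 Ox i; apply: center_formsP (Cb i) x00 Ox.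
split.
  have [x1 [x10 Ox1 q1]] := isotropic_solution
    (line_forms (cam_data a) (anchor_data a ord0) (anchor_data a ord_max) b e) kg.
  exact: (dim_line_variety n_gt0 LE kg G_unit Ox1 q1 (nz _ x10 Ox1)).
apply: (two_point_section n_gt0 LE kg G_unit e_bij) => [i|x x00 Ox _ i].
  by rewrite cam.
exact: nz.
Qed.

End LineSections.

(** * Sections with one point *)

Section DoubleSections.
Local Open Scope classical_set_scope.
Local Open Scope card_scope.
Local Open Scope ring_scope.
Variable K : numClosedFieldType.
Local Notation J := (klein K).

Lemma remaining_pair p (x y : 'I_p) : p = 4%N -> x != y -> exists u v,
  [/\ uniq [:: x; y; u; v] & forall i, i \in [:: x; y; u; v]].
Proof.
move=> p4 xy; have : #|~: [set x; y]| == 2%N.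
  have := cardsC [set x; y]; rewrite cards2 xy card_ord => E.
  by rewrite -(eqn_add2l 2) E p4.
case/cards2P=> u [v [uv /setP E]]; exists u, v.
have mE i : (i == x) || (i == y) = ~~ ((i == u) || (i == v)).
  by have := E i; rewrite !inE negb_or => <-; rewrite -negb_or negbK.
split; last by move=> i; rewrite !inE orbA mE; rewrite orNb.
have hx := mE x; have hy := mE y; rewrite eqxx /= in hx; rewrite eqxx orbT in hy.
by rewrite /= !inE !negb_or xy uv -!negb_or -hx -hy.
Qed.

Lemma plane_point3 : plane_point (delta_mx 0 's3) (delta_mx 0 'f3) = delta_mx 'f0 0 :> 'cV[K]_4.
Proof.
rewrite /plane_point kleinE !trmx_delta -colE; apply/matrixP => i o; rewrite ord1 !mxE.
by move: i; apply: ord4P; rewrite -?val_eqE /= ?oppr0.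
Qed.

Lemma plane_point1 : plane_point (delta_mx 0 's1) (delta_mx 0 'f3) = - delta_mx 'f1 0 :> 'cV[K]_4.
Proof.
rewrite /plane_point kleinE !trmx_delta -colE; apply/matrixP => i o; rewrite ord1 !mxE.
by move: i; apply: ord4P; rewrite -?val_eqE /= ?oppr0.
Qed.

Lemma join_coef_sel : join_coef (sel K 't0 't2) (sel K 't1 't2) = delta_mx 0 't2.
Proof.
apply/rowP => c; rewrite !mxE !pcoord_sel // -!val_eqE /=.
by case: c => [[|[|[|//]]] ?] /=; rewrite ?mulr0 ?mul0r ?mulr1 ?subr0.
Qed.

Variables (n g k : nat).
Hypotheses (n_gt0 : (0 < n)%N) (kg : (k + g = 4)%N).

(** The candidate line is the join of two plane points, a polynomial expression in the data. It
    remains to make the Gram determinant and one image coordinate per camera nonzero. *)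
Lemma line_sections2_double (d : 'I_n -> nat) i0 : (\sum_i d i = k)%N -> d i0 = 2%N ->
  gen (fun a => gen (fun b => @line_section_claim K n g k 2 d 1 a b)).
Proof.
move=> /tagged_enum[e [ei [eK eiK]]] di0.
have e_bij : bijective e by exists ei.
have lt0 : (0 < d i0)%N by rewrite di0.
have lt1 : (1 < d i0)%N by rewrite di0.
pose r0 := Ordinal lt0; pose r1 := Ordinal lt1.
have r01 (r : 'I_(d i0)) : r = r0 \/ r = r1.
  case: r => [[|[|r]] lt]; [left|right|]; try exact: val_inj.
  by exfalso; move: lt; rewrite di0.
pose R r := Tagged (fun i => 'I_(d i)) (r : 'I_(d i0)).
pose j0 := lshift g (ei (R r0)); pose j1 := lshift g (ei (R r1)).
have j01 : j0 != j1.
  apply/eqP => /lshift_inj /(can_inj eiK) /eqP; rewrite -tag_eqE /tag_eq eqxx /= tagged_asE.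
  by rewrite -val_eqE.
have [a1 [a2 [/= un cover]]] := remaining_pair kg j01.
move: un; rewrite !inE !negb_or -!andbA => /and5P[_ j0a1 j0a2 j1a1 /and3P[j1a2 a12 _]].
have own j : tag (e j) = i0 -> lshift g j = j0 \/ lshift g j = j1.
  move=> tj; have [r rE] : exists r, e j = R r.
    by move: (e j) tj => [i r] /= E; subst i; exists r.
  by rewrite -[j]eK rE; case: (r01 r) => ->; [left|right].
have ej0 : e (ei (R r0)) = R r0 by rewrite eiK.
have ej1 : e (ei (R r1)) = R r1 by rewrite eiK.
have other j : tag (e j) != i0 -> lshift g j = a1 \/ lshift g j = a2.
  move=> tj; have := cover (lshift g j); rewrite !inE => /or4P[] /eqP E; [| |by left|by right].
    by move: tj; rewrite (lshift_inj E) ej0 eqxx.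
  by move: tj; rewrite (lshift_inj E) ej1 eqxx.
(* All cameras other than [i0] are equal in a witness, so it is immaterial how the two remaining
   forms are distributed over cameras and anchors. *)
pose C2 (u v : 'I_3 -> 'I_4) : arrangement K n 3 2 := fun i => cam_rows K (if i == i0 then u else v).
pose w4 T (x y z t : T) (i : 'I_(k + g)) := if i == j0 then x else if i == j1 then y
  else if i == a1 then z else t.
have w40 T (x y z t : T) : w4 _ x y z t j0 = x by rewrite /w4 eqxx.
have w41 T (x y z t : T) : w4 _ x y z t j1 = y by rewrite /w4 eq_sym (negbTE j01) eqxx.
have w42 T (x y z t : T) : w4 _ x y z t a1 = z.
  by rewrite /w4 ![a1 == _]eq_sym (negbTE j0a1) (negbTE j1a1) eqxx.
have w43 T (x y z t : T) : w4 _ x y z t a2 = t.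
  by rewrite /w4 ![a2 == _]eq_sym (negbTE j0a2) (negbTE j1a2) (negbTE a12).
have wit (u v : 'I_3 -> 'I_4) (s : 'I_4 -> 'I_3 * 'I_3) (c : 'I_4 -> 'I_6) :
    [/\ ((s 'f0).1 < (s 'f0).2)%N, ((s 'f1).1 < (s 'f1).2)%N,
      ((s 'f2).1 < (s 'f2).2)%N & ((s 'f3).1 < (s 'f3).2)%N] ->
    [/\ (u (s 'f0).1, u (s 'f0).2) = pair6 (c 'f0), (u (s 'f1).1, u (s 'f1).2) = pair6 (c 'f1),
      (v (s 'f2).1, v (s 'f2).2) = pair6 (c 'f2) & (v (s 'f3).1, v (s 'f3).2) = pair6 (c 'f3)] ->
    forall j, (fun t => let q := s (w4 _ 'f0 'f1 'f2 'f3 (lshift g (ei t))) in sel K q.1 q.2) (e j) *m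
      lam (C2 u v (tag (e j))) = delta_mx 0 (c (w4 _ 'f0 'f1 'f2 'f3 (lshift g j))).
  move=> [s0 s1 s2 s3] [E0 E1 E2 E3] j; rewrite /= eK /C2.
  have [tj|tj] := eqVneq (tag (e j)) i0.
    case: (own j tj) => ->; rewrite ?w40 ?w41 sel_lam //; apply: lam_cam_rows;
      by rewrite -?E0 -?E1.
  case: (other j tj) => ->; rewrite ?w42 ?w43 sel_lam //; apply: lam_cam_rows;
    by rewrite -?E2 -?E3.
have gG : gen (fun a : 'I_n * 'I_2.+1 * 'I_4 + 'I_g * 'I_4 * 'I_2 -> K =>
    gen (fun b => gram (line_forms (cam_data a) (anchor_data a ord0)
    (anchor_data a ord_max) b e) \in @unitmx K _)).
  apply: (gen_gram (h := 2) kg).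
  (* Camera [i0] with rows [e_0, e_1, e_2] supplies coordinates 0 and 1, the others with rows
     [e_1, e_2, e_3] supply 4 and 5: the set required by [gram_witness]. *)
  pose s (i : 'I_4) : 'I_3 * 'I_3 := match (i : nat) with
    | 0 => ('t0, 't1) | 1 => ('t0, 't2) | 2 => ('t0, 't2) | _ => ('t1, 't2) end.
  pose c (i : 'I_4) := nth 's0 [:: 's0; 's1; 's4; 's5] i.
  have H := wit (rows3 'f0 'f1 'f2) (rows3 'f1 'f2 'f3) s c.
  exists (C2 (rows3 'f0 'f1 'f2) (rows3 'f1 'f2 'f3)).
  exists (fun t => let q := s (w4 _ 'f0 'f1 'f2 'f3 (lshift g (ei t))) in sel K q.1 q.2).
  exists (fun i => c (w4 _ 'f0 'f1 'f2 'f3 i)); split; last by apply: H; split.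
    move=> i j; have := cover i; have := cover j; rewrite !inE.
    by do 2![case/or4P=> /eqP->]; rewrite ?w40 ?w41 ?w42 ?w43.
  by move=> i; have := cover i; rewrite !inE; case/or4P=> /eqP->; rewrite ?w40 ?w41 ?w42 ?w43.
pose F (C : arrangement K n 3 2) l l' (b : {i : 'I_n & ('I_(d i) * 'I_(nplucker 3))%type} -> K) :=
  wedge4 (plane_point (row a1 (line_forms C l l' b e)) (back_plane C b r0 r1))
         (plane_point (row a2 (line_forms C l l' b e)) (back_plane C b r0 r1)).
have gF i : gen (fun a : 'I_n * 'I_2.+1 * 'I_4 + 'I_g * 'I_4 * 'I_2 -> K => gen (fun b =>
    (lam_row (cam_data a i) 't0 't1 *m
      F (cam_data a) (anchor_data a ord0) (anchor_data a ord_max) b) 0 0 != 0)).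
  apply: (gen2_data (h := 2) (f := fun C l l' b => (lam_row (C i) 't0 't1 *m F C l l' b) 0 0)).
    move=> T C l l' b pC pl pl' pb.
    have pLF := polymx_line_data e pC pl pl' pb.
    have pB : polymx (fun x => back_plane (C x) (b x) r0 r1).
      by apply: polymx_mul; [apply: polymx_join_coef; apply: polymx_secrow|exact: pC].
    apply: polymx_mul; first exact: polymx_lam_row.
    by apply: polymx_wedge4; apply: polymx_plane_point => //; apply: polymx_row.
  (* Here the back-projected plane is [x_3 = 0], and the plane points of the remaining forms 3 and 1
     are [e_0] and [-e_1]. Every camera has [e_0, e_1] as its first two rows, so it sees their join
     in its first coordinate. *)
  pose s (i : 'I_4) : 'I_3 * 'I_3 := match (i : nat) with
    | 0 => ('t0, 't2) | 1 => ('t1, 't2) | 2 => ('t1, 't2) | _ => ('t0, 't2) end.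
  pose c (i : 'I_4) := nth 's0 [:: 's2; 's4; 's3; 's1] i.
  pose w t : 'rV[K]_(nplucker 3) :=
    let q := s (w4 _ 'f0 'f1 'f2 'f3 (lshift g (ei t))) in sel K q.1 q.2.
  have H j : w (e j) *m lam (C2 (rows3 'f0 'f1 'f3) (rows3 'f0 'f1 'f2) (tag (e j))) =
      delta_mx 0 (c (w4 _ 'f0 'f1 'f2 'f3 (lshift g j))) by apply: wit; split.
  have [l [l' lw]] := witness_rows (h := 2) (w := w) (g := g)
    (c := fun i => c (w4 _ 'f0 'f1 'f2 'f3 i)) H.
  exists (C2 (rows3 'f0 'f1 'f3) (rows3 'f0 'f1 'f2)), l, l', w => b bw.
  have LF := lw b bw; rewrite /F LF.
  have rowcE a x : w4 _ 'f0 'f1 'f2 'f3 a = x ->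
      row a (\matrix_(i, s0) (s0 == c (w4 'I_4 'f0 'f1 'f2 'f3 i))%:R : 'M[K]_(k + g, 6)) = delta_mx 0 (c x).
    by move=> <-; apply/rowP => t; rewrite !mxE eqxx.
  rewrite (rowcE a1 'f2) ?w42 // (rowcE a2 'f3) ?w43 //.
  have -> : back_plane (C2 (rows3 'f0 'f1 'f3) (rows3 'f0 'f1 'f2)) b r0 r1 = delta_mx 0 'f3.
    rewrite /back_plane !bw /w -/(R r0) -/(R r1) -/j0 -/j1 w40 w41 /= join_coef_sel -rowE /C2 eqxx.
    by apply/rowP => t; rewrite !mxE eqxx.
  rewrite plane_point3 plane_point1.
  have -> : lam_row (C2 (rows3 'f0 'f1 'f3) (rows3 'f0 'f1 'f2) i) 't0 't1 = delta_mx 0 's0.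
    by rewrite /C2; case: eqP => _; apply: lam_cam_rows.
  by rewrite -rowE !mxE /= mul0r subr0 mul1r oppr_eq0 oner_eq0.
have := gen_and gG (gen_forall gF); apply: gen_mono => a [Ga /gen_forall Fa].
apply: gen_mono (gen_and Ga Fa) => b [G_unit Fb] L cam LE.
set l := anchor_data a ord0; set l' := anchor_data a ord_max.
have lamF i : lam (cam_data a i) *m F (cam_data a) l l' b != 0.
  rewrite lam_eq0; apply: contraNneq (Fb i) => CX.
  by rewrite lam_rowE CX mxE.
have forms_cover (x : 'cV[K]_6) :
    secrow b (R r0) *m (lam (cam_data a i0) *m x) = 0 ->
    secrow b (R r1) *m (lam (cam_data a i0) *m x) = 0 ->
    row a1 (line_forms (cam_data a) l l' b e) *m x = 0 ->
    row a2 (line_forms (cam_data a) l l' b e) *m x = 0 ->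
    line_forms (cam_data a) l l' b e *m x = 0.
  move=> h0 h1 h2 h3; apply/row_matrixP => i; rewrite row_mul row0.
  have hj (r : 'I_(d i0)) : secrow b (R r) *m (lam (cam_data a i0) *m x) = 0 ->
      row (lshift g (ei (R r))) (line_forms (cam_data a) l l' b e) *m x = 0.
    move=> hr; apply/matrixP => o o'; rewrite !ord1 -row_mul mxE line_forms_mul col_mxEu.
    by rewrite camera_formsE eiK /= hr.
  have := cover i; rewrite !inE; case/or4P=> /eqP-> //; exact: hj.
have forms0 := plane_line_forms n_gt0 forms_cover lamF.
split; last exact: (one_point_section n_gt0 LE e_bij forms_cover lamF).
apply: (dim_line_variety n_gt0 LE kg G_unit forms0 _ lamF).
exact: wedge_isotropic.
Qed.

End DoubleSections.

(** * The multidegree functions *)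

Section PermOf.
Variables (n : nat) (d : 'I_n -> nat).

Lemma sumn_codom : (\sum_i d i = sumn (codom d))%N.
Proof. by rewrite sumnE big_map enumT. Qed.

Lemma perm_of_sum t : is_perm_of d t -> (\sum_i d i = sumn t)%N.
Proof.
by rewrite sumn_codom => /perm_sumn ->; rewrite sumn_cat sumn_nseq mul0n addn0.
Qed.

Lemma perm_of_mem t x : is_perm_of d t -> x != 0%N -> [exists i, d i == x] = (x \in t).
Proof.
move=> /perm_mem E x0; have := E x; rewrite mem_cat mem_nseq (negbTE x0) andbF orbF => <-.
by apply/existsP/codomP => [[i /eqP <-]|[i ->]]; exists i.
Qed.

Lemma perm_of_lt t m : is_perm_of d t -> (0 < m)%N -> all (ltn^~ m) t -> forall i, (d i < m)%N.
Proof.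
move=> /perm_mem E m0 /allP tm i; have := E (d i).
rewrite codom_f mem_cat mem_nseq => /esym/orP[/tm//|/andP[_ /eqP->//]].
Qed.

Lemma perm_small (s : seq nat) : all (ltn^~ 3) s ->
  perm_eq s (nseq (count_mem 2 s) 2 ++ nseq (count_mem 1 s) 1 ++ nseq (count_mem 0 s) 0)%N.
Proof.
move=> s3; apply/seq.permP => a; rewrite !count_cat !count_nseq.
elim: s s3 => [_|x s IH /= /andP[x3 /IH ->]]; first by rewrite /= !muln0.
by case: x x3 => [|[|[|//]]] _ /=; case: (a _); lia.
Qed.

Lemma perm_of_small : (forall i, d i < 3)%N -> exists p q,
  (\sum_i d i = q + 2 * p)%N /\ is_perm_of d (nseq p 2 ++ nseq q 1).
Proof.
move=> d3; set s := codom d; have s3 : all (ltn^~ 3) s by apply/allP => x /codomP[i ->]; apply: d3.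
exists (count_mem 2 s), (count_mem 1 s); have ps := perm_small s3.
split.
  rewrite sumn_codom (perm_sumn ps) !sumn_cat !sumn_nseq; lia.
rewrite /is_perm_of -/s; have := perm_size ps.
rewrite !size_cat !size_nseq size_codom card_ord => nE.
by rewrite -catA (_ : n - _ = count_mem 0 s)%N //; lia.
Qed.

End PermOf.

Section Lines.
Local Open Scope classical_set_scope.
Local Open Scope card_scope.
Local Open Scope ring_scope.
Variable K : numClosedFieldType.
Variables (n g k : nat).
Hypotheses (n_gt0 : (0 < n)%N) (kg : (k + g = 4)%N).

(** Only finitely many [d] are in range, so their generic sets can be intersected. The dimension
    does not involve the section, hence one generic section provides it. *)
Lemma lines_generic h (c : {ffun 'I_n -> 'I_(nplucker h.+1)} -> nat)
    (P : arrangement K n 3 h -> ('I_g -> grass K 2 4) -> Prop) :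
  (forall d : {ffun 'I_n -> 'I_(nplucker h.+1)}, (\sum_i d i = k)%N ->
    gen (fun a => gen (fun b => @line_section_claim K n g k h (fun i => d i) (c d) a b))) ->
  (forall C L, (forall d : {ffun 'I_n -> 'I_(nplucker h.+1)}, (\sum_i d i = k)%N ->
    dim_is (line_variety C L) k /\ multideg (line_variety C L) (fun i => d i) (c d)) -> P C L) ->
  @generic_anchored K n h g P.
Proof.
move=> Hd HP; apply: gen_generically.
have := gen_forall (fun d => gen_imp (Hd d)); apply: gen_mono => a Ha C B L cam LB _.
apply: HP => d dk.
have LE j : val (L j) = <<[:: anchor_data a ord0 j; anchor_data a ord_max j]>>%VS.
  by rewrite LB; apply: limg_columns => r; rewrite !mxE.
have [b claim] := gen_ex (Ha d dk); have [dimX _] := claim L cam LE.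
split=> //; apply: multideg_gen.
  by split=> [|i]; [rewrite dk|exact: ltn_ord].
by apply: gen_mono (Ha d dk) => b' claim' _; have [_ ] := claim' L cam LE.
Qed.

Lemma lines3_generic :
  @generic_anchored K n 3 g (fun C L => multideg_constant (line_variety C L) 2).
Proof.
apply: (lines_generic (c := fun=> 2%N)) => [d dk|C L H].
  exact: line_sections3 n_gt0 kg _ dk.
have np : nplucker 4 = 6%N := nplucker4.
have [d dk] : exists d : {ffun 'I_n -> 'I_(nplucker 4)}, (\sum_i d i = k)%N.
  by rewrite np; apply: bounded_composition; move: n_gt0 kg; case: (n) => // ?; lia.
have [dimX mX] := H d dk; split; first by have [dom _] := mX; exists (fun i => d i).
move=> d' [dim' lt']; have dk' := dim_is_unique dim' dimX.
pose d2 : {ffun 'I_n -> 'I_(nplucker 4)} := [ffun i => Ordinal (lt' i)].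
have dE : d' = (fun i => d2 i : nat) by apply/funext => i; rewrite ffunE.
have d2k : (\sum_i d2 i = k)%N by rewrite -dk' dE.
by rewrite dE; have [] := H d2 d2k.
Qed.

Definition double_count (d : {ffun 'I_n -> 'I_(nplucker 3)}) : nat :=
  (if [exists i, d i == 2 :> nat] then 1 else 2)%N.

Lemma lines2_generic (P : arrangement K n 3 2 -> ('I_g -> grass K 2 4) -> Prop) :
  (forall C L, (forall d : 'I_n -> nat, (\sum_i d i = k)%N -> (forall i, d i < 3)%N ->
     dim_is (line_variety C L) k /\
     multideg (line_variety C L) d (if [exists i, d i == 2] then 1 else 2)%N) -> P C L) ->
  @generic_anchored K n 2 g P.
Proof.
have np : nplucker 3 = 3%N := nplucker3.
move=> HP; apply: (lines_generic (c := double_count)) => [d dk|C L H].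
  rewrite /double_count; have [/existsP[i /eqP di]|/existsPn nd] := boolP [exists i, d i == 2 :> nat]%N.
    exact: line_sections2_double n_gt0 kg _ _ dk di.
  have d1 i : (d i <= 1)%N.
    have := nd i; have := ltn_ord (d i); move: (d i : nat) => x; rewrite np; lia.
  exact: line_sections2_distinct n_gt0 kg _ dk d1.
apply: HP => d dk d3; have d3' i : (d i < nplucker 3)%N by rewrite np.
pose d2 : {ffun 'I_n -> 'I_(nplucker 3)} := [ffun i => Ordinal (d3' i)].
have dE : d = (fun i => d2 i : nat) by apply/funext => i; rewrite ffunE.
have d2k : (\sum_i d2 i = k)%N by rewrite -dk dE.
have [dimX mX] := H d2 d2k; split=> //.
move: mX; rewrite -dE; congr multideg; rewrite /double_count.
by congr (if _ then _ else _); apply: eq_existsb => i; rewrite ffunE.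
Qed.

Definition lines2_facts (X : set (mpspace K n (nplucker 3))) : Prop :=
  forall d : 'I_n -> nat, (\sum_i d i = k)%N -> (forall i, d i < 3)%N ->
     dim_is X k /\ multideg X d (if [exists i, d i == 2] then 1 else 2)%N.

Lemma lines2_at X t : lines2_facts X -> sumn t = k -> all (ltn^~ 3) t ->
  multideg_at X t (if 2 \in t then 1 else 2)%N.
Proof.
move=> HX tk t3 d dt.
have [_] := HX d (etrans (perm_of_sum dt) tk) (perm_of_lt (m := 3) dt isT t3).
by rewrite (perm_of_mem dt).
Qed.

(** The bound [k <= n * 2] yields at least one admissible tuple, and through it the dimension [k],
    which fixes the sum of the entries. *)
Lemma lines2_only X (ts : seq (seq nat)) : lines2_facts X -> (k <= n * 2)%N ->
  (forall p q, (q + 2 * p = k)%N -> nseq p 2 ++ nseq q 1 \in ts)%N ->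
  multideg_only X ts.
Proof.
move=> HX kn Hts d [dimd dlt].
have [d0 d0k] := bounded_composition n_gt0 kn.
have [dimX _] := HX (fun i => d0 i) d0k (fun i => ltn_ord _).
have dk := dim_is_unique dimd dimX.
have [|p [q [sE pE]]] := @perm_of_small n d; first by move=> i; have := dlt i; rewrite [nplucker 3]nplucker3.
by apply/hasP; exists (nseq p 2 ++ nseq q 1)%N => //; apply: Hts; rewrite -sE.
Qed.

End Lines.

Theorem proposition5p1 (R : realType) (n : nat) (n_gt0 : (0 < n)%N) :
  (forall N h : nat,
     (N, h) \in [:: (3, 3); (3, 2); (3, 1); (2, 2); (2, 1); (1, 1)]%N ->
     @generic_cameras R[i] n N h (fun C =>
       multideg_constant (point_variety C) 1)) /\
  (forall g : nat, (g <= 3)%N ->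
     @generic_anchored R[i] n 3 g (fun C L =>
       multideg_constant (line_variety C L) 2)) /\
  @generic_anchored R[i] n 2 0 (fun C L =>
     let X := line_variety C L in
     multideg_at X [:: 2; 2]%N 1 /\
     multideg_at X [:: 2; 1; 1]%N 1 /\
     multideg_at X [:: 1; 1; 1; 1]%N 2 /\
     ((1 < n)%N ->
       multideg_only X [:: [:: 2; 2]; [:: 2; 1; 1]; [:: 1; 1; 1; 1]]%N)) /\
  @generic_anchored R[i] n 2 1 (fun C L =>
     let X := line_variety C L in
     multideg_at X [:: 2; 1]%N 1 /\
     multideg_at X [:: 1; 1; 1]%N 2 /\
     ((1 < n)%N -> multideg_only X [:: [:: 2; 1]; [:: 1; 1; 1]]%N)) /\
  @generic_anchored R[i] n 2 2 (fun C L =>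
     let X := line_variety C L in
     multideg_at X [:: 2]%N 1 /\
     multideg_at X [:: 1; 1]%N 2 /\
     multideg_only X [:: [:: 2]; [:: 1; 1]]%N) /\
  @generic_anchored R[i] n 2 3 (fun C L =>
     let X := line_variety C L in
     multideg_at X [:: 1]%N 2 /\
     multideg_only X [:: [:: 1]]%N).
Proof.
split; first by move=> N h; apply: points_generic.
split; first by move=> g g3; apply: lines3_generic n_gt0 (subnK (leqW g3)).
split.
  apply: (@lines2_generic _ n 0 4) => // C L H X.
  split; first exact: lines2_at H _ _.
  split; first exact: lines2_at H _ _.
  split; first exact: lines2_at H _ _.
  move=> n1; apply: (lines2_only n_gt0 (k := 4) H); first by lia.
  move=> [|[|[|p]]] q E; [have -> : q = 4%N by lia|have -> : q = 2%N by lia|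
    have -> : q = 0%N by lia|lia] => //.
split.
  apply: (@lines2_generic _ n 1 3) => // C L H X.
  split; first exact: lines2_at H _ _.
  split; first exact: lines2_at H _ _.
  move=> n1; apply: (lines2_only n_gt0 (k := 3) H); first by lia.
  move=> [|[|p]] q E; [have -> : q = 3%N by lia|have -> : q = 1%N by lia|lia] => //.
split.
  apply: (@lines2_generic _ n 2 2) => // C L H X.
  split; first exact: lines2_at H _ _.
  split; first exact: lines2_at H _ _.
  apply: (lines2_only n_gt0 (k := 2) H); first by lia.
  move=> [|[|p]] q E; [have -> : q = 2%N by lia|have -> : q = 0%N by lia|lia] => //.
apply: (@lines2_generic _ n 3 1) => // C L H X.
split; first exact: lines2_at H _ _.
apply: (lines2_only n_gt0 (k := 1) H); first by lia.
move=> [|p] q E; [have -> : q = 1%N by lia|lia] => //.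
Qed.
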